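(* Let $n\in\mathbb{R}$ and $\ell=-\frac12+i\lambda$ with $\lambda\in\mathbb{R}$ be fixed. Then $$\sup\Bigl\{\ \Bigl|\,\mathfrak{P}_{mn}^{\ell}(x)-\frac{(-1)^{m-n}}{m^{\ell+1}\,\Gamma(n-\ell)}\,W_{n,\,i\lambda}\Bigl(\frac{2m}{x}\Bigr)\Bigr|\;x^{\frac12}\,m^{2}\ :\ x\in\mathbb{R},\ x\ge 1,\ m\in n+\mathbb{N}_0,\ m>0\ \Bigr\}$$ is finite.
   Context: $\mathbb{N}_0=\{0,1,2,\dots\}$. Coefficient functions: let $\ell=-\frac12+i\lambda$, $\lambda\in\mathbb{R}$. For $m\in\mathbb{R}$ define $\mathbf{e}_m\in L^2(\mathbb{R})$ by $\mathbf{e}_m(t)=\frac{1}{\sqrt{\pi}}\,e^{-i\pi m}\,e^{2im\arctan t}\,(t^2+1)^{\ell}$ (for each $\epsilon\in\mathbb{R}$, the family $(\mathbf{e}_m)_{m\in\epsilon+\mathbb{Z}}$ is an orthonormal basis of $L^2(\mathbb{R})$). For $m,n\in\mathbb{R}$ with $m-n\in\mathbb{Z}$ and $x\ge1$, write $x=\cosh 2\tau$ with the unique $\tau\ge 0$ and put $$\mathfrak{P}_{mn}^{\ell}(x)=\int_{\mathbb{R}} e^{-2\ell\tau}\,\mathbf{e}_n(e^{2\tau}t)\,\overline{\mathbf{e}_m(t)}\,dt .$$ These are the matrix coefficients, with respect to $(\mathbf{e}_m)$, of the principal series operators $f\mapsto e^{-2\ell\tau}f(e^{2\tau}\cdot)$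 representing $\mathrm{diag}(e^{\tau},e^{-\tau})$. Whittaker function: for $\mathrm{Re}\,z>0$ and $\mathrm{Re}(\rho-\nu+\frac12)>0$, $$W_{\nu,\rho}(z)=\frac{z^{\rho+\frac12}e^{-z/2}}{\Gamma(\rho-\nu+\frac12)}\int_0^\infty e^{-zu}\,u^{\rho-\nu-\frac12}(1+u)^{\rho+\nu-\frac12}\,du ,$$ extended by analytic continuation to all $\nu,\rho\in\mathbb{C}$ and $z\in\mathbb{C}\setminus\,]-\infty,0]$. Convention: $\frac{1}{\Gamma}$ is the entire function, i.e. $\frac1{\Gamma(t)}=0$ for $t=0,-1,-2,\dots$ (this matters only for $\ell=-\frac12$ and $n\in\{-\frac12,-\frac32,\dots\}$). *)

(* Defs.v *)
From Stdlib Require Import Reals ZArith Lra.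
From Coquelicot Require Import Coquelicot.
Open Scope R_scope.

Definition Cexp (z : C) : C :=
  (exp (Re z) * cos (Im z), exp (Re z) * sin (Im z)).

(* C minus the closed negative real half-line. *)
Definition slit_plane (z : C) : Prop := 0 < Re z \/ Im z <> 0.

(* Principal logarithm on [slit_plane]: by the half-angle formula, the second
   component is the argument in ]-PI, PI[. *)
Definition Clog (z : C) : C :=
  (ln (Cmod z), 2 * atan (Im z / (Cmod z + Re z))).

(* Principal power with complex exponent ([Cpow] has exponents in [nat]). *)
Definition Cpower (z s : C) : C := Cexp (s * Clog z)%C.

(* All the integrands integrated below are continuous and absolutely
   integrable, so these improper Riemann integrals are the Lebesgue ones. *)
Definition CInt_line (f : R -> C) : C :=
  RInt_gen (V := C_R_CompleteNormedModule) f
    (Rbar_locally m_infty) (Rbar_locally p_infty).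

Definition CInt_pos (f : R -> C) : C :=
  RInt_gen (V := C_R_CompleteNormedModule) f
    (at_right 0) (Rbar_locally p_infty).

(* Euler's integral; meaningful for 0 < Re s. *)
Definition Gamma_Euler (s : C) : C :=
  CInt_pos (fun u => (Cexp (- RtoC u) * Cpower (RtoC u) (s - RtoC 1))%C).

Fixpoint rising (s : C) (N : nat) : C :=
  match N with
  | O => RtoC 1
  | S N' => (rising s N' * (s + RtoC (INR N')))%C
  end.

(* The entire function 1 / Gamma: the shift N satisfies 0 < Re s + N, and
   1 / Gamma s = s (s + 1) ... (s + N - 1) / Gamma (s + N). *)
Definition rGamma (s : C) : C :=
  let N := Z.to_nat (up (- Re s)) in
  (rising s N / Gamma_Euler (s + RtoC (INR N)))%C.

Definition basis_e (l : C) (m t : R) : C :=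
  (RtoC (/ sqrt PI) * Cexp (- (Ci * RtoC (PI * m)))
   * Cexp (Ci * RtoC (2 * m * atan t)) * Cpower (RtoC (t ^ 2 + 1)) l)%C.

(* The tau >= 0 such that x = cosh (2 tau), for 1 <= x. *)
Definition tau (x : R) : R := ln (x + sqrt (x ^ 2 - 1)) / 2.

Lemma tau_spec (x : R) : 1 <= x ->
  0 <= tau x /\ cosh (2 * tau x) = x /\
  forall t, 0 <= t -> cosh (2 * t) = x -> t = tau x.
Proof.
intros Hx.
assert (Hq : 0 <= x ^ 2 - 1) by nra.
assert (Hs := sqrt_pos (x ^ 2 - 1)).
assert (Hss := sqrt_sqrt _ Hq).
set (s := sqrt (x ^ 2 - 1)) in *.
assert (Hp : 1 <= x + s) by lra.
assert (Hi : / (x + s) = x - s)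
  by (apply Rmult_eq_reg_l with (x + s); [rewrite Rinv_r|]; nra).
assert (Ht : 2 * tau x = ln (x + s)) by (unfold tau, s; field).
split; [|split].
- assert (0 <= ln (x + s)); [|lra].
  rewrite <- ln_1.
  destruct (Req_dec (x + s) 1) as [-> | Hne]; [lra|].
  left; apply ln_increasing; lra.
- rewrite Ht; unfold cosh; rewrite exp_Ropp, exp_ln, Hi by lra; field.
- intros t Ht0 Hc.
  unfold cosh in Hc; rewrite exp_Ropp in Hc.
  assert (Hy : 1 <= exp (2 * t)) by (generalize (exp_ineq1_le (2 * t)); lra).
  set (y := exp (2 * t)) in *.
  assert (Hyi : y * / y = 1) by (apply Rinv_r; lra).
  assert (Hyl : / y <= 1) by (rewrite <- Rinv_1; apply Rinv_le_contravar; lra).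
  assert (Hd : (y - x) * (y - x) = x ^ 2 - 1) by nra.
  assert (Hsy : s = y - x)
    by (unfold s; rewrite <- Hd; apply sqrt_square; lra).
  assert (2 * t = 2 * tau x); [|lra].
  rewrite Ht, Hsy.
  replace (x + (y - x)) with y by ring.
  unfold y; symmetry; apply ln_exp.
Qed.

Definition coefP (l : C) (m n x : R) : C :=
  CInt_line (fun t =>
    (Cexp (- (RtoC 2 * l * RtoC (tau x)))
     * basis_e l n (exp (2 * tau x) * t) * Cconj (basis_e l m t))%C).

Definition analytic_at (f : C -> C) (z0 : C) : Prop :=
  exists (a : nat -> C) (r : R), 0 < r /\
    forall z : C, Cmod (z - z0) < r ->
      is_pseries (K := C_AbsRing) (V := C_NormedModule) a (z - z0)%C (f z).

(* Meaningful for 0 < Re z and 0 < Re (rho - nu + 1/2). *)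
Definition whittaker_int (nu rho z : C) : C :=
  (Cpower z (rho + RtoC (/ 2)) * Cexp (- (z / RtoC 2))
   * rGamma (rho - nu + RtoC (/ 2))
   * CInt_pos (fun u =>
       Cexp (- (z * RtoC u))
       * Cpower (RtoC u) (rho - nu - RtoC (/ 2))
       * Cpower (RtoC (1 + u)) (rho + nu - RtoC (/ 2))))%C.

(* W, as a function of (nu, rho, z), is the analytic continuation of
   [whittaker_int] to C x C x slit_plane.  Analyticity is required in each
   variable separately, which is equivalent to joint analyticity (Hartogs) and
   determines W on that domain: continue first in nu, for Re z > 0, then
   in z. *)
Definition is_whittaker_W (W : C -> C -> C -> C) : Prop :=
  (forall nu rho z : C, 0 < Re z -> 0 < Re (rho - nu + RtoC (/ 2)) ->
     W nu rho z = whittaker_int nu rho z) /\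
  (forall nu rho z : C, slit_plane z ->
     analytic_at (fun nu' => W nu' rho z) nu /\
     analytic_at (fun rho' => W nu rho' z) rho /\
     analytic_at (fun z' => W nu rho z') z).

(* Main.v *)
(* Substituting [t = tan (th / 2)], the matrix coefficient is, up to the sign
   [(-1) ^ (m - n)], the [(m - n)]-th Fourier coefficient of
   [(ch tau) ^ (2 l) * (1 - r z) ^ (l - n) * (1 - r / z) ^ (l + n)], with [r = tanh tau].
   Expand both powers.  For [n < 1/2] the binomial coefficients of
   [(1 - w) ^ (l - n)] are Beta integrals, up to the factor
   [1 / (Gamma (n - l) * Gamma (l - n + 1))], and summing under the integral gives
   (with [tanh s = 1 / x], [e ^ (- s) = r])
     [P = +- 2 ^ (l + 1) / (Gamma (n - l) * Gamma (l - n + 1)) * (sinh s) ^ (- l)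
          * int_0^oo e ^ (- m (2 u + s)) * (sinh u) ^ (l - n) * (sinh (u + s)) ^ (l + n) du].
   Replacing [s] by [1 / x] and [sinh] by the identity turns this integral into the
   one that defines [W], at [2 m / x].  The logarithms of the two integrands differ by
   [O ((u + s) ^ 2 + m (u + s) ^ 3)], hence the integrals by [O (m ^ -2 x ^ (-1/2))], with a
   factor that decays exponentially in [m / x] for [x >= 2].  That decay carries the
   estimate from [n - 1] and [n] to [n + 1] along the three-term recurrences of [P]
   and of [W], which have the same shape; for [W] the recurrence is continued
   analytically in the first parameter.  For [1 <= x <= 2] both terms decay
   exponentially in [m]. *)

Require Import Defs.
From Stdlib Require Import Reals Lra Lia Psatz ZArith.
From Coquelicot Require Import Coquelicot.
Open Scope R_scope.

(** The base range is [n < 1/2] because the exponent [l - n] of the integrand at 0 has real part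
    [-1/2 - n], which must exceed -1. Both recurrences keep [m] fixed: they link [(n + 1, k)],
    [(n, k + 1)] and [(n - 1, k + 2)]. Their middle coefficient grows like [m / x], so an error
    bound that is merely uniform would be lost at each step, whereas a bound with exponential decay
    in [m / x] only loses half of its rate. The middle coefficients differ by the factor
    [x / sinh (2 tau) = 1 + O (x^-2)]; the weight [m^2] is compatible with this discrepancy because
    [m^2 x^-2 = (m / x)^2]. Near [x = 1] that factor blows up, so the recurrence of the error is run
    on [x >= 2] only, and on [[1, 2]] the coefficient is bounded through its power series. The step
    to [n + 1] divides by [n - l], which vanishes only for [lambda = 0] and [n = -1/2]; in that case
    both terms at [n = 1/2] are elementary functions and are compared directly. *)

(** * Complex numbers and their exponential *)

Lemma Cmod_le_parts (z : C) (M : R) : Rabs (Re z) <= M -> Rabs (Im z) <= M -> Cmod z <= 2 * M.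
Proof.
intros H1 H2; unfold Cmod.
assert (0 <= M) by (generalize (Rabs_pos (Re z)); lra).
rewrite <- (sqrt_square (2 * M)) by lra.
apply sqrt_le_1_alt; fold (Re z); fold (Im z).
assert (Re z * Re z <= M * M) by (rewrite <- (Rabs_right M) in H1 by lra; generalize (Rsqr_le_abs_1 _ _ H1); unfold Rsqr; lra).
assert (Im z * Im z <= M * M) by (rewrite <- (Rabs_right M) in H2 by lra; generalize (Rsqr_le_abs_1 _ _ H2); unfold Rsqr; lra).
simpl; nra.
Qed.

Lemma Im_Cmod (z : C) : Rabs (Im z) <= Cmod z.
Proof. exact (Rle_trans _ _ _ (Rmax_r _ _) (Rmax_Cmod z)). Qed.

Lemma C_eq (z w : C) : Re z = Re w -> Im z = Im w -> z = w.
Proof. destruct z, w; simpl; congruence. Qed.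

Lemma Cexp_plus (z w : C) : Cexp (z + w)%C = (Cexp z * Cexp w)%C.
Proof.
destruct z as [a b], w as [c d]; unfold Cexp, Cplus, Cmult; simpl.
rewrite exp_plus, cos_plus, sin_plus; f_equal; ring.
Qed.

Lemma Cexp_0 : Cexp 0 = (RtoC 1).
Proof. unfold Cexp; simpl; rewrite exp_0, cos_0, sin_0; unfold RtoC; f_equal; ring. Qed.

Lemma Cmod_Cexp (z : C) : Cmod (Cexp z) = exp (Re z).
Proof.
unfold Cexp, Cmod; cbn [fst snd].
replace ((exp (Re z) * cos (Im z)) ^ 2 + (exp (Re z) * sin (Im z)) ^ 2)
  with (exp (Re z) * exp (Re z) * (Rsqr (sin (Im z)) + Rsqr (cos (Im z)))) by (unfold Rsqr; ring).
rewrite sin2_cos2, Rmult_1_r; apply sqrt_square; left; apply exp_pos.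
Qed.

Lemma Cexp_neq_0 (z : C) : Cexp z <> RtoC 0.
Proof.
intros H; generalize (exp_pos (Re z)); rewrite <- Cmod_Cexp, H, Cmod_0; lra.
Qed.

Lemma Cexp_opp (z : C) : Cexp (- z)%C = (/ Cexp z)%C.
Proof.
assert (H := Cexp_neq_0 z).
assert (E : (Cexp z * Cexp (- z) = 1)%C).
{ rewrite <- Cexp_plus; replace (z + - z)%C with (RtoC 0) by ring; apply Cexp_0. }
replace (Cexp (- z)) with ((/ Cexp z) * (Cexp z * Cexp (- z)))%C by (field; exact H).
rewrite E; ring.
Qed.

Lemma Cexp_conj (z : C) : Cconj (Cexp z) = Cexp (Cconj z).
Proof.
destruct z as [a b]; unfold Cconj, Cexp; simpl; rewrite cos_neg, sin_neg; f_equal; ring.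
Qed.

Lemma Cexp_real (x : R) : Cexp (RtoC x) = RtoC (exp x).
Proof. unfold Cexp, RtoC; simpl; rewrite cos_0, sin_0; f_equal; ring. Qed.

Lemma Cexp_pow (z : C) (k : nat) : Cexp (RtoC (INR k) * z)%C = (Cexp z ^ k)%C.
Proof.
induction k as [|k IH].
- simpl; replace (RtoC 0 * z)%C with (RtoC 0) by ring; apply Cexp_0.
- rewrite S_INR, RtoC_plus; simpl Cpow; rewrite <- IH, <- Cexp_plus; f_equal; ring.
Qed.

Lemma Cpower_pos (x : R) (s : C) : 0 < x -> Cpower (RtoC x) s = Cexp (s * RtoC (ln x))%C.
Proof.
intros Hx; unfold Cpower, Clog; rewrite Cmod_R, Rabs_right by lra.
do 2 f_equal; simpl; unfold RtoC; f_equal.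
replace (0 / (x + x)) with 0 by (field; lra); rewrite atan_0; ring.
Qed.

(** * Differentiation of complex functions of a real variable *)

(** Componentwise, so that the real mean value theorem and the real fundamental theorem of calculus
    apply to each part. *)
Definition Cder (f : R -> C) (x : R) (d : C) : Prop :=
  is_derive (fun t => Re (f t)) x (Re d) /\ is_derive (fun t => Im (f t)) x (Im d).

Lemma Cder_eq (f : R -> C) (x : R) (d d' : C) : Cder f x d -> d = d' -> Cder f x d'.
Proof. intros H <-; exact H. Qed.

Lemma Cder_ext_loc (f g : R -> C) (x : R) (d : C) :
  locally x (fun t => f t = g t) -> Cder f x d -> Cder g x d.
Proof.
intros H [H1 H2]; split.
- apply is_derive_ext_loc with (2 := H1); revert H; apply filter_imp; intros y ->; reflexivity.
- apply is_derive_ext_loc with (2 := H2); revert H; apply filter_imp; intros y ->; reflexivity.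
Qed.

Lemma Cder_ext (f g : R -> C) (x : R) (d : C) :
  (forall t, f t = g t) -> Cder f x d -> Cder g x d.
Proof. intros H; apply Cder_ext_loc, filter_forall, H. Qed.

Lemma Cder_const (c : C) (x : R) : Cder (fun _ => c) x (RtoC 0).
Proof. split; apply @is_derive_const. Qed.

Lemma Cder_plus (f g : R -> C) (x : R) (df dg : C) :
  Cder f x df -> Cder g x dg -> Cder (fun t => f t + g t)%C x (df + dg)%C.
Proof. intros [H1 H2] [H3 H4]; split.
- exact (is_derive_plus (fun t => Re (f t)) (fun t => Re (g t)) x _ _ H1 H3).
- exact (is_derive_plus (fun t => Im (f t)) (fun t => Im (g t)) x _ _ H2 H4). Qed.

Lemma is_derive_mult_R (f g : R -> R) (x df dg : R) :
  is_derive f x df -> is_derive g x dg -> is_derive (fun t => f t * g t) x (df * g x + f x * dg).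
Proof. intros H1 H2; apply (is_derive_mult f g x df dg H1 H2 Rmult_comm). Qed.

Lemma Cder_mult (f g : R -> C) (x : R) (df dg : C) :
  Cder f x df -> Cder g x dg -> Cder (fun t => f t * g t)%C x (df * g x + f x * dg)%C.
Proof.
intros [H1 H2] [H3 H4]; split.
- replace (Re (df * g x + f x * dg)%C)
    with ((Re df * Re (g x) + Re (f x) * Re dg) - (Im df * Im (g x) + Im (f x) * Im dg))
    by (unfold Re, Im, Cplus, Cmult; simpl; ring).
  exact (is_derive_minus (fun t => Re (f t) * Re (g t)) (fun t => Im (f t) * Im (g t)) x _ _
    (is_derive_mult_R _ _ _ _ _ H1 H3) (is_derive_mult_R _ _ _ _ _ H2 H4)).
- replace (Im (df * g x + f x * dg)%C)
    with ((Re df * Im (g x) + Re (f x) * Im dg) + (Im df * Re (g x) + Im (f x) * Re dg))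
    by (unfold Re, Im, Cplus, Cmult; simpl; ring).
  exact (is_derive_plus (fun t => Re (f t) * Im (g t)) (fun t => Im (f t) * Re (g t)) x _ _
    (is_derive_mult_R _ _ _ _ _ H1 H4) (is_derive_mult_R _ _ _ _ _ H2 H3)).
Qed.

Lemma Cder_scal (c : C) (f : R -> C) (x : R) (d : C) :
  Cder f x d -> Cder (fun t => c * f t)%C x (c * d)%C.
Proof.
intros H; eapply Cder_eq; [exact (Cder_mult _ _ _ _ _ (Cder_const c x) H)|cbv beta; ring].
Qed.

Lemma Cder_RtoC (f : R -> R) (x d : R) : is_derive f x d -> Cder (fun t => RtoC (f t)) x (RtoC d).
Proof. intros H; split; [exact H|exact (is_derive_const (0 : R) x)]. Qed.

Lemma Cder_Cexp (f : R -> C) (x : R) (d : C) :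
  Cder f x d -> Cder (fun t => Cexp (f t)) x (d * Cexp (f x))%C.
Proof.
intros [H1 H2].
assert (He : is_derive (fun t => exp (Re (f t))) x (Re d * exp (Re (f x))))
  by (apply (is_derive_comp exp _ x _ _ (is_derive_exp _) H1)).
assert (Hc : is_derive (fun t => cos (Im (f t))) x (Im d * - sin (Im (f x))))
  by (apply (is_derive_comp cos _ x _ _ (is_derive_cos _) H2)).
assert (Hs : is_derive (fun t => sin (Im (f t))) x (Im d * cos (Im (f x))))
  by (apply (is_derive_comp sin _ x _ _ (is_derive_sin _) H2)).
split.
- replace (Re (d * Cexp (f x))%C)
    with (Re d * exp (Re (f x)) * cos (Im (f x)) + exp (Re (f x)) * (Im d * - sin (Im (f x))))
    by (unfold Cexp, Re, Im, Cmult; simpl; ring).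
  apply (is_derive_mult_R _ _ _ _ _ He Hc).
- replace (Im (d * Cexp (f x))%C)
    with (Re d * exp (Re (f x)) * sin (Im (f x)) + exp (Re (f x)) * (Im d * cos (Im (f x))))
    by (unfold Cexp, Re, Im, Cmult; simpl; ring).
  apply (is_derive_mult_R _ _ _ _ _ He Hs).
Qed.

Definition Ccont (f : R -> C) (x : R) : Prop :=
  continuous (fun t => Re (f t)) x /\ continuous (fun t => Im (f t)) x.

Lemma Cder_Ccont (f : R -> C) (x : R) (d : C) : Cder f x d -> Ccont f x.
Proof. intros [H1 H2]; split; apply @ex_derive_continuous; eexists; eassumption. Qed.

Lemma Ccont_ext_loc (f g : R -> C) (x : R) :
  locally x (fun t => f t = g t) -> Ccont f x -> Ccont g x.
Proof.
intros H [H1 H2]; split.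
- apply continuous_ext_loc with (2 := H1); revert H; apply filter_imp; intros y ->; reflexivity.
- apply continuous_ext_loc with (2 := H2); revert H; apply filter_imp; intros y ->; reflexivity.
Qed.

Lemma Ccont_plus (f g : R -> C) (x : R) : Ccont f x -> Ccont g x -> Ccont (fun t => f t + g t)%C x.
Proof.
intros [H1 H2] [H3 H4]; split.
- exact (continuous_plus (fun t => Re (f t)) (fun t => Re (g t)) x H1 H3).
- exact (continuous_plus (fun t => Im (f t)) (fun t => Im (g t)) x H2 H4).
Qed.

Lemma Ccont_mult (f g : R -> C) (x : R) : Ccont f x -> Ccont g x -> Ccont (fun t => f t * g t)%C x.
Proof.
intros [H1 H2] [H3 H4]; split.
- exact (continuous_minus (fun t => Re (f t) * Re (g t)) (fun t => Im (f t) * Im (g t)) x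
    (continuous_mult _ _ x H1 H3) (continuous_mult _ _ x H2 H4)).
- exact (continuous_plus (fun t => Re (f t) * Im (g t)) (fun t => Im (f t) * Re (g t)) x
    (continuous_mult _ _ x H1 H4) (continuous_mult _ _ x H2 H3)).
Qed.

Lemma Ccont_const (c : C) (x : R) : Ccont (fun _ => c) x.
Proof. exact (Cder_Ccont _ _ _ (Cder_const c x)). Qed.

Lemma MVT_bound (f df : R -> R) (a b M : R) : a <= b ->
  (forall t, a <= t <= b -> is_derive f t (df t)) ->
  (forall t, a <= t <= b -> Rabs (df t) <= M) -> Rabs (f b - f a) <= M * (b - a).
Proof.
intros Hab Hd HM.
destruct (MVT_gen f a b df) as [c [Hc ->]].
- intros t Ht; rewrite Rmin_left, Rmax_right in Ht by lra; apply Hd; lra.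
- intros t Ht; rewrite Rmin_left, Rmax_right in Ht by lra.
  apply continuity_pt_filterlim, (ex_derive_continuous f t); eexists; apply Hd; lra.
- rewrite Rmin_left, Rmax_right in Hc by lra.
  rewrite Rabs_mult, (Rabs_right (b - a)) by lra.
  apply Rmult_le_compat_r; [lra|]; apply HM; lra.
Qed.

(** A complex-valued function has no mean value point, but the inequality holds for each part;
    recombining the parts costs the factor 2. *)
Lemma Cder_bound (f df : R -> C) (a b M : R) : a <= b ->
  (forall t, a <= t <= b -> Cder f t (df t)) ->
  (forall t, a <= t <= b -> Cmod (df t) <= M) -> Cmod (f b - f a)%C <= 2 * (M * (b - a)).
Proof.
intros Hab Hd HM; apply Cmod_le_parts.
- apply (MVT_bound (fun t => Re (f t)) (fun t => Re (df t))); auto.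
  + intros t Ht; apply (Hd t Ht).
  + intros t Ht; eapply Rle_trans; [apply re_le_Cmod|apply HM, Ht].
- apply (MVT_bound (fun t => Im (f t)) (fun t => Im (df t))); auto.
  + intros t Ht; apply (Hd t Ht).
  + intros t Ht; eapply Rle_trans; [apply Im_Cmod|apply HM, Ht].
Qed.

Lemma exp_le (x y : R) : x <= y -> exp x <= exp y.
Proof. intros [H| ->]; [left; apply exp_increasing, H|lra]. Qed.

(** Mean value inequality on the segment from [w] to [z], along which the real part stays below [M].
    Every comparison of two integrands below goes through it, after both are written as
    exponentials. *)
Lemma Cexp_diff (z w : C) (M : R) : Re z <= M -> Re w <= M ->
  Cmod (Cexp z - Cexp w)%C <= 2 * (Cmod (z - w)%C * exp M).
Proof.
intros Hz Hw.
assert (H := Cder_bound (fun t => Cexp (w + RtoC t * (z - w))%C)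
  (fun t => ((z - w) * Cexp (w + RtoC t * (z - w)))%C) 0 1 (Cmod (z - w)%C * exp M)).
cbv beta in H.
replace (w + RtoC 1 * (z - w))%C with z in H by ring.
replace (w + RtoC 0 * (z - w))%C with w in H by ring.
replace (Cmod (z - w)%C * exp M * (1 - 0)) with (Cmod (z - w)%C * exp M) in H by ring.
apply H; [lra| |].
- intros t _; apply Cder_Cexp.
  eapply Cder_eq; [apply Cder_plus; [apply Cder_const|apply Cder_mult; [exact (Cder_RtoC (fun t => t) t 1 (is_derive_id t))|apply Cder_const]]|cbv beta; ring].
- intros t Ht; rewrite Cmod_mult, Cmod_Cexp.
  apply Rmult_le_compat_l; [apply Cmod_ge_0|]; apply exp_le.
  replace (Re (w + RtoC t * (z - w))%C) with ((1 - t) * Re w + t * Re z)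
    by (unfold Re, Im, Cminus, Cplus, Cmult; simpl; ring).
  assert ((1 - t) * Re w <= (1 - t) * M) by (apply Rmult_le_compat_l; lra).
  assert (t * Re z <= t * M) by (apply Rmult_le_compat_l; lra).
  lra.
Qed.

(** * Integrals over the positive half-line *)

Definition is_CInt_pos (f : R -> C) (l : C) : Prop :=
  is_RInt_gen (fun t => Re (f t)) (at_right 0) (Rbar_locally p_infty) (Re l) /\
  is_RInt_gen (fun t => Im (f t)) (at_right 0) (Rbar_locally p_infty) (Im l).

Lemma at_right_interval (P : R -> Prop) :
  (exists d, 0 < d /\ forall u, 0 < u < d -> P u) -> at_right 0 P.
Proof.
intros [d [Hd H]]; exists (mkposreal d Hd); intros u Hu Hu0; apply H; split; [exact Hu0|].
generalize (Rle_abs (minus u 0)); change (abs (minus u 0)) with (Rabs (minus u 0)) in *.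
unfold ball in Hu; simpl in Hu; unfold AbsRing_ball, abs, minus, plus, opp in *; simpl in *; lra.
Qed.

(** Separating the two endpoints by 1 makes the lower one eventually smaller than the upper one. *)
Lemma is_CInt_pos_filter (P : R -> R -> Prop) :
  (forall a b, 0 < a -> a < b -> P a b) ->
  filter_prod (at_right 0) (Rbar_locally p_infty) (fun ab => P (fst ab) (snd ab)).
Proof.
intros H; exists (fun a => 0 < a < 1) (fun b => 1 < b).
- apply at_right_interval; exists 1; split; [lra|auto].
- exists 1; auto.
- intros a b Ha Hb; cbv beta in Ha, Hb; apply (H a b); lra.
Qed.

Lemma is_RInt_pos_ext (f g : R -> R) (l : R) : (forall u, 0 < u -> f u = g u) ->
  is_RInt_gen f (at_right 0) (Rbar_locally p_infty) l ->
  is_RInt_gen g (at_right 0) (Rbar_locally p_infty) l.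
Proof.
intros H; apply is_RInt_gen_ext.
refine (is_CInt_pos_filter (fun a b => forall x, Rmin a b < x < Rmax a b -> f x = g x) _).
intros a b Ha Hab x Hx; apply H; rewrite Rmin_left in Hx; lra.
Qed.

Lemma is_CInt_pos_ext (f g : R -> C) (l : C) : (forall u, 0 < u -> f u = g u) -> is_CInt_pos f l -> is_CInt_pos g l.
Proof.
intros H [H1 H2]; split; [revert H1|revert H2]; apply is_RInt_pos_ext; intros u Hu; rewrite H; auto.
Qed.

Lemma is_CInt_pos_plus (f g : R -> C) (lf lg : C) : is_CInt_pos f lf -> is_CInt_pos g lg -> is_CInt_pos (fun u => f u + g u)%C (lf + lg)%C.
Proof.
intros [H1 H2] [H3 H4]; split.
- exact (is_RInt_gen_plus _ _ _ _ H1 H3).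
- exact (is_RInt_gen_plus _ _ _ _ H2 H4).
Qed.

Lemma is_CInt_pos_scal (c : C) (f : R -> C) (l : C) : is_CInt_pos f l -> is_CInt_pos (fun u => c * f u)%C (c * l)%C.
Proof.
intros [H1 H2]; split.
- exact (is_RInt_gen_minus _ _ _ _ (is_RInt_gen_scal _ (Re c) _ H1) (is_RInt_gen_scal _ (Im c) _ H2)).
- exact (is_RInt_gen_plus _ _ _ _ (is_RInt_gen_scal _ (Re c) _ H2) (is_RInt_gen_scal _ (Im c) _ H1)).
Qed.

Lemma is_CInt_pos_minus (f g : R -> C) (lf lg : C) : is_CInt_pos f lf -> is_CInt_pos g lg -> is_CInt_pos (fun u => f u - g u)%C (lf - lg)%C.
Proof.
intros Hf Hg; replace (lf - lg)%C with (lf + RtoC (-1) * lg)%C by ring.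
apply is_CInt_pos_ext with (fun u => f u + RtoC (-1) * g u)%C; [intros u _; ring|].
apply is_CInt_pos_plus; [exact Hf|apply is_CInt_pos_scal, Hg].
Qed.

Lemma is_CInt_pos_det (f : R -> C) (l l' : C) : is_CInt_pos f l -> is_CInt_pos f l' -> l = l'.
Proof.
intros [H1 H2] [H3 H4]; apply C_eq.
- rewrite <- (is_RInt_gen_unique _ _ H1); apply is_RInt_gen_unique, H3.
- rewrite <- (is_RInt_gen_unique _ _ H2); apply is_RInt_gen_unique, H4.
Qed.

Lemma CRInt_gen_parts {Fa Fb : (R -> Prop) -> Prop} {FFa : ProperFilter' Fa} {FFb : ProperFilter' Fb}
  (f : R -> C) (l : C) :
  is_RInt_gen (fun t => Re (f t)) Fa Fb (Re l) -> is_RInt_gen (fun t => Im (f t)) Fa Fb (Im l) ->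
  RInt_gen (V := C_R_CompleteNormedModule) f Fa Fb = l.
Proof.
intros H1 H2; apply (is_RInt_gen_unique (V := C_R_CompleteNormedModule)).
intros P [e He].
assert (F1 := H1 (fun y => ball (Re l) e y) (locally_ball (Re l) e)).
assert (F2 := H2 (fun y => ball (Im l) e y) (locally_ball (Im l) e)).
unfold filtermapi in *.
generalize (filter_and _ _ F1 F2); apply filter_imp.
intros [a b] [[y1 [I1 B1]] [y2 [I2 B2]]].
exists (y1, y2); split.
- exact (is_RInt_fct_extend_pair (U := R_NormedModule) (V := R_NormedModule) f a b y1 y2 I1 I2).
- apply He; split; assumption.
Qed.

Lemma is_CInt_pos_CInt (f : R -> C) (l : C) : is_CInt_pos f l -> CInt_pos f = l.
Proof. intros [H1 H2]; unfold CInt_pos; exact (CRInt_gen_parts f l H1 H2). Qed.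

(** Domination is expressed through a primitive [Phi] of the dominating function with limits at both
    ends: the Cauchy criterion for [f] reduces to the one for [Phi], and the total increment of
    [Phi] bounds the integral. *)
Lemma is_RInt_pos_dom (f Phi phi : R -> R) (L0 L1 : R) :
  (forall u, 0 < u -> continuous f u) ->
  (forall u, 0 < u -> is_derive Phi u (phi u)) ->
  (forall u, 0 < u -> continuous phi u) ->
  (forall u, 0 < u -> Rabs (f u) <= phi u) ->
  filterlim Phi (at_right 0) (locally L0) ->
  filterlim Phi (Rbar_locally p_infty) (locally L1) ->
  exists l, is_RInt_gen f (at_right 0) (Rbar_locally p_infty) l /\ Rabs l <= L1 - L0.
Proof.
intros Hf HPhi Hphi Hdom HL0 HL1.
assert (Hex : forall a b, 0 < a -> 0 < b -> ex_RInt f a b).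
{ intros a b Ha Hb; apply (ex_RInt_continuous (V := R_CompleteNormedModule)); intros z Hz.
  apply Hf; generalize (Rmin_glb_lt a b 0 Ha Hb); lra. }
assert (Hbd1 : forall a b, 0 < a -> a <= b -> Rabs (RInt f a b) <= Phi b - Phi a).
{ intros a b Ha Hab.
  assert (HI : is_RInt phi a b (Phi b - Phi a)).
  { apply (is_RInt_derive Phi phi); intros z Hz; rewrite Rmin_left in Hz by lra;
    [apply HPhi|apply Hphi]; lra. }
  apply (norm_RInt_le (V := R_NormedModule) f phi a b); auto.
  - intros x Hx; apply Hdom; lra.
  - apply (RInt_correct (V := R_CompleteNormedModule)), Hex; lra. }
assert (Hbd : forall a b, 0 < a -> 0 < b -> Rabs (RInt f a b) <= Rabs (Phi b - Phi a)).
{ intros a b Ha Hb; destruct (Rle_lt_dec a b) as [H|H].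
  - eapply Rle_trans; [apply Hbd1; lra|apply Rle_abs].
  - assert (E : RInt f a b = - RInt f b a) by (symmetry; apply (opp_RInt_swap (V := R_CompleteNormedModule)), Hex; auto).
    rewrite E, Rabs_Ropp, Rabs_minus_sym.
    eapply Rle_trans; [apply Hbd1; lra|apply Rle_abs]. }
set (G := fun ab : R * R => RInt f (fst ab) (snd ab)).
assert (HC : exists l, filterlim G (filter_prod (at_right 0) (Rbar_locally p_infty)) (locally l)).
{ apply (filterlim_locally_cauchy (U := R_CompleteSpace)).
  intros e.
  assert (He : 0 < e / 4) by (generalize (cond_pos e); lra).
  assert (E0 := HL0 _ (locally_ball L0 (mkposreal _ He))).
  assert (E1 := HL1 _ (locally_ball L1 (mkposreal _ He))).
  unfold filtermap in E0, E1.
  assert (E0' : at_right 0 (fun x => 0 < x /\ ball L0 (mkposreal _ He) (Phi x))).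
  { apply filter_and; [|exact E0]; apply at_right_interval; exists 1; split; [lra|tauto]. }
  assert (E1' : Rbar_locally p_infty (fun x => 0 < x /\ ball L1 (mkposreal _ He) (Phi x))).
  { apply filter_and; [|exact E1]; exists 0; auto. }
  exists (fun ab => (0 < fst ab /\ ball L0 (mkposreal _ He) (Phi (fst ab))) /\
     (0 < snd ab /\ ball L1 (mkposreal _ He) (Phi (snd ab)))).
  split; [exact (Filter_prod _ _ _ _ _ E0' E1' (fun a b H1 H2 => conj H1 H2))|].
  intros [a b] [a' b'] [[Ha Ba] [Hb Bb]] [[Ha' Ba'] [Hb' Bb']]; cbn [fst snd] in *.
  unfold ball in *; simpl in *; unfold AbsRing_ball, abs, minus, plus, opp in *; simpl in *.
  unfold G; cbn [fst snd].
  (* The two integrals differ only by the end pieces, on which [Phi] varies by less than [e / 2]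
     each. *)
  assert (E : RInt f a b = RInt f a a' + (RInt f a' b' + RInt f b' b)).
  { rewrite <- (RInt_Chasles f a a' b) by (apply Hex; auto).
    rewrite <- (RInt_Chasles f a' b' b) by (apply Hex; auto). reflexivity. }
  rewrite E.
  replace (RInt f a' b' + - (RInt f a a' + (RInt f a' b' + RInt f b' b)))
    with (- (RInt f a a' + RInt f b' b)) by ring.
  rewrite Rabs_Ropp; eapply Rle_lt_trans; [apply Rabs_triang|].
  assert (B1 := Hbd a a' Ha Ha'); assert (B2 := Hbd b' b Hb' Hb).
  assert (T1 : Rabs (Phi a' - Phi a) < e / 2).
  { replace (Phi a' - Phi a) with ((Phi a' + - L0) - (Phi a + - L0)) by ring.
    eapply Rle_lt_trans; [apply Rabs_triang|]; rewrite Rabs_Ropp; lra. }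
  assert (T2 : Rabs (Phi b - Phi b') < e / 2).
  { replace (Phi b - Phi b') with ((Phi b + - L1) - (Phi b' + - L1)) by ring.
    eapply Rle_lt_trans; [apply Rabs_triang|]; rewrite Rabs_Ropp; lra. }
  lra. }
destruct HC as [l Hl]; exists l.
assert (Hgen : is_RInt_gen f (at_right 0) (Rbar_locally p_infty) l).
{ intros P HP; specialize (Hl P HP); unfold filtermapi, filtermap in *.
  assert (HF := is_CInt_pos_filter (fun a b => is_RInt f a b (RInt f a b))
    (fun a b Ha Hab => RInt_correct (V := R_CompleteNormedModule) f a b (Hex a b Ha (Rlt_trans _ _ _ Ha Hab)))).
  generalize (filter_and _ _ Hl HF); apply filter_imp; intros [a b] [H1 H2].
  exists (G (a, b)); split; assumption. }
split; [exact Hgen|].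
assert (HPI : is_RInt_gen phi (at_right 0) (Rbar_locally p_infty) (L1 - L0)).
{ intros P HP; unfold filtermapi.
  assert (HF := is_CInt_pos_filter (fun a b => is_RInt phi a b (Phi b - Phi a))).
  assert (HF' : forall a b, 0 < a -> a < b -> is_RInt phi a b (Phi b - Phi a)).
  { intros a b Ha Hab; apply (is_RInt_derive Phi phi); intros z Hz; rewrite Rmin_left in Hz by lra;
    [apply HPhi|apply Hphi]; lra. }
  specialize (HF HF').
  assert (HM : filterlim (fun ab : R * R => Phi (snd ab) - Phi (fst ab)) (filter_prod (at_right 0) (Rbar_locally p_infty)) (locally (L1 - L0))).
  { apply (filterlim_comp_2 (G := locally L1) (H := locally (- L0)) (fun ab : R * R => Phi (snd ab)) (fun ab : R * R => - Phi (fst ab)) Rplus).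
    - apply filterlim_comp with (2 := HL1), filterlim_snd.
    - apply filterlim_comp with (G := locally L0) (f := fun ab : R * R => Phi (fst ab)) (g := Ropp).
      + apply filterlim_comp with (2 := HL0), filterlim_fst.
      + exact (filterlim_opp (V := R_NormedModule) L0).
    - exact (filterlim_plus (V := R_NormedModule) L1 (- L0)). }
  specialize (HM P HP); unfold filtermap in HM.
  generalize (filter_and _ _ HM HF); apply filter_imp; intros [a b] [H1 H2].
  exists (Phi b - Phi a); split; assumption. }
apply (RInt_gen_norm (V := R_CompleteNormedModule) (Fa := at_right 0) (Fb := Rbar_locally p_infty) f phi l (L1 - L0)); auto.
- refine (is_CInt_pos_filter (fun a b => a <= b) _); intros; lra.
- refine (is_CInt_pos_filter (fun a b => forall x, a <= x <= b -> norm (f x) <= phi x) _).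
  intros a b Ha Hab x Hx; apply Hdom; lra.
Qed.

Lemma is_CInt_pos_dom (f : R -> C) (Phi phi : R -> R) (L0 L1 : R) :
  (forall u, 0 < u -> Ccont f u) ->
  (forall u, 0 < u -> is_derive Phi u (phi u)) ->
  (forall u, 0 < u -> continuous phi u) ->
  (forall u, 0 < u -> Cmod (f u) <= phi u) ->
  filterlim Phi (at_right 0) (locally L0) ->
  filterlim Phi (Rbar_locally p_infty) (locally L1) ->
  exists l, is_CInt_pos f l /\ Cmod l <= 2 * (L1 - L0).
Proof.
intros Hf HPhi Hphi Hdom HL0 HL1.
destruct (is_RInt_pos_dom (fun t => Re (f t)) Phi phi L0 L1) as [lr [Hr Br]]; auto.
{ intros u Hu; apply Hf, Hu. }
{ intros u Hu; eapply Rle_trans; [apply re_le_Cmod|apply Hdom, Hu]. }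
destruct (is_RInt_pos_dom (fun t => Im (f t)) Phi phi L0 L1) as [li [Hi Bi]]; auto.
{ intros u Hu; apply Hf, Hu. }
{ intros u Hu; eapply Rle_trans; [apply Im_Cmod|apply Hdom, Hu]. }
exists (lr, li); split; [split; assumption|].
apply Cmod_le_parts; assumption.
Qed.

Lemma is_RInt_pos_scale (c : R) (f : R -> R) (l : R) : 0 < c ->
  is_RInt_gen f (at_right 0) (Rbar_locally p_infty) l ->
  is_RInt_gen (fun u => c * f (c * u)) (at_right 0) (Rbar_locally p_infty) l.
Proof.
intros Hc H P HP; specialize (H P HP); unfold filtermapi in *.
destruct H as [Q T [d HQ] [M HT] H].
exists (fun a => Q (c * a)) (fun b => T (c * b)).
- apply at_right_interval; exists (d / c); split; [apply Rdiv_lt_0_compat; [apply cond_pos|exact Hc]|].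
  intros u [Hu0 Hud].
  assert (c * u < d) by (apply Rmult_lt_compat_l with (r := c) in Hud; [|lra]; replace (c * (d / c)) with (pos d) in Hud by (field; lra); lra).
  assert (0 < c * u) by nra.
  apply HQ; [|assumption].
  unfold ball; simpl; unfold AbsRing_ball, abs, minus, plus, opp; simpl.
  rewrite Ropp_0, Rplus_0_r, Rabs_right; lra.
- exists (M / c); intros u Hu; apply HT.
  apply Rmult_lt_compat_l with (r := c) in Hu; [|lra].
  replace (c * (M / c)) with M in Hu by (field; lra); lra.
- intros a b Ha Hb; destruct (H _ _ Ha Hb) as [y [Hy Py]]; exists y; split; [|exact Py].
  cbn [fst snd] in *.
  apply (is_RInt_ext (fun y0 => scal c (f (c * y0 + 0)))); [intros x _; rewrite Rplus_0_r; reflexivity|].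
  apply (is_RInt_comp_lin f c 0 a b y); rewrite !Rplus_0_r; exact Hy.
Qed.

Lemma is_CInt_pos_scale (c : R) (f : R -> C) (l : C) : 0 < c ->
  is_CInt_pos f l -> is_CInt_pos (fun u => RtoC c * f (c * u)%R)%C l.
Proof.
intros Hc [H1 H2]; split.
- apply is_RInt_pos_ext with (2 := is_RInt_pos_scale c _ _ Hc H1); intros u _; unfold Re, Im, RtoC, Cmult; simpl; ring.
- apply is_RInt_pos_ext with (2 := is_RInt_pos_scale c _ _ Hc H2); intros u _; unfold Re, Im, RtoC, Cmult; simpl; ring.
Qed.

Lemma is_RInt_pos_FTC (F f : R -> R) (l0 l1 : R) :
  (forall u, 0 < u -> is_derive F u (f u)) -> (forall u, 0 < u -> continuous f u) ->
  (forall e, 0 < e -> exists d, 0 < d /\ forall u, 0 < u < d -> Rabs (F u - l0) < e) ->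
  (forall e, 0 < e -> exists M, forall u, M < u -> Rabs (F u - l1) < e) ->
  is_RInt_gen f (at_right 0) (Rbar_locally p_infty) (l1 - l0).
Proof.
intros HF Hf H0 H1 P [e HP]; unfold filtermapi.
assert (He : 0 < e / 2) by (generalize (cond_pos e); lra).
destruct (H0 _ He) as [d [Hd HQ]]; destruct (H1 _ He) as [M HT].
exists (fun a => 0 < a /\ Rabs (F a - l0) < e / 2 /\ a < 1) (fun b => 1 < b /\ Rabs (F b - l1) < e / 2).
- apply at_right_interval; exists (Rmin d 1); split; [apply Rmin_glb_lt; lra|].
  intros u [Hu0 Hu]; assert (Hu1 := Rlt_le_trans _ _ _ Hu (Rmin_l _ _)).
  assert (Hu2 := Rlt_le_trans _ _ _ Hu (Rmin_r _ _)).
  split; [exact Hu0|split; [apply HQ; lra|lra]].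
- exists (Rmax M 1); intros u Hu.
  generalize (Rmax_l M 1) (Rmax_r M 1); intros; split; [lra|apply HT; lra].
- intros a b [Ha [Qa Ha1]] [Hb Tb]; exists (F b - F a); split.
  + apply (is_RInt_derive F f); cbn [fst snd]; intros z Hz; rewrite Rmin_left in Hz by lra;
    [apply HF|apply Hf]; lra.
  + apply HP; unfold ball; simpl; unfold AbsRing_ball, abs, minus, plus, opp; simpl.
    replace (F b - F a + - (l1 - l0)) with ((F b - l1) - (F a - l0)) by ring.
    eapply Rle_lt_trans; [apply Rabs_triang|]; rewrite Rabs_Ropp; lra.
Qed.

Lemma is_CInt_pos_FTC (F f : R -> C) (l0 l1 : C) :
  (forall u, 0 < u -> Cder F u (f u)) -> (forall u, 0 < u -> Ccont f u) ->
  (forall e, 0 < e -> exists d, 0 < d /\ forall u, 0 < u < d -> Cmod (F u - l0)%C < e) ->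
  (forall e, 0 < e -> exists M, forall u, M < u -> Cmod (F u - l1)%C < e) ->
  is_CInt_pos f (l1 - l0)%C.
Proof.
intros HF Hf H0 H1; split.
- apply (is_RInt_pos_FTC (fun u => Re (F u)) _ (Re l0) (Re l1)).
  + intros u Hu; exact (proj1 (HF u Hu)).
  + intros u Hu; exact (proj1 (Hf u Hu)).
  + intros e He; destruct (H0 e He) as [d [Hd H]]; exists d; split; [exact Hd|].
    intros u Hu; eapply Rle_lt_trans; [|apply (H u Hu)]; apply (re_le_Cmod (F u - l0)%C).
  + intros e He; destruct (H1 e He) as [M H]; exists M.
    intros u Hu; eapply Rle_lt_trans; [|apply (H u Hu)]; apply (re_le_Cmod (F u - l1)%C).
- apply (is_RInt_pos_FTC (fun u => Im (F u)) _ (Im l0) (Im l1)).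
  + intros u Hu; exact (proj2 (HF u Hu)).
  + intros u Hu; exact (proj2 (Hf u Hu)).
  + intros e He; destruct (H0 e He) as [d [Hd H]]; exists d; split; [exact Hd|].
    intros u Hu; eapply Rle_lt_trans; [|apply (H u Hu)]; apply (Im_Cmod (F u - l0)%C).
  + intros e He; destruct (H1 e He) as [M H]; exists M.
    intros u Hu; eapply Rle_lt_trans; [|apply (H u Hu)]; apply (Im_Cmod (F u - l1)%C).
Qed.

(** * Domination by powers and exponentials *)

Lemma ln_le_sub_1 (y : R) : 0 < y -> ln y <= y - 1.
Proof. intros Hy; generalize (exp_ineq1_le (ln y)); rewrite exp_ln; lra. Qed.

(** For [p > 0] the constant [(p / d)^p] comes from [ln t <= t - 1] at [t = d y / p]. *)
Lemma Rpower_exp_bound (p d : R) : 0 <= p -> 0 < d ->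
  exists K, 0 < K /\ forall y, 0 < y -> Rpower y p <= K * exp (d * y).
Proof.
intros [Hp| <-] Hd.
- exists (exp (p * ln (p / d))); split; [apply exp_pos|]; intros y Hy.
  rewrite <- exp_plus; unfold Rpower; apply exp_le.
  assert (Hq : 0 < d / p) by (apply Rdiv_lt_0_compat; lra).
  assert (H := ln_le_sub_1 (d / p * y) (Rmult_lt_0_compat _ _ Hq Hy)).
  rewrite ln_mult in H by lra.
  replace (p / d) with (/ (d / p)) by (field; lra).
  rewrite ln_Rinv by lra.
  assert (E : p * ln y <= p * (d / p * y - 1 - ln (d / p))) by (apply Rmult_le_compat_l; lra).
  replace (p * (d / p * y - 1 - ln (d / p))) with (d * y - p - p * ln (d / p)) in E by (field; lra).
  lra.
- exists 1; split; [lra|]; intros y Hy; unfold Rpower; rewrite Rmult_0_l, exp_0.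
  assert (0 <= d * y) by nra. generalize (exp_ineq1_le (d * y)); lra.
Qed.

Lemma Rpower_pos (x p : R) : 0 < Rpower x p.
Proof. apply exp_pos. Qed.

Lemma lim_Rpower_0 (F : R -> R) (K p : R) : 0 < p -> 0 <= K ->
  (forall u, 0 < u < 1 -> F u <= K * Rpower u p) ->
  forall e, 0 < e -> exists d, 0 < d /\ forall u, 0 < u < d -> F u < e.
Proof.
intros Hp HK HF e He.
assert (Hq : 0 < e / (K + 1)) by (apply Rdiv_lt_0_compat; lra).
exists (Rmin 1 (exp (ln (e / (K + 1)) / p))); split; [apply Rmin_glb_lt; [lra|apply exp_pos]|].
intros u [Hu Hu'].
assert (H1 := Rlt_le_trans _ _ _ Hu' (Rmin_l _ _)); assert (H2 := Rlt_le_trans _ _ _ Hu' (Rmin_r _ _)).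
eapply Rle_lt_trans; [apply HF; lra|].
assert (H3 : Rpower u p <= e / (K + 1)).
{ rewrite <- (exp_ln (e / (K + 1))) by exact Hq.
  unfold Rpower; apply exp_le.
  apply Rlt_le in H2; apply ln_le in H2; [|exact Hu]; rewrite ln_exp in H2.
  apply Rmult_le_compat_l with (r := p) in H2; [|lra].
  replace (p * (ln (e / (K + 1)) / p)) with (ln (e / (K + 1))) in H2 by (field; lra); lra. }
assert (H4 : K * Rpower u p <= K * (e / (K + 1))) by (apply Rmult_le_compat_l; lra).
assert (H5 : K * (e / (K + 1)) = e - e / (K + 1)) by (field; lra).
lra.
Qed.

Lemma lim_exp_infty (F : R -> R) (K d : R) : 0 < d -> 0 <= K ->
  (forall u, 0 < u -> F u <= K * exp (- (d * u))) ->
  forall e, 0 < e -> exists M, forall u, M < u -> F u < e.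
Proof.
intros Hd HK HF e He.
exists (Rmax 0 (K / (d * e))); intros u Hu.
assert (H1 := Rle_lt_trans _ _ _ (Rmax_l _ _) Hu); assert (H2 := Rle_lt_trans _ _ _ (Rmax_r _ _) Hu).
eapply Rle_lt_trans; [apply HF, H1|].
assert (Hdu : 0 < d * u) by nra.
assert (He1 := exp_ineq1_le (d * u)).
rewrite exp_Ropp.
apply Rmult_lt_reg_r with (exp (d * u)); [apply exp_pos|].
replace (K * / exp (d * u) * exp (d * u)) with K by (field; apply Rgt_not_eq, exp_pos).
assert (K < u * (d * e)).
{ apply Rmult_lt_compat_r with (r := d * e) in H2; [|nra].
  replace (K / (d * e) * (d * e)) with K in H2 by (field; lra); lra. }
nra.
Qed.

(** Integration by parts with vanishing boundary terms. It yields the recurrences of Gamma, of Beta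
    and of the integral behind [W]. *)
Lemma is_CInt_pos_FTC_0 (F f : R -> C) (K p d : R) : 0 < p -> 0 < d -> 0 <= K ->
  (forall u, 0 < u -> Cder F u (f u)) -> (forall u, 0 < u -> Ccont f u) ->
  (forall u, 0 < u -> Cmod (F u) <= K * (Rpower u p * exp (- (d * u)))) ->
  is_CInt_pos f (RtoC 0).
Proof.
intros Hp Hd HK HF Hf HB.
replace (RtoC 0) with (RtoC 0 - RtoC 0)%C by ring.
apply (is_CInt_pos_FTC F); auto.
- apply (lim_Rpower_0 (fun u => Cmod (F u - RtoC 0)%C) K p); auto.
  intros u Hu; replace (F u - RtoC 0)%C with (F u) by ring.
  eapply Rle_trans; [apply HB; lra|]; apply Rmult_le_compat_l; [exact HK|].
  rewrite <- (Rmult_1_r (Rpower u p)) at 2; apply Rmult_le_compat_l; [left; apply Rpower_pos|].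
  rewrite <- exp_0; apply exp_le; nra.
- assert (Hd2 : 0 < d / 2) by lra.
  destruct (Rpower_exp_bound p (d / 2) (Rlt_le _ _ Hp) Hd2) as [K' [HK' HE]].
  apply (lim_exp_infty (fun u => Cmod (F u - RtoC 0)%C) (K * K') (d / 2)); [lra|nra|].
  intros u Hu; replace (F u - RtoC 0)%C with (F u) by ring.
  eapply Rle_trans; [apply HB; lra|]; rewrite Rmult_assoc; apply Rmult_le_compat_l; [exact HK|].
  replace (- (d * u)) with (d / 2 * u + (- (d * u) - d / 2 * u)) by ring.
  replace (- (d / 2 * u)) with (d / 2 * u + (- (d * u))) by field.
  replace (exp (- (d / 2 * u))) with (exp (d / 2 * u) * exp (- (d * u))) by (rewrite <- exp_plus; f_equal; field).
  replace (exp (d / 2 * u + (- (d * u) - d / 2 * u))) with (exp (- (d * u))) by (f_equal; ring).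
  replace (exp (d / 2 * u + - (d * u))) with (exp (d / 2 * u) * exp (- (d * u))) by (rewrite <- exp_plus; f_equal; field).
  rewrite <- Rmult_assoc; apply Rmult_le_compat_r; [left; apply exp_pos|apply HE, Hu].
Qed.

Lemma is_derive_ext_eq (f : R -> R) (x d d' : R) : is_derive f x d -> d = d' -> is_derive f x d'.
Proof. intros H <-; exact H. Qed.

(* The dominating primitive is a multiple of [(d u / (1 + d u)) ^ (p + 1)]. *)
Lemma is_CInt_pos_dom_power (p : R) : -1 < p ->
  exists Kp, 0 < Kp /\ forall (K d : R) (f : R -> C), 0 <= K -> 0 < d ->
    (forall u, 0 < u -> Ccont f u) ->
    (forall u, 0 < u -> Cmod (f u) <= K * (Rpower u p * exp (- (d * u)))) ->
    exists l, is_CInt_pos f l /\ Cmod l <= K * (Kp * Rpower d (- (p + 1))).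
Proof.
intros Hp.
(* The derivative of [(d u / (1 + d u))^(p + 1)] is proportional to [u^p (1 + d u)^(- p - 2)], so
   the exponential only has to beat the power [p + 2] of [1 + d u]. *)
destruct (Rpower_exp_bound (p + 2) 1) as [C1 [HC1 HE]]; [lra|lra|].
exists (2 * (C1 * exp 1 / (p + 1))); split.
{ generalize (exp_pos 1); intros; apply Rmult_lt_0_compat; [lra|apply Rdiv_lt_0_compat; nra]. }
intros K d f HK Hd Hf HB.
set (A := K * (C1 * exp 1) * Rpower d (- (p + 1))).
assert (HA : 0 <= A) by (generalize (exp_pos 1) (Rpower_pos d (- (p + 1))); intros; unfold A; repeat apply Rmult_le_pos; lra).
set (w := fun u => d * u / (1 + d * u)).
assert (Hw : forall u, 0 < u -> 0 < w u < 1).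
{ intros u Hu; assert (0 < d * u) by nra; unfold w; split; [apply Rdiv_lt_0_compat; lra|].
  apply Rmult_lt_reg_r with (1 + d * u); [lra|]; unfold Rdiv; rewrite Rmult_assoc, Rinv_l; lra. }
set (Phi := fun u => A / (p + 1) * exp ((p + 1) * ln (w u))).
set (phi := fun u => A * (exp (p * ln (w u)) * (d / (1 + d * u) ^ 2))).
assert (HD : forall u, 0 < u -> is_derive Phi u (phi u)).
{ intros u Hu; specialize (Hw u Hu); assert (0 < d * u) by nra.
  unfold Phi, phi, w in *; auto_derive; [split; [lra|split; [lra|exact I]]|].
  replace ((p + 1) * ln (d * u * / (1 + d * u))) with (p * ln (d * u / (1 + d * u)) + ln (d * u / (1 + d * u)))
    by (unfold Rdiv; ring).
  rewrite exp_plus, exp_ln by lra.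
  field; repeat split; lra. }
assert (Hphi : forall u, 0 < u -> continuous phi u).
{ intros u Hu; specialize (Hw u Hu); assert (0 < d * u) by nra.
  apply (ex_derive_continuous (V := R_NormedModule) phi u); unfold phi, w in *; auto_derive.
  repeat split; try lra; nra. }
assert (Hdom : forall u, 0 < u -> Cmod (f u) <= phi u).
{ intros u Hu; specialize (Hw u Hu); assert (Hs : 0 < d * u) by nra.
  eapply Rle_trans; [apply HB, Hu|]; unfold phi, A, w.
  rewrite !Rmult_assoc; apply Rmult_le_compat_l; [exact HK|].
  assert (H1 : exp (p * ln (d * u / (1 + d * u))) = Rpower d p * (Rpower u p * Rpower (1 + d * u) (- p))).
  { unfold Rpower; rewrite <- !exp_plus; f_equal; unfold Rdiv; rewrite ln_mult, ln_mult, ln_Rinv;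
    [ring|lra|lra|lra|nra|apply Rinv_0_lt_compat; lra]. }
  rewrite H1.
  assert (H2 : Rpower d (- (p + 1)) * Rpower d p * d = 1).
  { rewrite <- (Rpower_1 d Hd) at 3; rewrite <- !Rpower_plus.
    replace (- (p + 1) + p + 1) with 0 by ring; apply Rpower_O; lra. }
  assert (H3 : Rpower (1 + d * u) (- p) / (1 + d * u) ^ 2 = / Rpower (1 + d * u) (p + 2)).
  { rewrite Rpower_plus, !Rpower_Ropp.
    replace (Rpower (1 + d * u) 2) with ((1 + d * u) ^ 2) by (rewrite <- Rpower_pow by lra; f_equal; simpl; ring).
    field; split; [lra|apply Rgt_not_eq, Rpower_pos]. }
  replace (C1 * (exp 1 * (Rpower d (- (p + 1)) * (Rpower d p * (Rpower u p * Rpower (1 + d * u) (- p)) * (d / (1 + d * u) ^ 2)))))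
    with ((Rpower d (- (p + 1)) * Rpower d p * d) * (Rpower u p * (C1 * exp 1 * (Rpower (1 + d * u) (- p) / (1 + d * u) ^ 2))))
    by (field; lra).
  rewrite H2, H3, Rmult_1_l; apply Rmult_le_compat_l; [left; apply Rpower_pos|].
  apply Rmult_le_reg_r with (Rpower (1 + d * u) (p + 2)); [apply Rpower_pos|].
  replace (C1 * exp 1 * / Rpower (1 + d * u) (p + 2) * Rpower (1 + d * u) (p + 2)) with (C1 * exp 1)
    by (field; apply Rgt_not_eq, Rpower_pos).
  specialize (HE (1 + d * u)); rewrite Rmult_1_l, exp_plus in HE.
  apply Rle_trans with (exp (- (d * u)) * (C1 * (exp 1 * exp (d * u)))).
  - apply Rmult_le_compat_l; [left; apply exp_pos|apply HE; lra].
  - rewrite exp_Ropp; right; field; apply Rgt_not_eq, exp_pos. }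
destruct (is_CInt_pos_dom f Phi phi 0 (A / (p + 1)) Hf HD Hphi Hdom) as [l [Hl Bl]].
- intros P [e HP].
  destruct (lim_Rpower_0 Phi (A / (p + 1) * Rpower d (p + 1)) (p + 1)) with (e := pos e) as [dd [Hdd H]].
  + lra.
  + apply Rmult_le_pos; [apply Rmult_le_pos; [lra|left; apply Rinv_0_lt_compat; lra]|left; apply Rpower_pos].
  + intros u Hu; assert (0 < d * u) by nra; unfold Phi; rewrite Rmult_assoc; apply Rmult_le_compat_l;
    [apply Rmult_le_pos; [lra|left; apply Rinv_0_lt_compat; lra]|].
    rewrite Rpower_mult_distr by lra; unfold Rpower; apply exp_le; apply Rmult_le_compat_l; [lra|].
    apply ln_le; [apply Hw; lra|]; unfold w.
    apply Rmult_le_reg_r with (1 + d * u); [lra|]; unfold Rdiv; rewrite Rmult_assoc, Rinv_l; nra.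
  + apply cond_pos.
  + unfold filtermap; apply at_right_interval; exists dd; split; [exact Hdd|]; intros u Hu; apply HP.
    specialize (H u Hu); unfold ball; simpl; unfold AbsRing_ball, abs, minus, plus, opp; simpl.
    rewrite Ropp_0, Rplus_0_r, Rabs_right; [exact H|].
    apply Rle_ge; unfold Phi; apply Rmult_le_pos; [apply Rmult_le_pos; [lra|left; apply Rinv_0_lt_compat; lra]|left; apply exp_pos].
- unfold Phi.
  apply filterlim_comp with (G := locally 1) (f := w) (g := fun y => A / (p + 1) * exp ((p + 1) * ln y)).
  + intros P [e HP]; unfold filtermap.
    exists (/ (d * e)); intros u Hu; apply HP.
    assert (He := cond_pos e).
    assert (0 < / (d * e)) by (apply Rinv_0_lt_compat; nra).
    assert (Hu0 : 0 < u) by lra; assert (0 < d * u) by nra.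
    unfold ball; simpl; unfold AbsRing_ball, abs, minus, plus, opp; simpl; unfold w.
    replace (d * u / (1 + d * u) + - (1)) with (- / (1 + d * u)) by (field; lra).
    rewrite Rabs_Ropp, Rabs_right by (apply Rle_ge; left; apply Rinv_0_lt_compat; lra).
    rewrite <- (Rinv_inv e); apply Rinv_lt_contravar; [apply Rmult_lt_0_compat; [apply Rinv_0_lt_compat; lra|lra]|].
    apply Rmult_lt_compat_l with (r := d) in Hu; [|lra].
    replace (d * / (d * e)) with (/ e) in Hu by (field; lra); lra.
  + assert (HC : continuous (fun y => A / (p + 1) * exp ((p + 1) * ln y)) 1)
      by (apply (ex_derive_continuous (V := R_NormedModule)); auto_derive; repeat split; lra).
    unfold continuous in HC; rewrite ln_1, Rmult_0_r, exp_0, Rmult_1_r in HC; exact HC.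
- exists l; split; [exact Hl|].
  eapply Rle_trans; [exact Bl|]; right; unfold A; field; lra.
Qed.

(** * Complex powers and limits *)

(** For [x > 0] this is [Cpower], by [Cpower_pos]; being one exponential, it lets products of powers
    be merged by adding exponents. *)
Definition rcpow (x : R) (s : C) : C := Cexp (s * RtoC (ln x)).

Lemma Re_mult_R (s : C) (x : R) : Re (s * RtoC x)%C = Re s * x.
Proof. unfold Re, RtoC, Cmult; simpl; ring. Qed.

Lemma Im_mult_R (s : C) (x : R) : Im (s * RtoC x)%C = Im s * x.
Proof. unfold Im, Re, RtoC, Cmult; simpl; ring. Qed.

Lemma Cmod_rcpow (x : R) (s : C) : Cmod (rcpow x s) = Rpower x (Re s).
Proof. unfold rcpow; rewrite Cmod_Cexp, Re_mult_R; reflexivity. Qed.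

Lemma rcpow_neq_0 (x : R) (s : C) : rcpow x s <> RtoC 0.
Proof. apply Cexp_neq_0. Qed.

Lemma rcpow_plus (x : R) (s t : C) : rcpow x (s + t)%C = (rcpow x s * rcpow x t)%C.
Proof. unfold rcpow; rewrite <- Cexp_plus; f_equal; ring. Qed.

Lemma rcpow_opp (x : R) (s : C) : rcpow x (- s)%C = (/ rcpow x s)%C.
Proof. unfold rcpow; rewrite <- Cexp_opp; f_equal; ring. Qed.

Lemma rcpow_0 (x : R) : rcpow x (RtoC 0) = RtoC 1.
Proof. unfold rcpow; replace (RtoC 0 * RtoC (ln x))%C with (RtoC 0) by ring; apply Cexp_0. Qed.

Lemma rcpow_1 (x : R) : 0 < x -> rcpow x (RtoC 1) = RtoC x.
Proof.
intros Hx; unfold rcpow; replace (RtoC 1 * RtoC (ln x))%C with (RtoC (ln x)) by ring.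
rewrite Cexp_real, exp_ln; auto.
Qed.

Lemma rcpow_INR (x : R) (k : nat) : 0 < x -> rcpow x (RtoC (INR k)) = RtoC (x ^ k).
Proof.
intros Hx; induction k as [|k IH]; [apply rcpow_0|].
rewrite S_INR, RtoC_plus, rcpow_plus, IH, rcpow_1, <- RtoC_mult by exact Hx; f_equal; simpl; ring.
Qed.

Lemma rcpow_mult (x y : R) (s : C) : 0 < x -> 0 < y -> rcpow (x * y) s = (rcpow x s * rcpow y s)%C.
Proof. intros Hx Hy; unfold rcpow; rewrite <- Cexp_plus, ln_mult, RtoC_plus by assumption; f_equal; ring. Qed.

Lemma Cder_rcpow (g : R -> R) (s : C) (u dg : R) : 0 < g u -> is_derive g u dg ->
  Cder (fun t => rcpow (g t) s) u (s * RtoC (dg / g u) * rcpow (g u) s)%C.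
Proof.
intros Hg Hd; unfold rcpow; apply Cder_Cexp, Cder_scal, (Cder_RtoC (fun t => ln (g t))).
eapply is_derive_ext_eq; [exact (is_derive_comp ln g u _ _ (is_derive_ln _ Hg) Hd)|].
reflexivity.
Qed.

Lemma Cder_exp_lin (c : C) (u : R) :
  Cder (fun t => Cexp (- (c * RtoC t))%C) u (- c * Cexp (- (c * RtoC u)))%C.
Proof.
apply Cder_Cexp; apply Cder_ext with (fun t => (- c) * RtoC t)%C; [intros; ring|].
eapply Cder_eq; [apply Cder_scal, (Cder_RtoC (fun t => t) u 1), (is_derive_id u)|ring].
Qed.

Definition Clim (u : nat -> C) (l : C) : Prop := is_lim_seq (fun N => Cmod (u N - l)%C) 0.

Lemma Clim_le (u : nat -> C) (l : C) (e : nat -> R) (N0 : nat) :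
  (forall N, (N0 <= N)%nat -> Cmod (u N - l)%C <= e N) -> is_lim_seq e 0 -> Clim u l.
Proof.
intros H He; apply (is_lim_seq_le_le_loc (fun _ => 0) _ e); [|apply is_lim_seq_const|exact He].
exists N0; intros N HN; split; [apply Cmod_ge_0|apply H, HN].
Qed.

Lemma Clim_unique (u : nat -> C) (l l' : C) : Clim u l -> Clim u l' -> l = l'.
Proof.
intros H H'.
assert (E : Rbar_le (Cmod (l - l')%C) (0 + 0)).
{ apply (is_lim_seq_le (fun _ => Cmod (l - l')%C) (fun N => Cmod (u N - l)%C + Cmod (u N - l')%C)).
  - intros N; replace (l - l')%C with (- (u N - l) + (u N - l'))%C by ring.
    eapply Rle_trans; [apply Cmod_triangle|]; rewrite Cmod_opp; lra.
  - apply is_lim_seq_const.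
  - apply (is_lim_seq_plus' _ _ 0 0 H H'). }
simpl in E; assert (E0 : Cmod (l - l')%C = 0) by (generalize (Cmod_ge_0 (l - l')%C); lra).
apply Cmod_eq_0 in E0.
replace l with (l - l' + l')%C by ring; rewrite E0; ring.
Qed.

Lemma Clim_const (l : C) : Clim (fun _ => l) l.
Proof.
unfold Clim; apply is_lim_seq_ext with (fun _ : nat => 0); [|apply is_lim_seq_const].
intros _; replace (l - l)%C with (RtoC 0) by ring; symmetry; apply Cmod_0.
Qed.

Lemma Clim_ext_loc (u v : nat -> C) (l : C) (N0 : nat) :
  (forall N, (N0 <= N)%nat -> u N = v N) -> Clim u l -> Clim v l.
Proof.
intros H; unfold Clim; apply is_lim_seq_ext_loc; exists N0; intros N HN; rewrite H by exact HN; reflexivity.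
Qed.

Lemma Clim_mult (u v : nat -> C) (l l' : C) : Clim u l -> Clim v l' -> Clim (fun N => u N * v N)%C (l * l')%C.
Proof.
intros H H'.
apply (Clim_le _ _ (fun N => Cmod (u N - l)%C * Cmod (v N - l')%C + (Cmod l * Cmod (v N - l')%C + Cmod l' * Cmod (u N - l)%C)) 0).
- intros N _.
  replace (u N * v N - l * l')%C with ((u N - l) * (v N - l') + (l * (v N - l') + l' * (u N - l)))%C by ring.
  eapply Rle_trans; [apply Cmod_triangle|]; rewrite Cmod_mult; apply Rplus_le_compat_l.
  eapply Rle_trans; [apply Cmod_triangle|]; rewrite !Cmod_mult; lra.
- replace 0 with (0 * 0 + (Cmod l * 0 + Cmod l' * 0)) by ring.
  apply (is_lim_seq_plus' _ _ (0 * 0)); [apply (is_lim_seq_mult' _ _ 0 0 H H')|].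
  apply (is_lim_seq_plus' _ _ (Cmod l * 0)).
  + apply (is_lim_seq_mult' _ _ (Cmod l) 0); [apply is_lim_seq_const|exact H'].
  + apply (is_lim_seq_mult' _ _ (Cmod l') 0); [apply is_lim_seq_const|exact H].
Qed.

Lemma Clim_scal (c : C) (u : nat -> C) (l : C) : Clim u l -> Clim (fun N => c * u N)%C (c * l)%C.
Proof. apply Clim_mult, Clim_const. Qed.

Lemma lim_over_n (K : R) : is_lim_seq (fun N => K / INR (S N)) 0.
Proof.
replace 0 with (K * 0) by ring.
apply (is_lim_seq_mult' _ _ K 0); [apply is_lim_seq_const|].
apply (is_lim_seq_inv (fun N => INR (S N)) p_infty); [|discriminate].
apply (is_lim_seq_incr_1 INR), is_lim_seq_INR.
Qed.

Lemma Clim_shift (u : nat -> C) (l : C) (k : nat) : Clim u l -> Clim (fun N => u (N + k)%nat) l.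
Proof. intros H; exact (proj1 (is_lim_seq_incr_n (fun N => Cmod (u N - l)%C) k 0) H). Qed.

(** * Euler's Gamma and Beta integrals *)

Lemma Re_minus (z w : C) : Re (z - w)%C = Re z - Re w.
Proof. reflexivity. Qed.
Lemma Re_plus (z w : C) : Re (z + w)%C = Re z + Re w.
Proof. reflexivity. Qed.
Lemma Re_opp (z : C) : Re (- z)%C = - Re z.
Proof. reflexivity. Qed.
Lemma Re_RtoC (x : R) : Re (RtoC x) = x.
Proof. reflexivity. Qed.

Ltac simpl_Re := repeat first [rewrite Re_minus | rewrite Re_plus | rewrite Re_opp | rewrite Re_RtoC | rewrite Re_mult_R].

Lemma Ccont_gamma (s : C) (u : R) : 0 < u -> Ccont (fun u => Cexp (- RtoC u) * rcpow u s)%C u.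
Proof.
intros Hu; apply Ccont_mult.
- apply Ccont_ext_loc with (fun t => Cexp (- (RtoC 1 * RtoC t))%C).
  + apply filter_forall; intros t; f_equal; ring.
  + exact (Cder_Ccont _ _ _ (Cder_exp_lin _ u)).
- exact (Cder_Ccont _ _ _ (Cder_rcpow (fun t => t) _ u 1 Hu (is_derive_id u))).
Qed.

Lemma Gamma_is_CInt_pos (s : C) : 0 < Re s ->
  is_CInt_pos (fun u => Cexp (- RtoC u) * rcpow u (s - RtoC 1))%C (Gamma_Euler s).
Proof.
intros Hs.
destruct (is_CInt_pos_dom_power (Re s - 1)) as [Kp [_ H]]; [lra|].
destruct (H 1 1 (fun u => Cexp (- RtoC u) * rcpow u (s - RtoC 1))%C) as [l [Hl _]]; try lra.
- intros u Hu; apply Ccont_gamma, Hu.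
- intros u Hu; rewrite Cmod_mult, Cmod_Cexp, Cmod_rcpow; simpl_Re.
  rewrite !Rmult_1_l; lra.
- unfold Gamma_Euler; erewrite is_CInt_pos_CInt; [exact Hl|].
  apply is_CInt_pos_ext with (2 := Hl); intros u Hu; rewrite Cpower_pos by exact Hu; reflexivity.
Qed.

Lemma Gamma_is_CInt_pos_scaled (s : C) (N : R) : 0 < Re s -> 0 < N ->
  is_CInt_pos (fun u => Cexp (- RtoC (N * u)) * rcpow u (s - RtoC 1))%C (rcpow N (- s)%C * Gamma_Euler s)%C.
Proof.
intros Hs HN; assert (H := is_CInt_pos_scale N _ _ HN (Gamma_is_CInt_pos s Hs)).
apply is_CInt_pos_scal with (c := rcpow N (- s)%C) in H.
apply is_CInt_pos_ext with (2 := H); intros u Hu.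
rewrite rcpow_mult by assumption.
replace (RtoC N) with (rcpow N (RtoC 1)) by (apply rcpow_1, HN).
replace (rcpow N (- s) * (rcpow N (RtoC 1) * (Cexp (- RtoC (N * u)) * (rcpow N (s - RtoC 1) * rcpow u (s - RtoC 1)))))%C
  with (rcpow N (- s) * rcpow N (RtoC 1) * rcpow N (s - RtoC 1) * (Cexp (- RtoC (N * u)) * rcpow u (s - RtoC 1)))%C by ring.
rewrite <- !rcpow_plus; replace (- s + RtoC 1 + (s - RtoC 1))%C with (RtoC 0) by ring.
rewrite rcpow_0; ring.
Qed.

(** The primitive is [e^(-u) u^s], which vanishes at both ends since [0 < Re s]. *)
Lemma Gamma_S (s : C) : 0 < Re s -> Gamma_Euler (s + RtoC 1)%C = (s * Gamma_Euler s)%C.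
Proof.
intros Hs.
assert (H1 := Gamma_is_CInt_pos s Hs).
assert (H2 := Gamma_is_CInt_pos (s + RtoC 1)%C); simpl_Re; rewrite Re_plus, Re_RtoC in H2.
specialize (H2 ltac:(lra)).
assert (H3 := is_CInt_pos_minus _ _ _ _ (is_CInt_pos_scal s _ _ H1) H2).
assert (H0 : is_CInt_pos (fun u => s * (Cexp (- RtoC u) * rcpow u (s - RtoC 1)) - Cexp (- RtoC u) * rcpow u (s + RtoC 1 - RtoC 1))%C (RtoC 0)).
{ apply (is_CInt_pos_FTC_0 (fun u => Cexp (- RtoC u) * rcpow u s)%C _ 1 (Re s) 1); try lra.
  - intros u Hu.
    assert (E : forall t, Cexp (- RtoC t)%C = Cexp (- (RtoC 1 * RtoC t))%C) by (intros; f_equal; ring).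
    apply Cder_ext with (fun t => Cexp (- (RtoC 1 * RtoC t)) * rcpow t s)%C; [intros; rewrite E; reflexivity|].
    eapply Cder_eq; [exact (Cder_mult _ _ _ _ _ (Cder_exp_lin (RtoC 1) u) (Cder_rcpow (fun t => t) s u 1 Hu (is_derive_id u)))|].
    rewrite E; replace (s + RtoC 1 - RtoC 1)%C with (s - RtoC 1 + RtoC 1)%C by ring.
    replace s with (s - RtoC 1 + RtoC 1)%C at 1 3 by ring.
    rewrite !rcpow_plus, (rcpow_1 u Hu), RtoC_div by lra.
    assert (RtoC u <> RtoC 0) by (intros A; injection A; lra).
    field; assumption.
  - intros u Hu.
    apply Ccont_ext_loc with (fun u => s * (Cexp (- RtoC u) * rcpow u (s - RtoC 1)) + RtoC (-1) * (Cexp (- RtoC u) * rcpow u (s + RtoC 1 - RtoC 1)))%C.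
    + apply filter_forall; intros; ring.
    + apply Ccont_plus; (apply Ccont_mult; [apply Ccont_const|apply Ccont_gamma, Hu]).
  - intros u Hu; rewrite Cmod_mult, Cmod_Cexp, Cmod_rcpow; simpl_Re; rewrite !Rmult_1_l; lra. }
assert (E := is_CInt_pos_det _ _ _ H3 H0).
replace (Gamma_Euler (s + RtoC 1)) with (s * Gamma_Euler s - (s * Gamma_Euler s - Gamma_Euler (s + RtoC 1)))%C by ring.
rewrite E; ring.
Qed.

Lemma one_minus_exp_bounds (v : R) : 0 < v -> v / (1 + v) <= 1 - exp (- v) <= v.
Proof.
intros Hv; split.
- rewrite exp_Ropp.
  assert (H := exp_ineq1_le v).
  assert (/ exp v <= / (1 + v)) by (apply Rinv_le_contravar; lra).
  replace (v / (1 + v)) with (1 - / (1 + v)) by (field; lra); lra.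
- generalize (exp_ineq1_le (- v)); lra.
Qed.

Lemma one_minus_exp_pos (v : R) : 0 < v -> 0 < 1 - exp (- v).
Proof.
intros Hv; destruct (one_minus_exp_bounds v Hv) as [H _].
assert (0 < v / (1 + v)) by (apply Rdiv_lt_0_compat; lra); lra.
Qed.

(** Replacing [1 - e^(-v)] by [v] costs at most a factor [1 + v], in either direction. *)
Lemma ln_one_minus_exp (v : R) : 0 < v -> Rabs (ln (1 - exp (- v)) - ln v) <= ln (1 + v).
Proof.
intros Hv; destruct (one_minus_exp_bounds v Hv) as [H1 H2].
assert (H0 : 0 < v / (1 + v)) by (apply Rdiv_lt_0_compat; lra).
assert (H3 := ln_le _ _ H0 H1); assert (H4 := ln_le (1 - exp (- v)) v ltac:(lra) H2).
rewrite ln_div in H3 by lra.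
assert (0 <= ln (1 + v)) by (rewrite <- ln_1; apply ln_le; lra).
apply Rabs_le; lra.
Qed.

Lemma ln_1p_le (v : R) : 0 < v -> ln (1 + v) <= v.
Proof. intros Hv; generalize (ln_le_sub_1 (1 + v)); lra. Qed.

Lemma Rabs_mult_le (x y M : R) : Rabs y <= M -> x * y <= Rabs x * M.
Proof.
intros H; eapply Rle_trans; [apply Rle_abs|]; rewrite Rabs_mult.
apply Rmult_le_compat_l; [apply Rabs_pos|exact H].
Qed.

(** The power of [1 - e^(-u)] is at most [u^p (1 + u)^|p|]; half of the exponential decay absorbs
    the second factor and the other half feeds [is_CInt_pos_dom_power]. *)
Lemma is_CInt_pos_dom_beta (g p : R) : 0 < g -> -1 < p ->
  exists Kp, 0 < Kp /\ forall (M : R) (f : R -> C), 0 <= M ->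
    (forall u, 0 < u -> Ccont f u) ->
    (forall u, 0 < u -> Cmod (f u) <= M * (Rpower (1 - exp (- u)) p * exp (- (g * u)))) ->
    exists l, is_CInt_pos f l /\ Cmod l <= M * Kp.
Proof.
intros Hg Hp.
destruct (is_CInt_pos_dom_power p Hp) as [Kp [HKp H]].
destruct (Rpower_exp_bound (Rabs p) (g / 2) (Rabs_pos p)) as [K1 [HK1 HE]]; [lra|].
set (K2 := K1 * exp (g / 2)).
assert (HK2 : 0 < K2) by (apply Rmult_lt_0_compat; [exact HK1|apply exp_pos]).
exists (K2 * (Kp * Rpower (g / 2) (- (p + 1)))); split.
{ repeat apply Rmult_lt_0_compat; auto; apply exp_pos. }
intros M f HM Hf HB.
destruct (H (M * K2) (g / 2) f) as [l [Hl Bl]]; auto; try nra.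
- intros u Hu; eapply Rle_trans; [apply HB, Hu|].
  rewrite Rmult_assoc; apply Rmult_le_compat_l; [exact HM|].
  assert (E : Rpower (1 - exp (- u)) p <= Rpower u p * Rpower (1 + u) (Rabs p)).
  { unfold Rpower; rewrite <- exp_plus; apply exp_le.
    assert (A := Rabs_mult_le p _ _ (ln_one_minus_exp u Hu)); lra. }
  assert (E2 := HE (1 + u) ltac:(lra)).
  apply Rle_trans with (Rpower u p * (K1 * exp (g / 2 * (1 + u))) * exp (- (g * u))).
  + apply Rmult_le_compat_r; [left; apply exp_pos|].
    eapply Rle_trans; [exact E|]; apply Rmult_le_compat_l; [left; apply Rpower_pos|exact E2].
  + right; unfold K2.
    replace (exp (g / 2 * (1 + u))) with (exp (g / 2) * exp (g / 2 * u)) by (rewrite <- exp_plus; f_equal; ring).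
    replace (exp (- (g * u))) with (exp (- (g / 2 * u)) * / exp (g / 2 * u)) by (rewrite <- exp_Ropp, <- exp_plus; f_equal; field).
    field; apply Rgt_not_eq, exp_pos.
- exists l; split; [exact Hl|]; eapply Rle_trans; [exact Bl|]; right; ring.
Qed.

(** With [t = e^(-v)] the integral is that of [t^(c - 1) (1 - t)^a] over []0, 1[], that is Euler's
    [B(c, a + 1)]. *)
Definition beta_integrand (c a : C) (v : R) : C := (Cexp (- (c * RtoC v)) * rcpow (1 - exp (- v)) a)%C.

Definition Beta_int (c a : C) : C := CInt_pos (beta_integrand c a).

Lemma is_derive_one_minus_exp (v : R) : is_derive (fun t => 1 - exp (- t)) v (exp (- v)).
Proof. auto_derive; [exact I|ring]. Qed.

Lemma Ccont_beta_integrand (c a : C) (v : R) : 0 < v -> Ccont (beta_integrand c a) v.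
Proof.
intros Hv; apply Ccont_mult; [exact (Cder_Ccont _ _ _ (Cder_exp_lin c v))|].
exact (Cder_Ccont _ _ _ (Cder_rcpow _ a v _ (one_minus_exp_pos v Hv) (is_derive_one_minus_exp v))).
Qed.

Lemma Cmod_beta_integrand (c a : C) (v : R) : Cmod (beta_integrand c a v) = Rpower (1 - exp (- v)) (Re a) * exp (- (Re c * v)).
Proof. unfold beta_integrand; rewrite Cmod_mult, Cmod_Cexp, Cmod_rcpow; simpl_Re; ring. Qed.

Lemma is_CInt_pos_Beta_int (c a : C) : 0 < Re c -> -1 < Re a -> is_CInt_pos (beta_integrand c a) (Beta_int c a).
Proof.
intros Hc Ha; destruct (is_CInt_pos_dom_beta (Re c) (Re a) Hc Ha) as [K [_ H]].
destruct (H 1 (beta_integrand c a)) as [l [Hl _]]; try lra.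
- apply Ccont_beta_integrand.
- intros u _; rewrite Cmod_beta_integrand; lra.
- unfold Beta_int; rewrite (is_CInt_pos_CInt _ _ Hl); exact Hl.
Qed.

Lemma beta_integrand_shift (c a : C) (v : R) : beta_integrand (c + RtoC 1)%C a v = (RtoC (exp (- v)) * beta_integrand c a v)%C.
Proof.
unfold beta_integrand; rewrite <- Cexp_real.
replace (- ((c + RtoC 1) * RtoC v))%C with (RtoC (- v) + - (c * RtoC v))%C by (rewrite RtoC_opp; ring).
rewrite Cexp_plus; ring.
Qed.

(** Integration of the derivative of [e^(- c v) (1 - e^(-v))^(a + 1)]. *)
Lemma Beta_int_rec (c a : C) : 0 < Re c -> -1 < Re a ->
  (c * Beta_int c a = (a + RtoC 1 + c) * Beta_int (c + RtoC 1) a)%C.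
Proof.
intros Hc Ha.
assert (H1 := is_CInt_pos_Beta_int c a Hc Ha).
assert (H2 := is_CInt_pos_Beta_int (c + RtoC 1)%C a ltac:(rewrite Re_plus, Re_RtoC; lra) Ha).
assert (H3 := is_CInt_pos_minus _ _ _ _ (is_CInt_pos_scal (a + RtoC 1 + c)%C _ _ H2) (is_CInt_pos_scal c _ _ H1)).
assert (H0 : is_CInt_pos (fun v => (a + RtoC 1 + c) * beta_integrand (c + RtoC 1) a v - c * beta_integrand c a v)%C (RtoC 0)).
{ apply (is_CInt_pos_FTC_0 (fun v => Cexp (- (c * RtoC v)) * rcpow (1 - exp (- v)) (a + RtoC 1))%C _ 1 (Re a + 1) (Re c)); try lra.
  - intros u Hu; assert (Hp := one_minus_exp_pos u Hu).
    eapply Cder_eq; [exact (Cder_mult _ _ _ _ _ (Cder_exp_lin c u) (Cder_rcpow _ (a + RtoC 1)%C u _ Hp (is_derive_one_minus_exp u)))|].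
    rewrite beta_integrand_shift; unfold beta_integrand; rewrite rcpow_plus, (rcpow_1 _ Hp), RtoC_div, !RtoC_minus by lra.
    assert (RtoC 1 - RtoC (exp (- u)) <> RtoC 0)%C by (rewrite <- RtoC_minus; intros A; injection A; lra).
    field; assumption.
  - intros u Hu; apply Ccont_ext_loc with (fun v => (a + RtoC 1 + c) * beta_integrand (c + RtoC 1) a v + (- c) * beta_integrand c a v)%C.
    + apply filter_forall; intros; ring.
    + apply Ccont_plus; (apply Ccont_mult; [apply Ccont_const|apply Ccont_beta_integrand, Hu]).
  - intros u Hu; rewrite Cmod_mult, Cmod_Cexp, Cmod_rcpow; simpl_Re.
    assert (Hp := one_minus_exp_pos u Hu); destruct (one_minus_exp_bounds u Hu) as [_ Hb].
    rewrite Rmult_1_l, Rmult_comm; apply Rmult_le_compat_r; [left; apply exp_pos|].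
    unfold Rpower; apply exp_le, Rmult_le_compat_l; [lra|apply ln_le; auto]. }
assert (E := is_CInt_pos_det _ _ _ H3 H0).
replace (c * Beta_int c a)%C with ((a + RtoC 1 + c) * Beta_int (c + RtoC 1) a - ((a + RtoC 1 + c) * Beta_int (c + RtoC 1) a - c * Beta_int c a))%C by ring.
rewrite E; ring.
Qed.

Lemma Beta_int_1 (a : C) : -1 < Re a -> ((a + RtoC 1) * Beta_int (RtoC 1) a = RtoC 1)%C.
Proof.
intros Ha.
assert (H1 := is_CInt_pos_scal (a + RtoC 1)%C _ _ (is_CInt_pos_Beta_int (RtoC 1) a ltac:(rewrite Re_RtoC; lra) Ha)).
set (s := (a + RtoC 1)%C) in *.
assert (Hs : 0 < Re s) by (unfold s; simpl_Re; lra).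
assert (E : (RtoC 1 - RtoC 0 = RtoC 1)%C) by ring.
refine (is_CInt_pos_det _ _ _ H1 _).
refine (eq_ind _ (fun z => is_CInt_pos _ z) _ _ E); clear E H1.
apply (is_CInt_pos_FTC (fun v => rcpow (1 - exp (- v)) s)).
- intros u Hu; assert (Hp := one_minus_exp_pos u Hu).
  eapply Cder_eq; [exact (Cder_rcpow _ s u _ Hp (is_derive_one_minus_exp u))|].
  unfold beta_integrand, s; rewrite rcpow_plus, (rcpow_1 _ Hp), RtoC_div, !RtoC_minus by lra.
  replace (- (RtoC 1 * RtoC u))%C with (RtoC (- u)) by (rewrite RtoC_opp; ring). rewrite Cexp_real.
  assert (RtoC 1 - RtoC (exp (- u)) <> RtoC 0)%C by (rewrite <- RtoC_minus; intros A; injection A; lra).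
  field; assumption.
- intros u Hu; apply Ccont_mult; [apply Ccont_const|apply Ccont_beta_integrand, Hu].
- apply (lim_Rpower_0 _ 1 (Re s)); try lra.
  intros u Hu; replace (rcpow (1 - exp (- u)) s - RtoC 0)%C with (rcpow (1 - exp (- u)) s) by ring.
  rewrite Cmod_rcpow, Rmult_1_l; unfold Rpower; apply exp_le, Rmult_le_compat_l; [lra|].
  apply ln_le; [apply one_minus_exp_pos; lra|apply one_minus_exp_bounds; lra].
- intros e He.
  (* For [w = e^(-v) <= 1/2], [1 - (1 - w)^s] is at most [4 |s| w]: one factor 2 comes from
     [Cexp_diff], the other from [- ln (1 - w) <= 2 w]. *)
  destruct (lim_exp_infty (fun v => 4 * Cmod s * exp (- v)) (4 * Cmod s) 1) with (e := e) as [M HM]; auto; try lra.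
  { generalize (Cmod_ge_0 s); lra. }
  { intros u _; rewrite Rmult_1_l; lra. }
  exists (Rmax 1 M); intros u Hu.
  assert (Hu1 := Rle_lt_trans _ _ _ (Rmax_l _ _) Hu).
  eapply Rle_lt_trans; [|apply (HM u), (Rle_lt_trans _ _ _ (Rmax_r _ _) Hu)].
  assert (Hp := one_minus_exp_pos u ltac:(lra)).
  assert (He1 : 0 < exp (- u)) by apply exp_pos.
  assert (Hlt : exp (- u) <= / 2).
  { rewrite exp_Ropp; apply Rinv_le_contravar; [lra|]; generalize (exp_ineq1_le u); lra. }
  assert (Hln : ln (1 - exp (- u)) <= 0) by (rewrite <- ln_1; apply ln_le; lra).
  replace (RtoC 1) with (Cexp (RtoC 0)) by apply Cexp_0.
  unfold rcpow; eapply Rle_trans; [apply (Cexp_diff _ _ 0)|].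
  + simpl_Re; nra.
  + rewrite Re_RtoC; lra.
  + rewrite exp_0; replace (s * RtoC (ln (1 - exp (- u))) - RtoC 0)%C with (s * RtoC (ln (1 - exp (- u))))%C by ring.
    rewrite Cmod_mult, Cmod_R, Rabs_left1 by exact Hln.
    assert (- ln (1 - exp (- u)) <= 2 * exp (- u)).
    { rewrite <- ln_Rinv by exact Hp; eapply Rle_trans; [apply ln_le_sub_1, Rinv_0_lt_compat, Hp|].
      apply Rmult_le_reg_r with (1 - exp (- u)); [exact Hp|].
      rewrite Rmult_minus_distr_r, Rinv_l by lra; nra. }
    generalize (Cmod_ge_0 s); nra.
Qed.

Lemma rising_shift (s : C) (N : nat) : rising s (S N) = (s * rising (s + RtoC 1) N)%C.
Proof.
induction N as [|N IH]; [simpl; ring|].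
replace (rising s (S (S N))) with (rising s (S N) * (s + RtoC (INR (S N))))%C by reflexivity.
rewrite IH, S_INR, RtoC_plus; simpl; ring.
Qed.

Lemma Beta_int_iter (c a : C) (N : nat) : 0 < Re c -> -1 < Re a ->
  (rising c N * Beta_int c a = rising (a + RtoC 1 + c) N * Beta_int (c + RtoC (INR N)) a)%C.
Proof.
intros Hc Ha; induction N as [|N IH].
- simpl; replace (c + RtoC 0)%C with c by ring; ring.
- simpl rising; rewrite S_INR, RtoC_plus.
  replace (rising c N * (c + RtoC (INR N)) * Beta_int c a)%C with ((rising c N * Beta_int c a) * (c + RtoC (INR N)))%C by ring.
  rewrite IH.
  assert (E := Beta_int_rec (c + RtoC (INR N))%C a ltac:(rewrite Re_plus, Re_RtoC; generalize (pos_INR N); lra) Ha).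
  replace (rising (a + RtoC 1 + c) N * Beta_int (c + RtoC (INR N)) a * (c + RtoC (INR N)))%C
    with (rising (a + RtoC 1 + c) N * ((c + RtoC (INR N)) * Beta_int (c + RtoC (INR N)) a))%C by ring.
  rewrite E; replace (c + (RtoC (INR N) + RtoC 1))%C with (c + RtoC (INR N) + RtoC 1)%C by ring; ring.
Qed.

(* Concentration at [v = O(1 / N)], where [1 - exp (- v)] is close to [v]. *)
Lemma Beta_int_asym (c a : C) : 0 < Re c -> -1 < Re a ->
  Clim (fun N => rcpow (INR (S N)) (a + RtoC 1) * Beta_int (c + RtoC (INR (S N))) a)%C (Gamma_Euler (a + RtoC 1)).
Proof.
intros Hc Ha.
(* The exponents of the two integrands compared below differ by at most [k u]. *)
set (k := Cmod c + Cmod a).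
assert (Hk0 : 0 <= k) by (generalize (Cmod_ge_0 c) (Cmod_ge_0 a); unfold k; lra).
destruct (is_CInt_pos_dom_power (Re a + 1)) as [Kp [HKp HD]]; [lra|].
destruct (archimed (2 * k)) as [Hup _].
set (N0 := Z.to_nat (up (2 * k))).
(* From [N0] on, the decay rate [n - k] is at least [n / 2]; this produces the power of 2 in the
   bound. *)
assert (HN0 : forall N, (N0 <= N)%nat -> 2 * k < INR (S N)).
{ intros N HN; apply Rlt_le_trans with (1 := Hup).
  apply le_INR in HN; unfold N0 in HN; rewrite INR_IZR_INZ in HN.
  rewrite S_INR; destruct (Z.le_gt_cases 0 (up (2 * k))) as [Hz|Hz].
  - rewrite Z2Nat.id in HN by exact Hz; lra.
  - apply IZR_lt in Hz; generalize (pos_INR N); lra. }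
apply (Clim_le _ _ (fun N => 2 * k * (Kp * Rpower 2 (Re a + 2)) / INR (S N)) N0); [|apply lim_over_n].
intros N HN; specialize (HN0 N HN); set (n := INR (S N)) in *.
assert (Hn : 0 < n) by (unfold n; rewrite S_INR; generalize (pos_INR N); lra).
assert (H1 := is_CInt_pos_Beta_int (c + RtoC n)%C a ltac:(rewrite Re_plus, Re_RtoC; lra) Ha).
assert (H2 := Gamma_is_CInt_pos_scaled (a + RtoC 1)%C n ltac:(simpl_Re; lra) Hn).
assert (H3 := is_CInt_pos_minus _ _ _ _ H1 H2).
(* The factor [k u] raises the power of [u] at 0 from [Re a] to [Re a + 1]; after scaling by [n]
   this gains the factor [1 / n]. *)
destruct (HD (2 * k) (n - k) (fun v => beta_integrand (c + RtoC n) a v - Cexp (- RtoC (n * v)) * rcpow v (a + RtoC 1 - RtoC 1))%C)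
  as [l [Hl Bl]]; try lra.
- intros u Hu; apply Ccont_ext_loc with (fun v => beta_integrand (c + RtoC n) a v + RtoC (-1) * (Cexp (- (RtoC n * RtoC v)) * rcpow v (a + RtoC 1 - RtoC 1)))%C.
  + apply filter_forall; intros t; rewrite RtoC_mult; ring.
  + apply Ccont_plus; [apply Ccont_beta_integrand, Hu|]; apply Ccont_mult; [apply Ccont_const|].
    apply Ccont_mult; [exact (Cder_Ccont _ _ _ (Cder_exp_lin _ u))|].
    exact (Cder_Ccont _ _ _ (Cder_rcpow (fun t => t) _ u 1 Hu (is_derive_id u))).
- intros u Hu.
  replace (a + RtoC 1 - RtoC 1)%C with a by ring.
  unfold beta_integrand, rcpow; rewrite <- !Cexp_plus.
  assert (Hln := ln_one_minus_exp u Hu); assert (Hl1 := ln_1p_le u Hu).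
  assert (Hla : Rabs (ln (1 - exp (- u)) - ln u) <= u) by lra.
  eapply Rle_trans; [apply (Cexp_diff _ _ (Re a * ln u - (n - k) * u))|].
  + simpl_Re; rewrite Rmult_plus_distr_r.
    assert (A := Rabs_mult_le (Re a) _ _ Hla).
    assert (B := Rmult_le_compat_r u _ _ (Rlt_le _ _ Hu) (re_le_Cmod a)).
    assert (0 <= Re c * u) by nra.
    assert (0 <= Cmod c * u) by (apply Rmult_le_pos; [apply Cmod_ge_0|lra]).
    unfold k; lra.
  + simpl_Re; assert (0 <= k * u) by nra; lra.
  + replace (- ((c + RtoC n) * RtoC u) + a * RtoC (ln (1 - exp (- u))) - (- RtoC (n * u) + a * RtoC (ln u)))%C
      with (- (c * RtoC u) + a * RtoC (ln (1 - exp (- u)) - ln u))%C by (rewrite RtoC_mult, RtoC_minus; ring).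
    assert (Cmod (- (c * RtoC u) + a * RtoC (ln (1 - exp (- u)) - ln u))%C <= k * u).
    { eapply Rle_trans; [apply Cmod_triangle|]; rewrite Cmod_opp, !Cmod_mult, !Cmod_R, (Rabs_right u) by lra.
      assert (A := Rmult_le_compat_l _ _ _ (Cmod_ge_0 a) Hla); unfold k; lra. }
    apply Rle_trans with (2 * (k * u * exp (Re a * ln u - (n - k) * u))).
    * apply Rmult_le_compat_l; [lra|]; apply Rmult_le_compat_r; [left; apply exp_pos|assumption].
    * right; replace (Rpower u (Re a + 1)) with (Rpower u (Re a) * u) by (rewrite Rpower_plus, Rpower_1; auto).
      unfold Rminus; rewrite exp_plus; fold (Rpower u (Re a)).
      replace (- ((n - k) * u)) with (- (n + - k) * u) by ring; replace (- ((n + - k) * u)) with (- (n + - k) * u) by ring; ring.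
- assert (E := is_CInt_pos_det _ _ _ H3 Hl).
  assert (E2 : (rcpow n (a + RtoC 1) * Beta_int (c + RtoC n) a - Gamma_Euler (a + RtoC 1) = rcpow n (a + RtoC 1) * l)%C).
  { rewrite <- E, rcpow_opp; field; apply rcpow_neq_0. }
  rewrite E2, Cmod_mult, Cmod_rcpow; simpl_Re.
  apply Rle_trans with (Rpower n (Re a + 1) * (2 * k * (Kp * Rpower (n - k) (- (Re a + 1 + 1))))).
  { apply Rmult_le_compat_l; [left; apply Rpower_pos|exact Bl]. }
  assert (E3 : Rpower (n - k) (- (Re a + 1 + 1)) <= Rpower n (- (Re a + 2)) * Rpower 2 (Re a + 2)).
  { unfold Rpower; rewrite <- exp_plus; apply exp_le.
    assert (ln (n / 2) <= ln (n - k)) by (apply ln_le; lra).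
    rewrite ln_div in H by lra. nra. }
  apply Rle_trans with (Rpower n (Re a + 1) * (2 * k * (Kp * (Rpower n (- (Re a + 2)) * Rpower 2 (Re a + 2))))).
  { apply Rmult_le_compat_l; [left; apply Rpower_pos|]; apply Rmult_le_compat_l; [lra|]; apply Rmult_le_compat_l; lra. }
  right.
  assert (E4 : Rpower n (Re a + 1) * Rpower n (- (Re a + 2)) = / n).
  { rewrite <- Rpower_plus; replace (Re a + 1 + - (Re a + 2)) with (- (1)) by ring; rewrite Rpower_Ropp, Rpower_1; auto. }
  unfold Rdiv; rewrite <- E4; ring.
Qed.

Lemma RtoC_neq_0 (x : R) : x <> 0 -> RtoC x <> RtoC 0.
Proof. intros Hx A; apply Hx; exact (f_equal fst A). Qed.

Lemma rising_1 (N : nat) : rising (RtoC 1) N = RtoC (INR (fact N)).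
Proof.
induction N as [|N IH]; [reflexivity|].
simpl rising; rewrite IH, fact_simpl, mult_INR, S_INR, <- RtoC_plus, <- RtoC_mult; f_equal; ring.
Qed.

(** By [gauss_eq] this is Gauss's quotient [n! n^z / (z (z + 1) ... (z + n))] with [n = N + 1]; in
    the form of a Beta integral its limit is already known. *)
Definition gauss_seq (z : C) (N : nat) : C :=
  (rcpow (INR (S N)) z * Beta_int (RtoC 1 + RtoC (INR (S N))) (z - RtoC 1))%C.

Lemma gauss_lim (z : C) : 0 < Re z -> Clim (gauss_seq z) (Gamma_Euler z).
Proof.
intros Hz.
assert (H := Beta_int_asym (RtoC 1) (z - RtoC 1)%C ltac:(rewrite Re_RtoC; lra) ltac:(simpl_Re; lra)).
unfold gauss_seq; replace (z - RtoC 1 + RtoC 1)%C with z in H by ring; exact H.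
Qed.

Lemma gauss_eq (z : C) (N : nat) : 0 < Re z ->
  (RtoC (INR (fact (S N))) * rcpow (INR (S N)) z = rising z (S (S N)) * gauss_seq z N)%C.
Proof.
intros Hz; unfold gauss_seq.
assert (H := Beta_int_iter (RtoC 1) (z - RtoC 1)%C (S N) ltac:(rewrite Re_RtoC; lra) ltac:(simpl_Re; lra)).
assert (H1 := Beta_int_1 (z - RtoC 1)%C ltac:(simpl_Re; lra)).
replace (z - RtoC 1 + RtoC 1)%C with z in * by ring.
rewrite rising_1 in H; rewrite (rising_shift z).
replace (z * rising (z + RtoC 1) (S N) * (rcpow (INR (S N)) z * Beta_int (RtoC 1 + RtoC (INR (S N))) (z - RtoC 1)))%C
  with (z * rcpow (INR (S N)) z * (rising (z + RtoC 1) (S N) * Beta_int (RtoC 1 + RtoC (INR (S N))) (z - RtoC 1)))%C by ring.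
rewrite <- H.
replace (z * rcpow (INR (S N)) z * (RtoC (INR (fact (S N))) * Beta_int (RtoC 1) (z - RtoC 1)))%C
  with (RtoC (INR (fact (S N))) * rcpow (INR (S N)) z * (z * Beta_int (RtoC 1) (z - RtoC 1)))%C by ring.
rewrite H1; ring.
Qed.

(** The first-order term has to be [Re w] and not the modulus: in the product below it produces the
    exact growth [N^(Re z)]. *)
Lemma Cmod_1_plus_le (w : C) : Cmod (RtoC 1 + w)%C <= exp (Re w + (Cmod w) ^ 2 / 2).
Proof.
assert (E : Cmod (RtoC 1 + w)%C ^ 2 = 1 + 2 * Re w + Cmod w ^ 2).
{ destruct w as [x y]; unfold Cmod; rewrite !pow2_sqrt by (apply Rplus_le_le_0_compat; apply pow2_ge_0); simpl; ring. }
apply Rsqr_incr_0_var; [|left; apply exp_pos].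
unfold Rsqr; rewrite <- exp_plus.
replace (Cmod (RtoC 1 + w)%C * Cmod (RtoC 1 + w)%C) with (Cmod (RtoC 1 + w)%C ^ 2) by ring.
rewrite E; eapply Rle_trans; [|apply exp_ineq1_le]; lra.
Qed.

(** Each factor is [M (1 + z / M)]. The first-order terms add up to a harmonic sum, at most
    [1 + ln], and the second-order ones telescope since [1 / (2 M^2) <= 1 / M - 1 / (M + 1)]. *)
Lemma rising_bound (z : C) (N : nat) : 0 < Re z ->
  Cmod (rising (z + RtoC 1) (S N)) <=
  INR (fact (S N)) * exp (Re z * (1 + ln (INR (S N))) + Cmod z ^ 2 * (1 - / INR (S (S N)))).
Proof.
intros Hz.
assert (Hfac : forall M : nat, Cmod (z + RtoC 1 + RtoC (INR M))%C <=
  INR (S M) * exp (Re z / INR (S M) + Cmod z ^ 2 * (/ INR (S M) - / INR (S (S M))))).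
{ intros M; set (n := INR (S M)).
  assert (Hn : 1 <= n) by (unfold n; rewrite S_INR; generalize (pos_INR M); lra).
  replace (INR (S (S M))) with (n + 1) by (unfold n; rewrite !S_INR; ring).
  replace (z + RtoC 1 + RtoC (INR M))%C with (RtoC n * (RtoC 1 + z * RtoC (/ n)))%C.
  2: { assert (En : RtoC n = (RtoC (INR M) + RtoC 1)%C) by (unfold n; rewrite S_INR, RtoC_plus; reflexivity).
       assert (HnC : RtoC n <> RtoC 0) by (apply RtoC_neq_0; lra).
       rewrite RtoC_inv by lra.
       transitivity (RtoC n + z)%C; [field; exact HnC|rewrite En; ring]. }
  rewrite Cmod_mult, Cmod_R, Rabs_right by lra; apply Rmult_le_compat_l; [lra|].
  eapply Rle_trans; [apply Cmod_1_plus_le|]; apply exp_le; rewrite Re_mult_R, Cmod_mult, Cmod_R.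
  rewrite Rabs_right by (apply Rle_ge; left; apply Rinv_0_lt_compat; lra).
  apply Rplus_le_compat_l.
  replace ((Cmod z * / n) ^ 2 / 2) with (Cmod z ^ 2 * (/ n * / n / 2)) by (field; lra).
  apply Rmult_le_compat_l; [apply pow2_ge_0|].
  replace (/ n - / (n + 1)) with (/ n * / (n + 1)) by (field; lra).
  unfold Rdiv; rewrite Rmult_assoc; apply Rmult_le_compat_l; [left; apply Rinv_0_lt_compat; lra|].
  rewrite <- Rinv_mult; apply Rinv_le_contravar; lra. }
induction N as [|N IH].
- simpl rising; simpl fact.
  replace (RtoC 1 * (z + RtoC 1 + RtoC 0))%C with (z + RtoC 1 + RtoC (INR 0))%C by (simpl; ring).
  eapply Rle_trans; [apply (Hfac 0%nat)|]; right.
  replace (INR (fact 1)) with 1 by reflexivity; replace (INR 1) with 1 by reflexivity; rewrite ln_1.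
  do 2 f_equal; field.
  apply not_0_INR; lia.
- replace (rising (z + RtoC 1) (S (S N))) with (rising (z + RtoC 1) (S N) * (z + RtoC 1 + RtoC (INR (S N))))%C by reflexivity.
  rewrite Cmod_mult.
  eapply Rle_trans; [apply Rmult_le_compat; [apply Cmod_ge_0|apply Cmod_ge_0|exact IH|apply Hfac]|].
  rewrite (fact_simpl (S N)), mult_INR.
  set (n := INR (S N)); set (n1 := INR (S (S N))); set (n2 := INR (S (S (S N)))).
  assert (Hn : 0 < n) by (unfold n; rewrite S_INR; generalize (pos_INR N); lra).
  assert (Hn1 : n1 = n + 1) by (unfold n1, n; rewrite (S_INR (S N)); ring).
  replace (INR (fact (S N)) * exp (Re z * (1 + ln n) + Cmod z ^ 2 * (1 - / n1)) *
    (n1 * exp (Re z / n1 + Cmod z ^ 2 * (/ n1 - / n2))))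
  with (n1 * INR (fact (S N)) * (exp (Re z * (1 + ln n) + Cmod z ^ 2 * (1 - / n1)) * exp (Re z / n1 + Cmod z ^ 2 * (/ n1 - / n2)))) by ring.
  rewrite <- exp_plus; apply Rmult_le_compat_l; [apply Rmult_le_pos; [lra|apply pos_INR]|].
  apply exp_le.
  assert (A : / n1 <= ln n1 - ln n).
  { assert (B := ln_le_sub_1 (n / n1) ltac:(apply Rdiv_lt_0_compat; lra)).
    rewrite ln_div in B by lra.
    replace (n / n1 - 1) with (- / n1) in B by (rewrite Hn1; field; lra); lra. }
  apply Rmult_le_compat_l with (r := Re z) in A; [|lra].
  unfold Rdiv; nra.
Qed.

(* [1 / Gamma z] is approached by [rising z (N + 1) / (N! N ^ z)], which stays bounded. *)
Lemma Gamma_neq_0 (z : C) : 0 < Re z -> Gamma_Euler z <> RtoC 0.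
Proof.
intros Hz E.
assert (H := gauss_lim z Hz); rewrite E in H; unfold Clim in H.
set (K := Cmod z * exp (Re z + Cmod z ^ 2)).
assert (Hb : forall N, 1 <= K * Cmod (gauss_seq z N - RtoC 0)%C).
{ intros N; replace (gauss_seq z N - RtoC 0)%C with (gauss_seq z N) by ring.
  assert (G := f_equal Cmod (gauss_eq z N Hz)).
  rewrite rising_shift, !Cmod_mult, Cmod_rcpow, Cmod_R, Rabs_right in G by (apply Rle_ge, pos_INR).
  assert (B := rising_bound z N Hz).
  set (n := INR (S N)) in *; set (n1 := INR (S (S N))) in *.
  assert (Hn : 0 < n) by (unfold n; rewrite S_INR; generalize (pos_INR N); lra).
  assert (HF : 0 < INR (fact (S N))) by apply INR_fact_lt_0.
  assert (Hn1 : 0 < / n1) by (apply Rinv_0_lt_compat; unfold n1; rewrite S_INR; fold n; lra).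
  assert (HP := Rpower_pos n (Re z)).
  assert (B2 : Cmod (rising (z + RtoC 1) (S N)) <= INR (fact (S N)) * Rpower n (Re z) * exp (Re z + Cmod z ^ 2)).
  { eapply Rle_trans; [exact B|]; rewrite Rmult_assoc; apply Rmult_le_compat_l; [lra|].
    unfold Rpower; rewrite <- exp_plus; apply exp_le.
    generalize (pow2_ge_0 (Cmod z)); nra. }
  assert (Hg := Cmod_ge_0 (gauss_seq z N)); assert (Hzz := Cmod_ge_0 z).
  apply Rmult_le_reg_l with (INR (fact (S N)) * Rpower n (Re z)); [nra|].
  rewrite Rmult_1_r; eapply Rle_trans; [right; exact G|].
  replace (INR (fact (S N)) * Rpower n (Re z) * (K * Cmod (gauss_seq z N)))
    with (Cmod z * (INR (fact (S N)) * Rpower n (Re z) * exp (Re z + Cmod z ^ 2)) * Cmod (gauss_seq z N)) by (unfold K; ring).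
  apply Rmult_le_compat_r; [exact Hg|]; apply Rmult_le_compat_l; assumption. }
assert (L : Rbar_le 1 (K * 0)).
{ apply (is_lim_seq_le (fun _ => 1) (fun N => K * Cmod (gauss_seq z N - RtoC 0)%C)); [exact Hb|apply is_lim_seq_const|].
  apply (is_lim_seq_mult' _ _ K 0); [apply is_lim_seq_const|exact H]. }
simpl in L; lra.
Qed.

Lemma rising_nat (k N : nat) :
  (RtoC (INR (fact k)) * rising (RtoC (INR k) + RtoC 1) N = RtoC (INR (fact (N + k))))%C.
Proof.
induction N as [|N IH]; [simpl; ring|].
simpl rising; rewrite Cmult_assoc, IH.
replace (S N + k)%nat with (S (N + k)) by lia.
rewrite fact_simpl, mult_INR, S_INR, plus_INR, <- !RtoC_plus, <- RtoC_mult; f_equal; ring.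
Qed.

Lemma fact_ratio_lim (k : nat) :
  is_lim_seq (fun N => INR (S N) ^ k * INR (fact (S N)) / INR (fact (S N + k))) 1.
Proof.
induction k as [|k IH].
- apply is_lim_seq_ext with (fun _ => 1); [|apply is_lim_seq_const].
  intros N; rewrite Nat.add_0_r; simpl pow; field; apply INR_fact_neq_0.
- apply is_lim_seq_ext with (fun N => INR (S N) ^ k * INR (fact (S N)) / INR (fact (S N + k)) * (1 - (INR k + 1) / INR (S (N + S k)))).
  + intros N; replace (S N + S k)%nat with (S (S N + k)) by lia; replace (S (N + S k))%nat with (S (S N + k)) by lia.
    rewrite (fact_simpl (S N + k)), mult_INR.
    replace (1 - (INR k + 1) / INR (S (S N + k))) with (INR (S N) / INR (S (S N + k))).
    * rewrite <- tech_pow_Rmult; field; split; [apply INR_fact_neq_0|apply not_0_INR; lia].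
    * rewrite (S_INR (S N + k)), plus_INR; field.
      generalize (pos_INR (S N)) (pos_INR k); lra.
  + replace 1 with (1 * (1 - 0)) at 1 by ring.
    apply (is_lim_seq_mult' _ _ 1 (1 - 0)); [exact IH|].
    apply is_lim_seq_minus'; [apply is_lim_seq_const|].
    apply (is_lim_seq_incr_n (fun N => (INR k + 1) / INR (S N)) (S k) 0), lim_over_n.
Qed.

Lemma Clim_RtoC (u : nat -> R) (l : R) : is_lim_seq u l -> Clim (fun N => RtoC (u N)) (RtoC l).
Proof.
intros H; unfold Clim.
apply is_lim_seq_ext with (fun N => Rabs (u N - l)).
- intros N; rewrite <- RtoC_minus, Cmod_R; reflexivity.
- apply (is_lim_seq_abs_0 (fun N => u N - l)).
  replace 0 with (l - l) by ring; apply is_lim_seq_minus'; [exact H|apply is_lim_seq_const].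
Qed.

(** The arguments [k - a] and [a + 1] of Beta add up to the integer [k + 1], so the third Gamma
    value is a factorial. Raising the first argument by [N] introduces a quotient of rising
    factorials; as [N] grows, this gives Gauss's product for [k - a], and the shifted Beta integral
    gives Gamma at [a + 1]. *)
Lemma Beta_Gamma (a : C) (k : nat) : -1 < Re a -> 0 < Re (RtoC (INR k) - a)%C ->
  (RtoC (INR (fact k)) * Beta_int (RtoC (INR k) - a) a = Gamma_Euler (a + RtoC 1) * Gamma_Euler (RtoC (INR k) - a))%C.
Proof.
intros Ha Hk; set (z := (RtoC (INR k) - a)%C) in *.
set (rho := fun N => INR (S N) ^ k * INR (fact (S N)) / INR (fact (S N + k))).
assert (L1 : Clim (fun N => RtoC (INR (fact k)) * Beta_int z a * RtoC (rho N))%C (RtoC (INR (fact k)) * Beta_int z a)%C).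
{ assert (L := Clim_scal (RtoC (INR (fact k)) * Beta_int z a)%C _ _ (Clim_RtoC rho 1 (fact_ratio_lim k))).
  rewrite Cmult_1_r in L; exact L. }
apply (Clim_unique _ _ _ L1).
(* With [n = N + 1], the factor [1 + z / n] supplies the last factor [z + n] of Gauss's quotient,
   which is absent from [rising z n] in [Beta_int_iter]. *)
apply Clim_ext_loc with (u := fun N => ((RtoC 1 + z * RtoC (/ INR (S N))) *
   ((rcpow (INR (S N)) (a + RtoC 1) * Beta_int (z + RtoC (INR (S N))) a) * gauss_seq z N))%C) (N0 := 0%nat).
- intros N _.
  assert (Hn : 0 < INR (S N)) by (rewrite S_INR; generalize (pos_INR N); lra).
  assert (HnC : RtoC (INR (S N)) <> RtoC 0) by (apply RtoC_neq_0; lra).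
  assert (I := Beta_int_iter z a (S N) Hk Ha).
  replace (a + RtoC 1 + z)%C with (RtoC (INR k) + RtoC 1)%C in I by (unfold z; ring).
  assert (F := rising_nat k (S N)).
  assert (G := gauss_eq z N Hk).
  replace (rising z (S (S N))) with (rising z (S N) * (z + RtoC (INR (S N))))%C in G by reflexivity.
  assert (HR : rising z (S N) <> RtoC 0).
  { intros A; rewrite A in G; apply (rcpow_neq_0 (INR (S N)) z).
    assert (HF : RtoC (INR (fact (S N))) <> RtoC 0) by (apply RtoC_neq_0, INR_fact_neq_0).
    replace (rcpow (INR (S N)) z) with (/ RtoC (INR (fact (S N))) * (RtoC (INR (fact (S N))) * rcpow (INR (S N)) z))%C by (field; exact HF).
    rewrite G; ring. }
  assert (HFk : RtoC (INR (fact (S N + k))) <> RtoC 0) by (apply RtoC_neq_0, INR_fact_neq_0).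
  unfold rho.
  rewrite RtoC_div, RtoC_mult by apply INR_fact_neq_0.
  rewrite RtoC_inv by lra.
  rewrite <- (rcpow_INR (INR (S N)) k) by exact Hn.
  replace (RtoC (INR k)) with (z + a)%C by (unfold z; ring).
  rewrite !rcpow_plus, rcpow_1 by exact Hn.
  assert (E : (RtoC (INR (fact k)) * Beta_int z a * (rcpow (INR (S N)) z * RtoC (INR (fact (S N)))) =
     RtoC (INR (fact (S N + k))) * ((z + RtoC (INR (S N))) * Beta_int (z + RtoC (INR (S N))) a * gauss_seq z N))%C).
  { replace (RtoC (INR (fact k)) * Beta_int z a * (rcpow (INR (S N)) z * RtoC (INR (fact (S N)))))%C
      with (RtoC (INR (fact k)) * Beta_int z a * (RtoC (INR (fact (S N))) * rcpow (INR (S N)) z))%C by ring.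
    rewrite G, <- F.
    replace (RtoC (INR (fact k)) * Beta_int z a * (rising z (S N) * (z + RtoC (INR (S N))) * gauss_seq z N))%C
      with (RtoC (INR (fact k)) * (rising z (S N) * Beta_int z a) * (z + RtoC (INR (S N))) * gauss_seq z N)%C by ring.
    rewrite I; ring. }
  replace (RtoC (INR (fact k)) * Beta_int z a * (rcpow (INR (S N)) z * rcpow (INR (S N)) a * RtoC (INR (fact (S N))) / RtoC (INR (fact (S N + k)))))%C
    with (rcpow (INR (S N)) a * (RtoC (INR (fact k)) * Beta_int z a * (rcpow (INR (S N)) z * RtoC (INR (fact (S N))))) / RtoC (INR (fact (S N + k))))%C
    by (field; exact HFk).
  rewrite E; field; auto.
- replace (Gamma_Euler (a + RtoC 1) * Gamma_Euler z)%C with (RtoC 1 * (Gamma_Euler (a + RtoC 1) * Gamma_Euler z))%C by ring.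
  apply Clim_mult.
  + apply (Clim_le _ _ (fun N => Cmod z / INR (S N)) 0); [|apply lim_over_n].
    intros N _; replace (RtoC 1 + z * RtoC (/ INR (S N)) - RtoC 1)%C with (z * RtoC (/ INR (S N)))%C by ring.
    rewrite Cmod_mult, Cmod_R, Rabs_right; [unfold Rdiv; lra|].
    apply Rle_ge; left; apply Rinv_0_lt_compat; rewrite S_INR; generalize (pos_INR N); lra.
  + apply Clim_mult; [apply Beta_int_asym; assumption|apply gauss_lim, Hk].
Qed.

(** A shift that reaches the right half-plane is at least the one chosen in the definition, and
    [Gamma_S] makes further shifts immaterial; the division in that argument rests on
    [Gamma_neq_0]. *)
Lemma rGamma_eq (s : C) (k : nat) : 0 < Re (s + RtoC (INR k))%C ->
  rGamma s = (rising s k / Gamma_Euler (s + RtoC (INR k)))%C.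
Proof.
intros Hk; unfold rGamma; set (N := Z.to_nat (up (- Re s))).
destruct (archimed (- Re s)) as [Hup1 Hup2].
assert (HN : 0 < Re (s + RtoC (INR N))%C).
{ simpl_Re; unfold N; rewrite INR_IZR_INZ; destruct (Z.le_gt_cases 0 (up (- Re s))) as [Hz|Hz].
  - rewrite Z2Nat.id by exact Hz; lra.
  - apply IZR_lt in Hz; generalize (pos_INR (Z.to_nat (up (- Re s)))); rewrite INR_IZR_INZ; lra. }
assert (Hstep : forall j : nat, (rising s (N + j) / Gamma_Euler (s + RtoC (INR (N + j))) = rising s N / Gamma_Euler (s + RtoC (INR N)))%C).
{ induction j as [|j IH]; [rewrite Nat.add_0_r; reflexivity|].
  rewrite <- IH; replace (N + S j)%nat with (S (N + j)) by lia; simpl rising.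
  assert (Hp : 0 < Re (s + RtoC (INR (N + j)))%C).
  { revert HN; simpl_Re; rewrite plus_INR; generalize (pos_INR j); lra. }
  rewrite S_INR, RtoC_plus, Cplus_assoc, Gamma_S by exact Hp.
  assert (G := Gamma_neq_0 _ Hp).
  assert (s + RtoC (INR (N + j)) <> RtoC 0)%C by (intros A; rewrite A, Re_RtoC in Hp; lra).
  field; split; assumption. }
assert (Hle : (N <= k)%nat).
{ destruct (Nat.le_gt_cases N k) as [H|H]; [exact H|exfalso].
  assert (Hpos : (0 < up (- Re s))%Z) by (unfold N in H; lia).
  assert (HkZ : (Z.of_nat k <= up (- Re s) - 1)%Z) by (unfold N in H; lia).
  apply IZR_le in HkZ; rewrite minus_IZR, <- INR_IZR_INZ in HkZ.
  revert Hk; simpl_Re; lra. }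
rewrite <- (Hstep (k - N)%nat); replace (N + (k - N))%nat with k by lia; reflexivity.
Qed.

(** * Binomial coefficients *)

(* [binom_coef a j] is the coefficient of [w ^ j] in [(1 - w) ^ a]. *)
Definition binom_coef (a : C) (j : nat) : C := (rising (- a) j / RtoC (INR (fact j)))%C.

(** [(-a)_k = Gamma(k - a) / Gamma(-a)], and [Gamma(k - a) / k!] is a Beta integral divided by
    [Gamma(a + 1)]. With [rGamma (- a)] the formula includes the poles of [Gamma(-a)], where both
    sides are 0. *)
Lemma binom_coef_Beta (a : C) (k : nat) : -1 < Re a -> 0 < Re (RtoC (INR k) - a)%C ->
  binom_coef a k = (rGamma (- a) * rGamma (a + RtoC 1) * Beta_int (RtoC (INR k) - a) a)%C.
Proof.
intros Ha Hk.
assert (E : (- a + RtoC (INR k) = RtoC (INR k) - a)%C) by ring.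
rewrite (rGamma_eq (- a)%C k) by (rewrite E; exact Hk).
assert (Ha1 : 0 < Re (a + RtoC 1)%C) by (simpl_Re; lra).
rewrite (rGamma_eq (a + RtoC 1)%C 0) by (simpl INR; simpl_Re; lra).
simpl rising; simpl INR; replace (a + RtoC 1 + RtoC 0)%C with (a + RtoC 1)%C by ring.
rewrite E.
assert (G1 := Gamma_neq_0 _ Ha1); assert (G2 := Gamma_neq_0 _ Hk).
assert (B := Beta_Gamma a k Ha Hk).
assert (HF : RtoC (INR (fact k)) <> RtoC 0) by (apply RtoC_neq_0, INR_fact_neq_0).
replace (Beta_int (RtoC (INR k) - a) a) with ((RtoC (INR (fact k)) * Beta_int (RtoC (INR k) - a) a) / RtoC (INR (fact k)))%C by (field; exact HF).
rewrite B; unfold binom_coef; field; auto.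
Qed.

Fixpoint Csum (f : nat -> C) (N : nat) : C :=
  match N with O => RtoC 0 | S N' => (Csum f N' + f N')%C end.

Lemma binom_coef_0 (a : C) : binom_coef a 0 = RtoC 1.
Proof. unfold binom_coef; simpl; field; apply RtoC_neq_0; lra. Qed.

Lemma binom_coef_S (a : C) (j : nat) : (RtoC (INR (S j)) * binom_coef a (S j) = (RtoC (INR j) - a) * binom_coef a j)%C.
Proof.
unfold binom_coef; rewrite fact_simpl, mult_INR, RtoC_mult; cbn [rising].
assert (RtoC (INR (S j)) <> RtoC 0) by (apply RtoC_neq_0, not_0_INR; lia).
assert (RtoC (INR (fact j)) <> RtoC 0) by (apply RtoC_neq_0, INR_fact_neq_0).
field; auto.
Qed.

Lemma geometric_bound (u : nat -> R) (mu : R) (J : nat) : 0 < mu ->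
  (forall j, 0 <= u j) -> (forall j, (J <= j)%nat -> u (S j) <= mu * u j) ->
  exists K, 0 < K /\ forall j, u j <= K * mu ^ j.
Proof.
intros Hmu Hu Hrec.
assert (H : forall M, exists K, 0 < K /\ forall j, (j <= M)%nat -> u j <= K * mu ^ j).
{ induction M as [|M [K [HK IH]]].
  - exists (u 0%nat + 1); split; [generalize (Hu 0%nat); lra|].
    intros j Hj; replace j with 0%nat by lia; simpl; lra.
  - assert (HP : 0 < mu ^ (S M)) by (apply pow_lt, Hmu).
    assert (Hq : 0 <= u (S M) / mu ^ (S M)) by (apply Rmult_le_pos; [apply Hu|left; apply Rinv_0_lt_compat, HP]).
    exists (K + u (S M) / mu ^ (S M)); split; [lra|].
    intros j Hj; destruct (Nat.eq_dec j (S M)) as [->|Hne].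
    + rewrite Rmult_plus_distr_r; replace (u (S M) / mu ^ S M * mu ^ S M) with (u (S M)) by (field; lra); nra.
    + eapply Rle_trans; [apply IH; lia|]; apply Rmult_le_compat_r; [left; apply pow_lt, Hmu|lra]. }
destruct (H J) as [K [HK HJ]]; exists K; split; [exact HK|].
intros j; induction j as [|j IH]; [apply HJ; lia|].
destruct (Nat.le_gt_cases (S j) J) as [Hj|Hj]; [apply HJ, Hj|].
eapply Rle_trans; [apply Hrec; lia|]; simpl; nra.
Qed.

(** The ratio of consecutive coefficients is at most [(j + |a|) / (j + 1)], which tends to 1; even
    with the factor [j + 1] in front it is below [mu] once [j >= 2 |a| / (mu - 1)]. That factor is
    the one that differentiation of the series brings in. *)
Lemma binom_coef_bound (a : C) (mu : R) : 1 < mu ->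
  exists K, 0 < K /\ forall j, INR (S j) * Cmod (binom_coef a j) <= K * mu ^ j.
Proof.
intros Hmu; set (A := Cmod a); assert (HA : 0 <= A) by apply Cmod_ge_0.
destruct (archimed (2 * A / (mu - 1))) as [Hup _].
assert (H0 : 0 <= 2 * A / (mu - 1)) by (apply Rmult_le_pos; [lra|left; apply Rinv_0_lt_compat; lra]).
assert (Hz : (0 <= up (2 * A / (mu - 1)))%Z) by (apply le_IZR; lra).
apply geometric_bound with (J := Z.to_nat (up (2 * A / (mu - 1)))); [lra| |].
- intros j; apply Rmult_le_pos; [apply pos_INR|apply Cmod_ge_0].
- intros j Hj; apply le_INR in Hj; rewrite INR_IZR_INZ, Z2Nat.id in Hj by exact Hz.
  assert (E := f_equal Cmod (binom_coef_S a j)).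
  rewrite !Cmod_mult, Cmod_R, Rabs_right in E by (apply Rle_ge, pos_INR).
  set (t := INR (S j)) in *; set (x := Cmod (binom_coef a (S j))) in *; set (y := Cmod (binom_coef a j)) in *.
  assert (Hy : 0 <= y) by apply Cmod_ge_0.
  assert (Ht : 1 <= t) by (unfold t; rewrite S_INR; generalize (pos_INR j); lra).
  assert (Htj : INR j = t - 1) by (unfold t; rewrite S_INR; ring).
  rewrite (S_INR (S j)); fold t.
  assert (Hja : Cmod (RtoC (INR j) - a)%C <= t - 1 + A).
  { eapply Rle_trans; [apply Cmod_triangle|]; rewrite Cmod_opp, Cmod_R, Rabs_right by (apply Rle_ge, pos_INR).
    fold A; lra. }
  assert (Hl : 2 * A <= (mu - 1) * t).
  { apply Rle_trans with ((mu - 1) * (2 * A / (mu - 1))); [right; field; lra|].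
    apply Rmult_le_compat_l; lra. }
  assert (E2 : t * x <= (t - 1 + A) * y) by (rewrite E; apply Rmult_le_compat_r; assumption).
  apply Rmult_le_reg_l with t; [lra|].
  apply Rle_trans with ((t + 1) * ((t - 1 + A) * y)); [nra|].
  replace (t * (mu * (t * y))) with (mu * t * t * y) by ring.
  rewrite <- Rmult_assoc; apply Rmult_le_compat_r; [exact Hy|]; nra.
Qed.

(* The principal logarithm of [1 - rho e ^ (i theta)], for [0 <= rho < 1]. *)
Definition log1m (rho th : R) : C :=
  (ln (1 - 2 * rho * cos th + rho ^ 2) / 2, - atan (rho * sin th / (1 - rho * cos th))).

Lemma cos2_sin2 (th : R) : cos th * cos th + sin th * sin th = 1.
Proof. generalize (sin2_cos2 th); unfold Rsqr; lra. Qed.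

Lemma one_minus_rho_cos (rho th : R) : 0 <= rho < 1 -> 1 - rho <= 1 - rho * cos th.
Proof. intros H; generalize (COS_bound th); nra. Qed.

Lemma rho_quad (rho th : R) : 0 <= rho < 1 -> (1 - rho) ^ 2 <= 1 - 2 * rho * cos th + rho ^ 2 <= 4.
Proof. intros H; generalize (COS_bound th); intros [H1 H2]; split; nra. Qed.

Lemma Cder_log1m (rho th : R) : 0 <= rho < 1 ->
  Cder (fun t => log1m t th) rho (- Cexp (Ci * RtoC th) / (RtoC 1 - RtoC rho * Cexp (Ci * RtoC th)))%C.
Proof.
intros H; assert (H1 := one_minus_rho_cos rho th H); assert (H2 := rho_quad rho th H).
assert (H3 : 0 < (1 - rho) ^ 2) by (apply pow_lt; lra).
assert (HD : (1 - rho * cos th) ^ 2 + (rho * sin th) ^ 2 = 1 - 2 * rho * cos th + rho ^ 2).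
{ generalize (cos2_sin2 th); intros E; nra. }
replace (Cexp (Ci * RtoC th)) with ((cos th, sin th) : C).
2: { unfold Cexp, Ci, RtoC, Cmult; simpl; replace (0 * th - 1 * 0) with 0 by ring; rewrite exp_0.
     f_equal; [replace (0 * 0 + 1 * th) with th by ring|replace (0 * 0 + 1 * th) with th by ring]; ring. }
set (c := cos th) in *; set (s := sin th) in *.
assert (E : (- (c, s) / (RtoC 1 - RtoC rho * (c, s)))%C =
  ((rho - c) / (1 - 2 * rho * c + rho ^ 2), - s / (1 - 2 * rho * c + rho ^ 2))).
{ unfold Cdiv, Cinv, Cminus, Copp, Cmult, Cplus, RtoC; cbn [fst snd].
  replace ((1 + - (rho * c - 0 * s)) ^ 2 + (0 + - (rho * s + 0 * c)) ^ 2) with (1 - 2 * rho * c + rho ^ 2)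
    by (rewrite <- HD; ring).
  assert (Es : s * s = 1 - c * c) by (generalize (cos2_sin2 th); unfold c, s; lra).
  f_equal; field_simplify; try lra; f_equal; nra. }
rewrite E; split; cbn [fst snd Re Im].
- unfold log1m; cbn [fst snd Re Im]; auto_derive; [fold c; lra|fold c; simpl in *; field; lra].
- unfold log1m; cbn [fst snd Re Im]; auto_derive; [fold c; lra|].
  fold c; fold s.
  assert (0 < (1 - rho * c) ^ 2) by (apply pow_lt; lra).
  replace (1 - 2 * rho * c + rho ^ 2) with ((1 - rho * c) ^ 2 + (rho * s) ^ 2) by exact HD.
  simpl in *; field; split; [generalize (Rle_0_sqr (rho * s)); unfold Rsqr; nra|lra].
Qed.

Lemma log1m_0 (th : R) : log1m 0 th = RtoC 0.
Proof.
unfold log1m, RtoC; f_equal.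
- replace (1 - 2 * 0 * cos th + 0 ^ 2) with 1 by ring; rewrite ln_1; field.
- replace (0 * sin th / (1 - 0 * cos th)) with 0 by (field; lra); rewrite atan_0; ring.
Qed.

Lemma log1m_bound (r rho th : R) : 0 <= rho <= r -> r < 1 -> Cmod (log1m rho th) <= 2 * (2 - ln (1 - r)).
Proof.
intros H Hr; assert (H2 := rho_quad rho th ltac:(lra)).
assert (H3 : 0 < (1 - rho) ^ 2) by (apply pow_lt; lra).
assert (Hl : ln (1 - r) <= 0) by (rewrite <- ln_1; apply ln_le; lra).
apply Cmod_le_parts; unfold log1m; cbn [fst snd Re Im].
- destruct H2 as [H2 H4].
  apply ln_le in H4; [|lra]; apply ln_le in H2; [|exact H3].
  replace ((1 - rho) ^ 2) with ((1 - rho) * (1 - rho)) in H2 by ring; rewrite ln_mult in H2 by lra.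
  assert (ln (1 - r) <= ln (1 - rho)) by (apply ln_le; lra).
  assert (ln 4 <= 4 - 1) by (apply ln_le_sub_1; lra).
  apply Rabs_le; lra.
- destruct (atan_bound (rho * sin th / (1 - rho * cos th))) as [A B].
  generalize PI_4; intros; apply Rabs_le; lra.
Qed.

Lemma Cexp_log1m_bound (a : C) (r rho th : R) : 0 <= rho <= r -> r < 1 ->
  Cmod (Cexp (a * log1m rho th)%C) <= exp (Cmod a * (2 * (2 - ln (1 - r)))).
Proof.
intros H Hr; rewrite Cmod_Cexp; apply exp_le.
eapply Rle_trans; [apply Rle_abs|]; eapply Rle_trans; [apply re_le_Cmod|].
rewrite Cmod_mult; apply Rmult_le_compat_l; [apply Cmod_ge_0|apply log1m_bound; assumption].
Qed.

Definition binom_sum (a : C) (N : nat) (z : C) : C := Csum (fun j => binom_coef a j * z ^ j)%C N.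

Lemma Cder_pow_ray (w : C) (j : nat) (rho : R) :
  Cder (fun t => (RtoC t * w) ^ j)%C rho (RtoC (INR j) * w * (RtoC rho * w) ^ pred j)%C.
Proof.
assert (H1 : Cder (fun t => RtoC t * w)%C rho w).
{ eapply Cder_eq; [apply Cder_mult; [exact (Cder_RtoC (fun t => t) rho 1 (is_derive_id rho))|apply Cder_const]|cbv beta; ring]. }
induction j as [|j IH].
- apply Cder_eq with (RtoC 0); [exact (Cder_const (RtoC 1) rho)|simpl; ring].
- eapply Cder_eq; [exact (Cder_mult _ _ _ _ _ H1 IH)|].
  rewrite S_INR, RtoC_plus; destruct j as [|j]; simpl; ring.
Qed.

(** In the term of index 0 the exponent [pred 0 = 0] is harmless, since [INR 0] annihilates it. *)
Fixpoint binom_sum_deriv (a w : C) (N : nat) (rho : R) : C :=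
  match N with
  | O => RtoC 0
  | S N' => (binom_sum_deriv a w N' rho + binom_coef a N' * (RtoC (INR N') * w * (RtoC rho * w) ^ pred N'))%C
  end.

Lemma Cder_binom_sum (a w : C) (N : nat) (rho : R) :
  Cder (fun t => binom_sum a N (RtoC t * w)%C) rho (binom_sum_deriv a w N rho).
Proof.
unfold binom_sum; induction N as [|N IH]; [exact (Cder_const (RtoC 0) rho)|].
simpl Csum; simpl binom_sum_deriv; apply Cder_plus; [exact IH|]; apply Cder_scal, Cder_pow_ray.
Qed.

(** [(1 - rho w)^a] satisfies [(1 - rho w) y' + a w y = 0]. For a partial sum, [binom_coef_S]
    cancels everything but the contribution of the first omitted coefficient. *)
Lemma binom_sum_ode (a w : C) (N : nat) (rho : R) :
  ((RtoC 1 - RtoC rho * w) * binom_sum_deriv a w N rho + a * w * binom_sum a N (RtoC rho * w) =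
   - (RtoC (INR N) * binom_coef a N * w * (RtoC rho * w) ^ pred N))%C.
Proof.
unfold binom_sum; induction N as [|N IH]; [simpl; ring|].
set (p := (RtoC rho * w)%C) in *.
cbn [Csum binom_sum_deriv pred]; fold p.
replace ((RtoC 1 - p) * (binom_sum_deriv a w N rho + binom_coef a N * (RtoC (INR N) * w * p ^ pred N)) + a * w * (Csum (fun j => binom_coef a j * p ^ j) N + binom_coef a N * p ^ N))%C
  with (((RtoC 1 - p) * binom_sum_deriv a w N rho + a * w * Csum (fun j => binom_coef a j * p ^ j) N) + (RtoC 1 - p) * binom_coef a N * (RtoC (INR N) * w * p ^ pred N) + a * w * binom_coef a N * p ^ N)%C by ring.
rewrite IH, binom_coef_S; destruct N as [|N]; [simpl; ring|cbn [pred]; simpl Cpow; ring].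
Qed.

(* The ratio of the partial sum to [(1 - rho e ^ (i th)) ^ a] has a small derivative in [rho]. *)
Lemma binomial_series (a : C) (r : R) : 0 < r < 1 ->
  exists K q, 0 < K /\ 0 < q < 1 /\ forall (N : nat) (rho th : R), 0 <= rho <= r ->
    Cmod (binom_sum a (S N) (RtoC rho * Cexp (Ci * RtoC th)) - Cexp (a * log1m rho th))%C <= K * q ^ N.
Proof.
intros Hr.
(* Halfway between 1 and [1 / r]: larger than 1 as [binom_coef_bound] requires, yet with
   [mu * r < 1]. *)
set (mu := (1 + / r) / 2).
assert (Hri : 1 < / r) by (rewrite <- Rinv_1; apply Rinv_lt_contravar; lra).
assert (Hmu : 1 < mu) by (unfold mu; lra).
assert (Hq : 0 < mu * r < 1).
{ split; [apply Rmult_lt_0_compat; lra|]; unfold mu; replace ((1 + / r) / 2 * r) with ((r + 1) / 2) by (field; lra); lra. }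
destruct (binom_coef_bound a mu Hmu) as [K [HK HB]].
set (E := exp (Cmod a * (2 * (2 - ln (1 - r))))).
assert (HE : 0 < E) by apply exp_pos.
exists (2 * (K * mu / (1 - r) * E) * E), (mu * r).
assert (HKp : 0 < K * mu / (1 - r)) by (apply Rdiv_lt_0_compat; [apply Rmult_lt_0_compat; lra|lra]).
split; [apply Rmult_lt_0_compat; [|exact HE]; apply Rmult_lt_0_compat; [lra|]; apply Rmult_lt_0_compat; assumption|]; split; [exact Hq|].
intros N rho th Hrho.
set (w := Cexp (Ci * RtoC th)).
assert (Hw : Cmod w = 1).
{ unfold w; rewrite Cmod_Cexp; replace (Re (Ci * RtoC th)%C) with 0 by (unfold Re, Ci, RtoC, Cmult; simpl; ring); apply exp_0. }
set (F := fun t => (binom_sum a (S N) (RtoC t * w) * Cexp (- a * log1m t th))%C).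
assert (Hnz : forall t, 0 <= t <= rho -> (RtoC 1 - RtoC t * w <> RtoC 0)%C /\ 1 - r <= Cmod (RtoC 1 - RtoC t * w)%C).
{ intros t Ht; assert (1 - r <= Cmod (RtoC 1 - RtoC t * w)%C).
  { assert (A := Cmod_triangle (RtoC 1 - RtoC t * w)%C (RtoC t * w)%C).
    replace (RtoC 1 - RtoC t * w + RtoC t * w)%C with (RtoC 1) in A by ring.
    rewrite Cmod_mult, Hw, !Cmod_R, Rabs_R1, Rabs_right in A by lra; lra. }
  split; [|assumption]; intros A; rewrite A, Cmod_0 in *; lra. }
set (dF := fun t => (- (RtoC (INR (S N)) * binom_coef a (S N) * w * (RtoC t * w) ^ N) / (RtoC 1 - RtoC t * w) * Cexp (- a * log1m t th))%C).
assert (HF : Cmod (F rho - F 0)%C <= 2 * (K * mu / (1 - r) * E * (mu * r) ^ N * (rho - 0))).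
{ apply (Cder_bound F dF 0 rho); [lra| |].
  - intros t Ht; destruct (Hnz t Ht) as [Hn _].
    eapply Cder_eq; [exact (Cder_mult _ _ _ _ _ (Cder_binom_sum a w (S N) t) (Cder_Cexp _ _ _ (Cder_scal (- a)%C _ _ _ (Cder_log1m t th ltac:(lra)))))|].
    unfold dF; fold w.
    assert (O := binom_sum_ode a w (S N) t); cbn [pred] in O; rewrite <- O; field; exact Hn.
  - intros t Ht; destruct (Hnz t Ht) as [Hn Hb]; unfold dF.
    rewrite Cmod_mult, Cmod_div by exact Hn.
    rewrite Cmod_opp, !Cmod_mult, Hw, Cmod_pow, Cmod_mult, Hw, !Cmod_R, !Rabs_right by (try apply Rle_ge; try apply pos_INR; lra).
    rewrite !Rmult_1_r.
    assert (A1 : Cmod (Cexp (- a * log1m t th)%C) <= E).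
    { unfold E; rewrite <- (Cmod_opp a); apply Cexp_log1m_bound; lra. }
    assert (A2 : INR (S N) * Cmod (binom_coef a (S N)) <= K * mu ^ S N).
    { eapply Rle_trans; [|apply HB]; apply Rmult_le_compat_r; [apply Cmod_ge_0|apply le_INR; lia]. }
    assert (A3 : t ^ N <= r ^ N) by (apply pow_incr; lra).
    assert (A4 : / Cmod (RtoC 1 - RtoC t * w)%C <= / (1 - r)) by (apply Rinv_le_contravar; lra).
    assert (A5 : INR (S N) * Cmod (binom_coef a (S N)) * t ^ N <= K * mu ^ S N * r ^ N).
    { apply Rmult_le_compat; auto; [apply Rmult_le_pos; [apply pos_INR|apply Cmod_ge_0]|apply pow_le; lra]. }
    apply Rle_trans with (K * mu ^ S N * r ^ N * / (1 - r) * E).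
    + apply Rmult_le_compat; [|apply Cmod_ge_0| |exact A1].
      * apply Rmult_le_pos; [|left; apply Rinv_0_lt_compat; lra].
        repeat apply Rmult_le_pos; [apply pos_INR|apply Cmod_ge_0|apply pow_le; lra].
      * apply Rmult_le_compat; auto; [|left; apply Rinv_0_lt_compat; lra].
        repeat apply Rmult_le_pos; [apply pos_INR|apply Cmod_ge_0|apply pow_le; lra].
    + right; rewrite Rpow_mult_distr; simpl; unfold Rdiv; ring. }
assert (F0 : F 0 = RtoC 1).
{ unfold F, binom_sum; rewrite log1m_0; replace (- a * RtoC 0)%C with (RtoC 0) by ring; rewrite Cexp_0.
  replace (RtoC 0 * w)%C with (RtoC 0) by ring.
  assert (Z : forall M, Csum (fun j => binom_coef a j * RtoC 0 ^ j)%C (S M) = RtoC 1).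
  { induction M as [|M IH]; [simpl; rewrite binom_coef_0; ring|].
    replace (Csum (fun j => binom_coef a j * RtoC 0 ^ j)%C (S (S M))) with (Csum (fun j => binom_coef a j * RtoC 0 ^ j)%C (S M) + binom_coef a (S M) * RtoC 0 ^ (S M))%C by reflexivity.
    rewrite IH; simpl; ring. }
  rewrite Z; ring. }
rewrite F0 in HF.
replace (binom_sum a (S N) (RtoC rho * w) - Cexp (a * log1m rho th))%C with ((F rho - RtoC 1) * Cexp (a * log1m rho th))%C.
2: { unfold F; replace (- a * log1m rho th)%C with (- (a * log1m rho th))%C by ring; rewrite Cexp_opp; field; apply Cexp_neq_0. }
rewrite Cmod_mult.
apply Rle_trans with (2 * (K * mu / (1 - r) * E * (mu * r) ^ N) * E).
- apply Rmult_le_compat; [apply Cmod_ge_0|apply Cmod_ge_0| |apply Cexp_log1m_bound; lra].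
  eapply Rle_trans; [exact HF|].
  assert (0 <= K * mu / (1 - r) * E * (mu * r) ^ N) by (apply Rmult_le_pos; [apply Rmult_le_pos; lra|apply pow_le; lra]).
  nra.
- right; ring.
Qed.

(** * Integrals over the circle *)

Definition is_CRInt (f : R -> C) (a b : R) (l : C) : Prop :=
  is_RInt (fun t => Re (f t)) a b (Re l) /\ is_RInt (fun t => Im (f t)) a b (Im l).

Definition CRInt (f : R -> C) (a b : R) : C :=
  (RInt (fun t => Re (f t)) a b, RInt (fun t => Im (f t)) a b).

Lemma is_CRInt_unique (f : R -> C) (a b : R) (l : C) : is_CRInt f a b l -> CRInt f a b = l.
Proof.
intros [H1 H2]; apply C_eq; cbn [Re Im fst snd CRInt].
- exact (is_RInt_unique _ _ _ _ H1).
- exact (is_RInt_unique _ _ _ _ H2).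
Qed.

Lemma is_CRInt_CRInt (f : R -> C) (a b : R) : (forall t, Ccont f t) -> is_CRInt f a b (CRInt f a b).
Proof.
intros H; split; apply (RInt_correct (V := R_CompleteNormedModule)), (ex_RInt_continuous (V := R_CompleteNormedModule));
intros z _; apply (H z).
Qed.

Lemma is_CRInt_ext (f g : R -> C) (a b : R) (l : C) : (forall t, f t = g t) -> is_CRInt f a b l -> is_CRInt g a b l.
Proof.
intros H [H1 H2]; split.
- apply is_RInt_ext with (2 := H1); intros x _; rewrite H; reflexivity.
- apply is_RInt_ext with (2 := H2); intros x _; rewrite H; reflexivity.
Qed.

Lemma is_CRInt_plus (f g : R -> C) (a b : R) (lf lg : C) :
  is_CRInt f a b lf -> is_CRInt g a b lg -> is_CRInt (fun t => f t + g t)%C a b (lf + lg)%C.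
Proof.
intros [H1 H2] [H3 H4]; split.
- exact (is_RInt_plus _ _ _ _ _ _ H1 H3).
- exact (is_RInt_plus _ _ _ _ _ _ H2 H4).
Qed.

Lemma is_CRInt_scal (c : C) (f : R -> C) (a b : R) (l : C) : is_CRInt f a b l -> is_CRInt (fun t => c * f t)%C a b (c * l)%C.
Proof.
intros [H1 H2]; split.
- exact (is_RInt_minus _ _ _ _ _ _ (is_RInt_scal _ _ _ (Re c) _ H1) (is_RInt_scal _ _ _ (Im c) _ H2)).
- exact (is_RInt_plus _ _ _ _ _ _ (is_RInt_scal _ _ _ (Re c) _ H2) (is_RInt_scal _ _ _ (Im c) _ H1)).
Qed.

Lemma is_CRInt_zero (a b : R) : is_CRInt (fun _ => RtoC 0) a b (RtoC 0).
Proof.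
assert (H : is_RInt (fun _ : R => 0) a b 0).
{ assert (E := is_RInt_const (V := R_NormedModule) a b 0).
  unfold scal in E; simpl in E; unfold mult in E; simpl in E; rewrite Rmult_0_r in E; exact E. }
split; exact H.
Qed.

Lemma is_CRInt_Csum (f : nat -> R -> C) (l : nat -> C) (a b : R) (N : nat) :
  (forall j, is_CRInt (f j) a b (l j)) -> is_CRInt (fun t => Csum (fun j => f j t) N) a b (Csum l N).
Proof.
intros H; induction N as [|N IH]; [apply is_CRInt_zero|].
exact (is_CRInt_plus _ _ _ _ _ _ IH (H N)).
Qed.

Lemma is_CRInt_det (f : R -> C) (a b : R) (l l' : C) : is_CRInt f a b l -> is_CRInt f a b l' -> l = l'.
Proof. intros H H'; rewrite <- (is_CRInt_unique _ _ _ _ H); apply is_CRInt_unique, H'. Qed.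

Lemma is_CRInt_FTC (F f : R -> C) (a b : R) :
  (forall t, Cder F t (f t)) -> (forall t, Ccont f t) -> is_CRInt f a b (F b - F a)%C.
Proof.
intros HF Hf; split.
- apply (is_RInt_derive (fun t => Re (F t)) (fun t => Re (f t))); intros t _; [exact (proj1 (HF t))|exact (proj1 (Hf t))].
- apply (is_RInt_derive (fun t => Im (F t)) (fun t => Im (f t))); intros t _; [exact (proj2 (HF t))|exact (proj2 (Hf t))].
Qed.

Lemma is_CRInt_bound (f : R -> C) (a b M : R) (l : C) : a <= b -> is_CRInt f a b l ->
  (forall t, a <= t <= b -> Cmod (f t) <= M) -> Cmod l <= 2 * ((b - a) * M).
Proof.
intros Hab [H1 H2] HM; apply Cmod_le_parts.
- apply (norm_RInt_le_const (V := R_NormedModule) (fun t => Re (f t)) a b); auto.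
  intros t Ht; eapply Rle_trans; [apply re_le_Cmod|apply HM, Ht].
- apply (norm_RInt_le_const (V := R_NormedModule) (fun t => Im (f t)) a b); auto.
  intros t Ht; eapply Rle_trans; [apply Im_Cmod|apply HM, Ht].
Qed.

Lemma atan_tends_PI2 (e : R) : 0 < e -> exists M, forall t, M < t -> PI / 2 - e < atan t < PI / 2.
Proof.
intros He; set (d := Rmin e (PI / 2)).
assert (HPI := PI_RGT_0).
assert (Hd : 0 < d) by (apply Rmin_glb_lt; lra).
assert (Hde : d <= e) by apply Rmin_l.
assert (Hd2 : d <= PI / 2) by apply Rmin_r.
exists (tan (PI / 2 - d)); intros t Ht; split; [|apply atan_bound].
apply Rle_lt_trans with (PI / 2 - d); [lra|].
rewrite <- (atan_tan (PI / 2 - d)) by lra; apply atan_increasing, Ht.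
Qed.

(** The substitution [th = 2 atan t] maps the line onto []-PI, PI[]; a primitive of [g] is
    continuous at both ends, so the improper integral tends to the ordinary one. *)
Lemma is_RInt_gen_line_circle (g : R -> R) : (forall t, continuous g t) ->
  is_RInt_gen (fun t => g (2 * atan t) * (2 / (1 + t ^ 2))) (Rbar_locally m_infty) (Rbar_locally p_infty) (RInt g (- PI) PI).
Proof.
intros Hg.
set (G := fun th => RInt g (- PI) th).
assert (HG : forall th, is_derive G th (g th)).
{ intros th; apply (is_derive_RInt g G (- PI)); [|apply Hg].
  apply filter_forall; intros y; apply (RInt_correct (V := R_CompleteNormedModule)), (ex_RInt_continuous (V := R_CompleteNormedModule)).
  intros z _; apply Hg. }
assert (HGc : forall th, continuous G th) by (intros th; apply (ex_derive_continuous (V := R_NormedModule)); eexists; apply HG).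
assert (HF : forall t, is_derive (fun t => G (2 * atan t)) t (g (2 * atan t) * (2 / (1 + t ^ 2)))).
{ intros t.
  assert (Ha : is_derive (fun t => 2 * atan t) t (2 / (1 + t ^ 2))).
  { auto_derive; [exact I|]; field; nra. }
  eapply is_derive_ext_eq; [exact (is_derive_comp G (fun t => 2 * atan t) t _ _ (HG _) Ha)|].
  unfold scal; simpl; unfold mult; simpl; ring. }
assert (Hfc : forall t, continuous (fun t => g (2 * atan t) * (2 / (1 + t ^ 2))) t).
{ intros t; apply (continuous_mult (fun t => g (2 * atan t)) (fun t => 2 / (1 + t ^ 2))).
  - apply (continuous_comp (fun t => 2 * atan t) g); [|apply Hg].
    apply (ex_derive_continuous (V := R_NormedModule)); auto_derive; exact I.
  - apply (ex_derive_continuous (V := R_NormedModule)); auto_derive; nra. }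
intros P [e HP]; unfold filtermapi.
assert (He : 0 < e / 2) by (generalize (cond_pos e); lra).
destruct (HGc PI _ (locally_ball (G PI) (mkposreal _ He))) as [d1 H1].
destruct (HGc (- PI) _ (locally_ball (G (- PI)) (mkposreal _ He))) as [d2 H2].
destruct (atan_tends_PI2 (d1 / 2)) as [M1 HM1]; [generalize (cond_pos d1); lra|].
destruct (atan_tends_PI2 (d2 / 2)) as [M2 HM2]; [generalize (cond_pos d2); lra|].
exists (fun a => Rabs (G (2 * atan a) - G (- PI)) < e / 2) (fun b => Rabs (G (2 * atan b) - G PI) < e / 2).
- exists (- M2); intros t Ht; apply (H2 (2 * atan t)).
  assert (A := HM2 (- t) ltac:(lra)); rewrite atan_opp in A.
  unfold ball; simpl; unfold AbsRing_ball, abs, minus, plus, opp; simpl; apply Rabs_def1; lra.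
- exists M1; intros t Ht; apply (H1 (2 * atan t)); assert (A := HM1 t Ht).
  unfold ball; simpl; unfold AbsRing_ball, abs, minus, plus, opp; simpl; apply Rabs_def1; lra.
- intros a b Ha Hb; exists (G (2 * atan b) - G (2 * atan a)); split.
  + cbn [fst snd]; apply (is_RInt_derive (fun t => G (2 * atan t))); intros t _; [apply HF|apply Hfc].
  + apply HP; unfold ball; simpl; unfold AbsRing_ball, abs, minus, plus, opp; simpl.
    assert (E0 : G (- PI) = 0) by (apply (RInt_point (V := R_CompleteNormedModule))).
    change (RInt g (- PI) PI) with (G PI); rewrite E0 in Ha.
    replace (G (2 * atan b) - G (2 * atan a) + - G PI) with ((G (2 * atan b) - G PI) - (G (2 * atan a) - 0)) by ring.
    eapply Rle_lt_trans; [apply Rabs_triang|]; rewrite Rabs_Ropp; lra.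
Qed.

Lemma CInt_line_circle (f g : R -> C) : (forall t, Ccont g t) ->
  (forall t, f t = (g (2 * atan t)%R * RtoC (2 / (1 + t ^ 2)))%C) ->
  CInt_line f = CRInt g (- PI) PI.
Proof.
intros Hg H; unfold CInt_line; apply (CRInt_gen_parts f); cbn [Re Im fst snd CRInt].
- refine (is_RInt_gen_ext _ _ _ _ (is_RInt_gen_line_circle _ (fun t => proj1 (Hg t)))).
  apply filter_forall; intros ab t _; rewrite H, Re_mult_R; reflexivity.
- refine (is_RInt_gen_ext _ _ _ _ (is_RInt_gen_line_circle _ (fun t => proj2 (Hg t)))).
  apply filter_forall; intros ab t _; rewrite H, Im_mult_R; reflexivity.
Qed.

Lemma Cexp_Ci (t : R) : Cexp (Ci * RtoC t)%C = (cos t, sin t).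
Proof.
unfold Cexp, Ci, RtoC, Cmult; cbn [Re Im fst snd].
replace (0 * t - 1 * 0) with 0 by ring; replace (0 * 0 + 1 * t) with t by ring.
rewrite exp_0; f_equal; ring.
Qed.

Lemma Cmod_Cexp_Ci (t : R) : Cmod (Cexp (Ci * RtoC t)%C) = 1.
Proof.
rewrite Cmod_Cexp; replace (Re (Ci * RtoC t)%C) with 0 by (unfold Re, Ci, RtoC, Cmult; simpl; ring); apply exp_0.
Qed.

Lemma sin_IZR_PI (p : Z) : sin (IZR p * PI) = 0.
Proof. apply sin_eq_0_1; exists p; reflexivity. Qed.

Lemma Cexp_int_PI (p : Z) : Cexp (Ci * RtoC (IZR p * PI)) = Cexp (Ci * RtoC (IZR p * - PI)).
Proof.
replace (IZR p * - PI) with (- (IZR p * PI)) by ring.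
rewrite !Cexp_Ci, cos_neg, sin_neg, sin_IZR_PI, Ropp_0; reflexivity.
Qed.

Lemma Cder_circle (p t : R) : Cder (fun t => Cexp (Ci * RtoC (p * t))%C) t (Ci * RtoC p * Cexp (Ci * RtoC (p * t)))%C.
Proof.
eapply Cder_eq; [apply Cder_Cexp, Cder_scal, (Cder_RtoC (fun t => p * t) t p)|cbv beta; ring].
auto_derive; [exact I|ring].
Qed.

Lemma is_CRInt_circle (p : Z) :
  is_CRInt (fun t => Cexp (Ci * RtoC (IZR p * t))%C) (- PI) PI (if Z.eq_dec p 0 then RtoC (2 * PI) else RtoC 0).
Proof.
destruct (Z.eq_dec p 0) as [->|Hp].
- apply is_CRInt_ext with (fun _ => RtoC 1).
  + intros t; rewrite Rmult_0_l; replace (Ci * RtoC 0)%C with (RtoC 0) by ring; symmetry; apply Cexp_0.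
  + replace (RtoC (2 * PI)) with (RtoC PI - RtoC (- PI))%C by (rewrite <- RtoC_minus; f_equal; ring).
    apply (is_CRInt_FTC RtoC); [|intros; apply Ccont_const].
    intros t; exact (Cder_RtoC (fun t => t) t 1 (is_derive_id t)).
- assert (Hp' : RtoC (IZR p) <> RtoC 0) by (apply RtoC_neq_0; intros A; apply Hp, eq_IZR, A).
  assert (HCi : Ci <> RtoC 0) by (intros A; generalize (f_equal snd A); simpl; lra).
  set (F := fun t => (/ (Ci * RtoC (IZR p)) * Cexp (Ci * RtoC (IZR p * t)))%C).
  replace (RtoC 0) with (F PI - F (- PI)%R)%C by (unfold F; rewrite (Cexp_int_PI p); ring).
  apply is_CRInt_FTC.
  + intros t; unfold F; eapply Cder_eq; [apply Cder_scal, Cder_circle|field; auto].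
  + intros t; exact (Cder_Ccont _ _ _ (Cder_circle (IZR p) t)).
Qed.

Lemma Csum_scal (c : C) (f : nat -> C) (N : nat) : Csum (fun j => c * f j)%C N = (c * Csum f N)%C.
Proof. induction N as [|N IH]; simpl; [ring|rewrite IH; ring]. Qed.

Lemma Csum_ext (f g : nat -> C) (N : nat) : (forall j, (j < N)%nat -> f j = g j) -> Csum f N = Csum g N.
Proof.
induction N as [|N IH]; intros H; [reflexivity|]; simpl; rewrite IH, H; [reflexivity|lia|].
intros j Hj; apply H; lia.
Qed.

Lemma Csum_delta (f : nat -> C) (c : C) (i N : nat) : (i < N)%nat ->
  Csum (fun j => f j * (if Nat.eq_dec j i then c else RtoC 0))%C N = (f i * c)%C.
Proof.
intros Hi.
assert (H0 : forall M, (M <= i)%nat -> Csum (fun j => f j * (if Nat.eq_dec j i then c else RtoC 0))%C M = RtoC 0).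
{ induction M as [|M IH]; intros HM; [reflexivity|]; simpl; rewrite IH by lia.
  destruct (Nat.eq_dec M i); [lia|ring]. }
induction N as [|N IH]; [lia|]; simpl.
destruct (Nat.eq_dec N i) as [->|Hne].
- rewrite H0 by lia; ring.
- rewrite IH by lia; ring.
Qed.

Lemma binom_sum_circle (a : C) (N : nat) (r t : R) :
  binom_sum a N (RtoC r * Cexp (Ci * RtoC t))%C = Csum (fun j => binom_coef a j * RtoC (r ^ j) * Cexp (Ci * RtoC (INR j * t)))%C N.
Proof.
unfold binom_sum; apply Csum_ext; intros j _.
rewrite RtoC_mult, RtoC_pow.
replace (Ci * (RtoC (INR j) * RtoC t))%C with (RtoC (INR j) * (Ci * RtoC t))%C by ring.
rewrite Cexp_pow, Cpow_mult_l; ring.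
Qed.

(** Orthogonality keeps only the pairs with [j = k + i]. The first sum has [k] more terms than the
    second so that this index is in range for every [i < N]. *)
Lemma is_CRInt_partial (a b : C) (r : R) (k N : nat) :
  is_CRInt (fun t => Cexp (- (Ci * RtoC (INR k * t))) *
      (binom_sum a (k + N) (RtoC r * Cexp (Ci * RtoC t)) * binom_sum b N (RtoC r * Cexp (Ci * RtoC (- t)))))%C (- PI) PI
    (RtoC (2 * PI) * Csum (fun i => binom_coef a (k + i) * binom_coef b i * RtoC (r ^ (k + 2 * i))) N)%C.
Proof.
apply is_CRInt_ext with (fun t => Csum (fun i => Csum (fun j =>
   binom_coef b i * RtoC (r ^ i) * (binom_coef a j * RtoC (r ^ j)) * Cexp (Ci * RtoC (IZR (Z.of_nat j - Z.of_nat i - Z.of_nat k) * t)))%C (k + N)) N).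
- intros t; rewrite !binom_sum_circle.
  set (X := Csum _ (k + N)).
  transitivity (Csum (fun i => Cexp (- (Ci * RtoC (INR k * t))) * X * (binom_coef b i * RtoC (r ^ i) * Cexp (Ci * RtoC (INR i * - t))))%C N);
    [|rewrite Csum_scal; ring].
  apply Csum_ext; intros i _.
  replace (Cexp (- (Ci * RtoC (INR k * t))) * X * (binom_coef b i * RtoC (r ^ i) * Cexp (Ci * RtoC (INR i * - t))))%C
    with (Cexp (- (Ci * RtoC (INR k * t))) * (binom_coef b i * RtoC (r ^ i) * Cexp (Ci * RtoC (INR i * - t))) * X)%C by ring.
  unfold X; rewrite <- Csum_scal; apply Csum_ext; intros j _.
  rewrite !minus_IZR, <- !INR_IZR_INZ.
  replace (Ci * RtoC ((INR j - INR i - INR k) * t))%C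
    with (Ci * RtoC (INR i * - t) + (- (Ci * RtoC (INR k * t)) + Ci * RtoC (INR j * t)))%C
    by (rewrite !RtoC_mult, !RtoC_minus, RtoC_opp; ring).
  rewrite !Cexp_plus; ring.
- replace (RtoC (2 * PI) * Csum (fun i => binom_coef a (k + i) * binom_coef b i * RtoC (r ^ (k + 2 * i))) N)%C
    with (Csum (fun i => Csum (fun j => binom_coef b i * RtoC (r ^ i) * (binom_coef a j * RtoC (r ^ j)) *
       (if Nat.eq_dec j (k + i) then RtoC (2 * PI) else RtoC 0))%C (k + N)) N).
  + apply is_CRInt_Csum; intros i; apply is_CRInt_Csum; intros j; apply is_CRInt_scal.
    assert (H := is_CRInt_circle (Z.of_nat j - Z.of_nat i - Z.of_nat k)).
    destruct (Z.eq_dec _ 0), (Nat.eq_dec j (k + i)); try exact H; lia.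
  + rewrite <- Csum_scal; apply Csum_ext; intros i Hi.
    rewrite Csum_delta by lia.
    replace (r ^ (k + 2 * i)) with (r ^ i * r ^ (k + i)) by (rewrite <- pow_add; f_equal; lia).
    rewrite !RtoC_mult; ring.
Qed.

(** * The matrix coefficients as Fourier coefficients *)

(* [sinh2tau x] is [sinh (2 tau)], for [x = cosh (2 tau)]. *)
Definition sinh2tau (x : R) : R := sqrt (x ^ 2 - 1).

(** With [t = tan (th / 2)] this is [atan (e^(2 tau) t) - atan t]; it is also the argument of
    [1 - r e^(- i th)] for [r = tanh tau]. *)
Definition phase (x th : R) : R := atan (sinh2tau x * sin th / (x + 1 - sinh2tau x * cos th)).

(** With [w = e^(2 tau)] and [t = tan (th / 2)], the argument of [ln] is
    [(w^2 t^2 + 1) / (w (t^2 + 1))], the ratio of the densities in the two basis functions up to the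
    factor [w]. *)
Definition P_integrand (l : C) (n : R) (k : nat) (x th : R) : C :=
  Cexp (l * RtoC (ln (x - sinh2tau x * cos th)) + Ci * RtoC (2 * n * phase x th - INR k * th))%C.

Definition P_coef (l : C) (n : R) (k : nat) (x : R) : C :=
  (RtoC (/ (2 * PI)) * CRInt (P_integrand l n k x) (- PI) PI)%C.

Lemma sinh2tau_sq (x : R) : 1 <= x -> sinh2tau x * sinh2tau x = x ^ 2 - 1.
Proof. intros Hx; unfold sinh2tau; apply sqrt_sqrt; nra. Qed.

Lemma sinh2tau_pos (x : R) : 0 <= sinh2tau x.
Proof. apply sqrt_pos. Qed.

Lemma sinh2tau_lt (x : R) : 1 <= x -> sinh2tau x < x.
Proof. intros Hx; assert (H1 := sinh2tau_sq x Hx); assert (H2 := sinh2tau_pos x); nra. Qed.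

Lemma sinh2tau_cos_lt (x th : R) : 1 <= x -> 0 < x - sinh2tau x * cos th.
Proof.
intros Hx; generalize (sinh2tau_lt x Hx) (sinh2tau_pos x) (COS_bound th); intros; nra.
Qed.

Lemma is_derive_phase (x th : R) : 1 <= x ->
  is_derive (phase x) th ((/ (x - sinh2tau x * cos th) - 1) / 2).
Proof.
intros Hx; assert (H1 := sinh2tau_cos_lt x th Hx); assert (H2 := sinh2tau_sq x Hx); assert (H3 := cos2_sin2 th).
unfold phase; auto_derive; [lra|].
set (S := sinh2tau x) in *; set (c := cos th) in *; set (s := sin th) in *.
assert (HB : 0 < x + 1 - S * c) by lra.
assert (E : (x + 1 - S * c) ^ 2 + (S * s) ^ 2 = 2 * (x + 1) * (x - S * c)).
{ replace ((S * s) ^ 2) with ((S * S) * (s * s)) by ring.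
  replace (s * s) with (1 - c * c) by lra.
  replace ((x + 1 - S * c) ^ 2) with ((x + 1) ^ 2 - 2 * (x + 1) * (S * c) + (S * S) * (c * c)) by ring.
  rewrite H2; ring. }
assert (E2 : S * c * (x + 1 - S * c) - S * s * (S * s) = (x + 1) * (S * c - (x - 1))).
{ replace (S * s * (S * s)) with ((S * S) * (s * s)) by ring.
  replace (s * s) with (1 - c * c) by lra.
  replace (S * c * (x + 1 - S * c)) with ((x + 1) * (S * c) - (S * S) * (c * c)) by ring.
  rewrite H2; ring. }
transitivity ((S * c * (x + 1 - S * c) - S * s * (S * s)) / ((x + 1 - S * c) ^ 2 + (S * s) ^ 2)).
{ field; repeat split; try lra; rewrite ?E; try (rewrite <- E; nra); nra. }
rewrite E, E2; field; lra.
Qed.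

Lemma Cder_P_integrand (l : C) (n : R) (k : nat) (x th : R) : 1 <= x ->
  Cder (P_integrand l n k x) th
   ((l * RtoC (sinh2tau x * sin th / (x - sinh2tau x * cos th)) +
     Ci * RtoC (n * (/ (x - sinh2tau x * cos th) - 1) - INR k)) * P_integrand l n k x th)%C.
Proof.
intros Hx; assert (H1 := sinh2tau_cos_lt x th Hx).
unfold P_integrand; apply Cder_Cexp.
apply Cder_plus; apply Cder_scal.
- apply (Cder_RtoC (fun t => ln (x - sinh2tau x * cos t))); auto_derive; [exact H1|field; lra].
- apply (Cder_RtoC (fun t => 2 * n * phase x t - INR k * t)).
  assert (D := is_derive_phase x th Hx).
  eapply is_derive_ext_eq.
  + apply (is_derive_minus (fun t => 2 * n * phase x t) (fun t => INR k * t)).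
    * exact (is_derive_scal (phase x) th (2 * n) _ D).
    * exact (is_derive_scal (fun t => t) th (INR k) _ (is_derive_id th)).
  + unfold minus, plus, opp, scal, one; simpl; unfold mult; simpl; field; lra.
Qed.

Lemma Ccont_P_integrand (l : C) (n : R) (k : nat) (x th : R) : 1 <= x -> Ccont (P_integrand l n k x) th.
Proof. intros Hx; exact (Cder_Ccont _ _ _ (Cder_P_integrand l n k x th Hx)). Qed.

Lemma cos_2_atan (t : R) : cos (2 * atan t) = (1 - t ^ 2) / (1 + t ^ 2).
Proof.
assert (0 < 1 + t ^ 2) by nra.
rewrite cos_2a_cos, cos_atan; unfold Rsqr.
assert (E : sqrt (1 + t * t) * sqrt (1 + t * t) = 1 + t * t) by (apply sqrt_sqrt; nra).
assert (0 < sqrt (1 + t * t)) by (apply sqrt_lt_R0; nra).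
replace (2 * (1 / sqrt (1 + t * t)) * (1 / sqrt (1 + t * t))) with (2 / (sqrt (1 + t * t) * sqrt (1 + t * t))) by (field; lra).
rewrite E; field; nra.
Qed.

Lemma sin_2_atan (t : R) : sin (2 * atan t) = 2 * t / (1 + t ^ 2).
Proof.
rewrite sin_2a, cos_atan, sin_atan; unfold Rsqr.
assert (E : sqrt (1 + t * t) * sqrt (1 + t * t) = 1 + t * t) by (apply sqrt_sqrt; nra).
assert (0 < sqrt (1 + t * t)) by (apply sqrt_lt_R0; nra).
replace (2 * (t / sqrt (1 + t * t)) * (1 / sqrt (1 + t * t))) with (2 * t / (sqrt (1 + t * t) * sqrt (1 + t * t))) by (field; lra).
rewrite E; field; nra.
Qed.

(** Both arctangents have the sign of [t], so their difference stays in []-PI/2, PI/2[] and the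
    subtraction formula needs no multiple of [PI]. *)
Lemma atan_dilate (w t : R) : 0 < w -> atan (w * t) - atan t = atan ((w - 1) * t / (1 + w * t ^ 2)).
Proof.
intros Hw.
assert (Hd : 0 < 1 + w * t ^ 2) by nra.
assert (E := atan_sub_correct (w * t) t).
replace (atan_sub (w * t) t) with ((w - 1) * t / (1 + w * t ^ 2)) in E by (unfold atan_sub; field; nra).
rewrite E; [ring|nra| |apply atan_bound].
assert (B1 := atan_bound (w * t)); assert (B2 := atan_bound t).
destruct (Rle_lt_dec 0 t) as [Ht|Ht].
- assert (0 <= atan t).
  { rewrite <- atan_0; destruct Ht as [Ht| <-]; [left; apply atan_increasing, Ht|lra]. }
  assert (0 <= atan (w * t)).
  { rewrite <- atan_0; destruct Ht as [Ht| <-]; [left; apply atan_increasing; nra|rewrite Rmult_0_r; lra]. }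
  lra.
- assert (atan t < 0) by (rewrite <- atan_0; apply atan_increasing, Ht).
  assert (atan (w * t) < 0) by (rewrite <- atan_0; apply atan_increasing; nra).
  lra.
Qed.

Lemma exp_2_tau (x : R) : 1 <= x -> exp (2 * tau x) = x + sinh2tau x.
Proof.
intros Hx; unfold tau; replace (2 * (ln (x + sqrt (x ^ 2 - 1)) / 2)) with (ln (x + sqrt (x ^ 2 - 1))) by field.
fold (sinh2tau x); apply exp_ln; generalize (sinh2tau_pos x); lra.
Qed.

Lemma Cexp_i_PI_nat (k : nat) : Cexp (Ci * RtoC (PI * INR k))%C = (RtoC (-1) ^ k)%C.
Proof.
rewrite RtoC_mult; replace (Ci * (RtoC PI * RtoC (INR k)))%C with (RtoC (INR k) * (Ci * RtoC PI))%C by ring.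
rewrite Cexp_pow, Cexp_Ci, cos_PI, sin_PI; reflexivity.
Qed.

Lemma coefP_P_coef (lambda n x : R) (k : nat) : 1 <= x ->
  let l := (RtoC (- / 2) + Ci * RtoC lambda)%C in
  coefP l (n + INR k) n x = (RtoC (-1) ^ k * P_coef l n k x)%C.
Proof.
intros Hx l; unfold coefP.
assert (HS := sinh2tau_sq x Hx); assert (HS0 := sinh2tau_pos x); assert (HSx := sinh2tau_lt x Hx).
set (g := fun th => (RtoC (-1) ^ k * RtoC (/ (2 * PI)) * P_integrand l n k x th)%C).
transitivity (CRInt g (- PI) PI).
- apply CInt_line_circle.
  + intros t; apply Ccont_mult; [apply Ccont_const|apply Ccont_P_integrand, Hx].
  + intros t.
    set (w := exp (2 * tau x)).
    assert (Hw : w = x + sinh2tau x) by apply exp_2_tau, Hx.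
    assert (Hw0 : 0 < w) by (rewrite Hw; lra).
    assert (Hwi : x - sinh2tau x = / w) by (rewrite Hw; apply Rmult_eq_reg_l with (x + sinh2tau x); [rewrite Rinv_r; nra|lra]).
    assert (Ht : 0 < 1 + t ^ 2) by nra.
    assert (Hwt : 0 < (w * t) ^ 2 + 1) by nra.
    assert (Hln : ln (x - sinh2tau x * cos (2 * atan t)) = ln ((w * t) ^ 2 + 1) - 2 * tau x - ln (t ^ 2 + 1)).
    { assert (Ew : 2 * tau x = ln w) by (unfold w; rewrite ln_exp; reflexivity).
      rewrite Ew, cos_2_atan.
      rewrite <- ln_div, <- ln_div by (try apply Rdiv_lt_0_compat; lra).
      f_equal; replace (x - sinh2tau x * ((1 - t ^ 2) / (1 + t ^ 2))) with (((x - sinh2tau x) + (x + sinh2tau x) * t ^ 2) / (1 + t ^ 2)) by (field; lra).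
      rewrite Hwi, <- Hw; field; lra. }
    assert (Hchi : phase x (2 * atan t) = atan (w * t) - atan t).
    { rewrite atan_dilate by exact Hw0; unfold phase; f_equal; rewrite cos_2_atan, sin_2_atan.
      assert (HD : 0 < 1 + w * t ^ 2) by nra.
      assert (ES : 2 * sinh2tau x = w - / w) by (rewrite <- Hwi, Hw; ring).
      assert (Ex : x + 1 - sinh2tau x = (1 + w) / w) by (replace (x + 1 - sinh2tau x) with (1 + / w) by lra; field; lra).
      assert (Ex' : x + 1 + sinh2tau x = 1 + w) by (rewrite Hw; ring).
      replace (x + 1 - sinh2tau x * ((1 - t ^ 2) / (1 + t ^ 2))) with (((x + 1 - sinh2tau x) + (x + 1 + sinh2tau x) * t ^ 2) / (1 + t ^ 2)) by (field; lra).
      replace (sinh2tau x * (2 * t / (1 + t ^ 2))) with ((2 * sinh2tau x) * t / (1 + t ^ 2)) by (field; lra).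
      rewrite ES, Ex, Ex'; field; repeat split; try nra.
      }
    unfold basis_e, g, P_integrand.
    rewrite !Cpower_pos by nra.
    rewrite Hln, Hchi.
    replace (RtoC (2 / (1 + t ^ 2))) with (RtoC 2 * Cexp (RtoC (- ln (t ^ 2 + 1))))%C.
    2: { rewrite Cexp_real, exp_Ropp, exp_ln, <- RtoC_mult by lra; f_equal; field; lra. }
    rewrite <- (Cexp_i_PI_nat k).
    assert (HP : (RtoC (/ sqrt PI) * RtoC (/ sqrt PI) = RtoC (/ (2 * PI)) * RtoC 2)%C).
    { rewrite <- !RtoC_mult; f_equal; assert (HPI := PI_RGT_0); rewrite <- Rinv_mult, sqrt_sqrt by lra; field; lra. }
    rewrite !Cmult_conj, !Cexp_conj.
    replace (Cconj (RtoC (/ sqrt PI))) with (RtoC (/ sqrt PI)) by (unfold Cconj, RtoC; simpl; f_equal; ring).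
    replace (Cconj (- (Ci * RtoC (PI * (n + INR k))))) with (Ci * RtoC (PI * (n + INR k)))%C
      by (apply C_eq; unfold Cconj, RtoC, Ci, Cmult, Copp; simpl; ring).
    replace (Cconj (Ci * RtoC (2 * (n + INR k) * atan t))) with (- (Ci * RtoC (2 * (n + INR k) * atan t)))%C
      by (apply C_eq; unfold Cconj, RtoC, Ci, Cmult, Copp; simpl; ring).
    (* Here [Re l = -1/2] enters: the conjugate of [l] is [-1 - l], and the power -1 of [t^2 + 1] so
       obtained is the Jacobian of the substitution, up to the factor 2. *)
    replace (Cconj (l * RtoC (ln (t ^ 2 + 1)))) with ((- RtoC 1 - l) * RtoC (ln (t ^ 2 + 1)))%C
      by (apply C_eq; unfold l, Cconj, RtoC, Ci, Cmult, Copp, Cminus, Cplus; simpl; field).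
    set (c := RtoC (/ sqrt PI)) in *.
    transitivity (c * c * Cexp (- (RtoC 2 * l * RtoC (tau x)) + (- (Ci * RtoC (PI * n)) + (Ci * RtoC (2 * n * atan (w * t))
      + (l * RtoC (ln ((w * t) ^ 2 + 1)) + (Ci * RtoC (PI * (n + INR k)) + (- (Ci * RtoC (2 * (n + INR k) * atan t))
      + (- RtoC 1 - l) * RtoC (ln (t ^ 2 + 1)))))))))%C; [rewrite !Cexp_plus; ring|].
    rewrite HP.
    transitivity (RtoC (/ (2 * PI)) * RtoC 2 * Cexp (Ci * RtoC (PI * INR k) + (l * RtoC (ln ((w * t) ^ 2 + 1) - 2 * tau x - ln (t ^ 2 + 1)) +
      Ci * RtoC (2 * n * (atan (w * t) - atan t) - INR k * (2 * atan t))
      + RtoC (- ln (t ^ 2 + 1)))))%C; [|rewrite !Cexp_plus; ring].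
    f_equal; f_equal.
    rewrite !RtoC_mult, RtoC_opp, !RtoC_minus, !RtoC_mult, !RtoC_minus, !RtoC_plus; ring.
- rewrite (is_CRInt_unique g (- PI) PI (RtoC (-1) ^ k * P_coef l n k x)%C); [reflexivity|].
  unfold g, P_coef; rewrite Cmult_assoc; apply is_CRInt_scal, is_CRInt_CRInt; intros t; apply Ccont_P_integrand, Hx.
Qed.

(** The angle [2 phase + th] is that of the dilated point, [2 atan (e^(2 tau) tan (th / 2))].
    Multiplying the integrand by its exponential, or by the inverse, shifts [n] by 1 and [k] by 1
    the opposite way. *)
Lemma cos_sin_phase (x th : R) : 1 <= x ->
  cos (2 * phase x th + th) = (x * cos th - sinh2tau x) / (x - sinh2tau x * cos th) /\
  sin (2 * phase x th + th) = sin th / (x - sinh2tau x * cos th).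
Proof.
intros Hx; assert (H1 := sinh2tau_cos_lt x th Hx); assert (HS := sinh2tau_sq x Hx); assert (H3 := cos2_sin2 th).
rewrite cos_plus, sin_plus; unfold phase; rewrite cos_2_atan, sin_2_atan.
set (S := sinh2tau x) in *; set (c := cos th) in *; set (s := sin th) in *.
assert (HB : 0 < x + 1 - S * c) by lra.
assert (Hs : s * s = 1 - c * c) by lra.
set (A := S * s); set (B := x + 1 - S * c) in *.
assert (HAA : A * A = (x ^ 2 - 1) * (1 - c * c)) by (unfold A; replace (S * s * (S * s)) with ((S * S) * (s * s)) by ring; rewrite HS, Hs; ring).
assert (HBB : B * B = (x + 1) ^ 2 - 2 * (x + 1) * (S * c) + (x ^ 2 - 1) * (c * c)) by (unfold B; rewrite <- HS; ring).
assert (HE : B * B + A * A = 2 * (x + 1) * (x - S * c)) by (rewrite HAA, HBB; ring).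
assert (HE2 : B * B - A * A = 2 * (x + 1) * (1 - S * c + (x - 1) * (c * c))) by (rewrite HAA, HBB; ring).
assert (HD : 0 < 2 * (x + 1) * (x - S * c)) by (apply Rmult_lt_0_compat; lra).
assert (Hc1 : (1 - (A / B) ^ 2) / (1 + (A / B) ^ 2) = (1 - S * c + (x - 1) * (c * c)) / (x - S * c)).
{ transitivity ((B * B - A * A) / (B * B + A * A)); [field; rewrite HE; repeat split; try lra; nra|].
  rewrite HE, HE2; field; lra. }
assert (Hs1 : 2 * (A / B) / (1 + (A / B) ^ 2) = S * s * (x + 1 - S * c) / ((x + 1) * (x - S * c))).
{ transitivity (2 * (A * B) / (B * B + A * A)); [field; rewrite HE; repeat split; try lra; nra|].
  rewrite HE; unfold A, B; field; lra. }
rewrite Hc1, Hs1; split.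
- replace (S * s * (x + 1 - S * c) / ((x + 1) * (x - S * c)) * s)
    with (S * (s * s) * (x + 1 - S * c) / ((x + 1) * (x - S * c))) by (field; lra).
  rewrite Hs.
  replace (S * (1 - c * c) * (x + 1 - S * c)) with ((1 - c * c) * ((x + 1) * S - (S * S) * c)) by ring.
  rewrite HS; field; lra.
- replace (S * s * (x + 1 - S * c) / ((x + 1) * (x - S * c)) * c)
    with (s * c * ((x + 1) * S - (S * S) * c) / ((x + 1) * (x - S * c))) by (field; lra).
  rewrite HS; field; lra.
Qed.

Lemma P_integrand_up (l : C) (n : R) (k : nat) (x th : R) :
  P_integrand l (n + 1) k x th = (P_integrand l n (S k) x th * Cexp (Ci * RtoC (2 * phase x th + th)))%C.
Proof.
unfold P_integrand; rewrite <- Cexp_plus; f_equal; rewrite S_INR, !RtoC_minus, !RtoC_plus, !RtoC_mult, !RtoC_plus; ring.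
Qed.

Lemma P_integrand_down (l : C) (n : R) (k : nat) (x th : R) :
  P_integrand l (n - 1) (S (S k)) x th = (P_integrand l n (S k) x th * Cexp (Ci * RtoC (- (2 * phase x th + th))))%C.
Proof.
unfold P_integrand; rewrite <- Cexp_plus; f_equal; rewrite !S_INR, RtoC_opp, !RtoC_minus, !RtoC_plus, !RtoC_mult, !RtoC_minus, !RtoC_plus; ring.
Qed.

(** The derivative of the integrand has integral 0 over the circle. Up to the factor of the
    integrand, that derivative is a combination of 1 and of the cosine and sine of the dilated
    angle, which are the shifts in [n] with [n + k] fixed. *)
Lemma P_coef_rec (l : C) (n : R) (k : nat) (x : R) : 1 <= x ->
  (RtoC (sinh2tau x / 2) * ((RtoC n - l) * P_coef l (n + 1) k x + (RtoC n + l) * P_coef l (n - 1) (S (S k)) x) =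
   RtoC (n + INR (S k) - n * x) * P_coef l n (S k) x)%C.
Proof.
intros Hx.
set (m := n + INR (S k)).
assert (HI : forall n' k', is_CRInt (P_integrand l n' k' x) (- PI) PI (CRInt (P_integrand l n' k' x) (- PI) PI)).
{ intros n' k'; apply is_CRInt_CRInt; intros t; apply Ccont_P_integrand, Hx. }
set (J0 := CRInt (P_integrand l n (S k) x) (- PI) PI) in *; set (Jp := CRInt (P_integrand l (n + 1) k x) (- PI) PI) in *;
set (Jm := CRInt (P_integrand l (n - 1) (S (S k)) x) (- PI) PI) in *.
assert (HC := is_CRInt_plus _ _ _ _ _ _ (is_CRInt_scal (Ci * RtoC (n * x - m))%C _ _ _ _ (HI n (S k)))
   (is_CRInt_plus _ _ _ _ _ _ (is_CRInt_scal (Ci * RtoC (sinh2tau x / 2) * (RtoC n - l))%C _ _ _ _ (HI (n + 1) k))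
     (is_CRInt_scal (Ci * RtoC (sinh2tau x / 2) * (RtoC n + l))%C _ _ _ _ (HI (n - 1) (S (S k)))))).
(* At both ends [sin] vanishes, hence so does [phase], and [k] is an integer: the real exponent [n]
   does not spoil periodicity. *)
assert (HZ : P_integrand l n (S k) x PI = P_integrand l n (S k) x (- PI)).
{ unfold P_integrand, phase; rewrite cos_neg, sin_neg, sin_PI, Ropp_0, Rmult_0_r.
  unfold Rdiv; rewrite Rmult_0_l, atan_0, !Cexp_plus; f_equal.
  replace (2 * n * 0 - INR (S k) * PI) with (IZR (- Z.of_nat (S k)) * PI) by (rewrite opp_IZR, <- INR_IZR_INZ; ring).
  rewrite Cexp_int_PI; do 2 f_equal; rewrite opp_IZR, <- INR_IZR_INZ; f_equal; ring. }
assert (H0 := is_CRInt_FTC (P_integrand l n (S k) x) _ (- PI) PI (fun t => Cder_P_integrand l n (S k) x t Hx)).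
match type of H0 with (_ -> is_CRInt ?h _ _ _) => set (h0 := h) in * end.
assert (Hpt : forall t, (Ci * RtoC (n * x - m) * P_integrand l n (S k) x t +
   (Ci * RtoC (sinh2tau x / 2) * (RtoC n - l) * P_integrand l (n + 1) k x t +
    Ci * RtoC (sinh2tau x / 2) * (RtoC n + l) * P_integrand l (n - 1) (S (S k)) x t))%C = h0 t).
{ intros t; unfold h0; rewrite P_integrand_up, P_integrand_down, !Cexp_Ci, cos_neg, sin_neg.
  assert (HD := sinh2tau_cos_lt x t Hx); destruct (cos_sin_phase x t Hx) as [-> ->].
  set (G := P_integrand l n (S k) x t); clearbody G.
  set (D := x - sinh2tau x * cos t) in *.
  replace ((x * cos t - sinh2tau x) / D, sin t / D) with (RtoC ((x * cos t - sinh2tau x) / D) + Ci * RtoC (sin t / D))%C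
    by (apply C_eq; unfold RtoC, Ci, Cplus, Cmult; simpl; ring).
  replace ((x * cos t - sinh2tau x) / D, - (sin t / D)) with (RtoC ((x * cos t - sinh2tau x) / D) - Ci * RtoC (sin t / D))%C
    by (apply C_eq; unfold RtoC, Ci, Cplus, Cminus, Copp, Cmult; simpl; ring).
  assert (Ei : (Ci * Ci = - RtoC 1)%C) by (apply C_eq; unfold RtoC, Ci, Copp, Cmult; simpl; ring).
  (* [1 / D] is affine in the cosine of the dilated angle; this linearizes the derivative of
     [phase]. *)
  assert (EX : / D = x + sinh2tau x * ((x * cos t - sinh2tau x) / D)).
  { apply Rmult_eq_reg_r with D; [|lra]; rewrite Rinv_l, Rmult_plus_distr_r by lra.
    replace (sinh2tau x * ((x * cos t - sinh2tau x) / D) * D) with (sinh2tau x * x * cos t - sinh2tau x * sinh2tau x) by (field; lra).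
    rewrite (sinh2tau_sq x Hx); unfold D; ring. }
  replace (sinh2tau x * sin t / D) with (sinh2tau x * (sin t / D)) by (field; lra).
  rewrite EX; unfold m.
  set (X := (x * cos t - sinh2tau x) / D); set (Y := sin t / D).
  replace (RtoC (sinh2tau x / 2)) with (RtoC (sinh2tau x) * RtoC (/ 2))%C by (rewrite <- RtoC_mult; f_equal).
  replace (n * (x + sinh2tau x * X - 1) - INR (S k)) with (n * x - (n + INR (S k)) + n * sinh2tau x * X) by ring.
  set (d := RtoC (n * x - (n + INR (S k)))).
  rewrite (RtoC_plus (n * x - (n + INR (S k)))); fold d.
  rewrite !RtoC_mult.
  assert (E2 : (RtoC (/ 2) * RtoC 2 = RtoC 1)%C) by (rewrite <- RtoC_mult; f_equal; field).
  transitivity ((Ci * d + Ci * RtoC (sinh2tau x) * RtoC (/ 2) * RtoC 2 * (RtoC n * RtoC X) - (Ci * Ci) * RtoC (sinh2tau x) * (RtoC (/ 2) * RtoC 2) * l * RtoC Y) * G)%C.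
  - ring.
  - rewrite Ei. replace (Ci * RtoC (sinh2tau x) * RtoC (/ 2) * RtoC 2)%C with (Ci * RtoC (sinh2tau x) * (RtoC (/ 2) * RtoC 2))%C by ring.
    rewrite E2; ring. }
assert (Hz0 : is_CRInt h0 (- PI) PI (RtoC 0)).
{ replace (RtoC 0) with (P_integrand l n (S k) x PI - P_integrand l n (S k) x (- PI)%R)%C by (rewrite HZ; ring).
  apply H0; intros t.
  apply Ccont_ext_loc with (2 := Ccont_plus _ _ t (Ccont_mult _ _ t (Ccont_const (Ci * RtoC (n * x - m))%C t) (Ccont_P_integrand l n (S k) x t Hx))
    (Ccont_plus _ _ t (Ccont_mult _ _ t (Ccont_const (Ci * RtoC (sinh2tau x / 2) * (RtoC n - l))%C t) (Ccont_P_integrand l (n + 1) k x t Hx))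
      (Ccont_mult _ _ t (Ccont_const (Ci * RtoC (sinh2tau x / 2) * (RtoC n + l))%C t) (Ccont_P_integrand l (n - 1) (S (S k)) x t Hx)))).
  apply filter_forall, Hpt. }
assert (E := is_CRInt_det _ _ _ _ _ (is_CRInt_ext _ _ _ _ _ Hpt HC) Hz0).
fold J0 Jp Jm in E.
unfold P_coef; fold J0; fold Jp; fold Jm.
assert (HCi : Ci <> RtoC 0) by (intros A; generalize (f_equal snd A); simpl; lra).
assert (E' : (RtoC (sinh2tau x / 2) * ((RtoC n - l) * Jp + (RtoC n + l) * Jm) = RtoC (m - n * x) * J0)%C).
{ replace (RtoC (m - n * x)) with (- RtoC (n * x - m))%C by (rewrite <- RtoC_opp; f_equal; ring).
  replace (RtoC (sinh2tau x / 2) * ((RtoC n - l) * Jp + (RtoC n + l) * Jm))%C with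
   (- RtoC (n * x - m) * J0 + / Ci * (Ci * RtoC (n * x - m) * J0 +
      (Ci * RtoC (sinh2tau x / 2) * (RtoC n - l) * Jp + Ci * RtoC (sinh2tau x / 2) * (RtoC n + l) * Jm)))%C by (field; exact HCi).
  rewrite E; ring. }
replace (RtoC (sinh2tau x / 2) * ((RtoC n - l) * (RtoC (/ (2 * PI)) * Jp) + (RtoC n + l) * (RtoC (/ (2 * PI)) * Jm)))%C
  with (RtoC (/ (2 * PI)) * (RtoC (sinh2tau x / 2) * ((RtoC n - l) * Jp + (RtoC n + l) * Jm)))%C by ring.
rewrite E'; ring.
Qed.

(** * Expansion in powers of [r = tanh tau] *)

Definition tanh_tau (x : R) : R := sinh2tau x / (x + 1).

Lemma tanh_tau_bounds (x : R) : 1 <= x -> 0 <= tanh_tau x < 1.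
Proof.
intros Hx; generalize (sinh2tau_pos x) (sinh2tau_lt x Hx); intros; unfold tanh_tau; split.
- apply Rmult_le_pos; [lra|left; apply Rinv_0_lt_compat; lra].
- apply Rmult_lt_reg_r with (x + 1); [lra|]; unfold Rdiv; rewrite Rmult_assoc, Rinv_l; lra.
Qed.

Lemma tanh_tau_quad (x th : R) : 1 <= x ->
  x - sinh2tau x * cos th = (x + 1) / 2 * (1 - 2 * tanh_tau x * cos th + tanh_tau x ^ 2).
Proof.
intros Hx; unfold tanh_tau.
replace ((x + 1) / 2 * (1 - 2 * (sinh2tau x / (x + 1)) * cos th + (sinh2tau x / (x + 1)) ^ 2))
  with ((x + 1) / 2 - sinh2tau x * cos th + (sinh2tau x * sinh2tau x) / (2 * (x + 1))) by (field; lra).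
rewrite (sinh2tau_sq x Hx); field; lra.
Qed.

Lemma P_integrand_factor (l : C) (n : R) (k : nat) (x th : R) : 1 <= x ->
  P_integrand l n k x th = (rcpow ((x + 1) / 2) l * (Cexp (- (Ci * RtoC (INR k * th))) *
    (Cexp ((l - RtoC n) * log1m (tanh_tau x) th) * Cexp ((l + RtoC n) * log1m (tanh_tau x) (- th)))))%C.
Proof.
intros Hx; assert (Hr := tanh_tau_bounds x Hx).
assert (HQ := rho_quad (tanh_tau x) th Hr); assert (H0 : 0 < (1 - tanh_tau x) ^ 2) by (apply pow_lt; lra).
unfold P_integrand, rcpow; rewrite <- !Cexp_plus; f_equal.
rewrite (tanh_tau_quad x th Hx), ln_mult by lra.
unfold log1m; rewrite cos_neg, sin_neg.
assert (Hchi : phase x th = atan (tanh_tau x * sin th / (1 - tanh_tau x * cos th))).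
{ unfold phase, tanh_tau; f_equal; generalize (sinh2tau_cos_lt x th Hx); intros; field; lra. }
replace (tanh_tau x * - sin th / (1 - tanh_tau x * cos th)) with (- (tanh_tau x * sin th / (1 - tanh_tau x * cos th)))
  by (unfold Rdiv; ring).
rewrite atan_opp, <- Hchi; set (c := phase x th); set (L := ln (1 - 2 * tanh_tau x * cos th + tanh_tau x ^ 2)).
set (M := ln ((x + 1) / 2)).
replace ((L / 2, - c) : C) with (RtoC (L / 2) - Ci * RtoC c)%C by (apply C_eq; unfold RtoC, Ci, Cminus, Cplus, Copp, Cmult; simpl; ring).
replace ((L / 2, - - c) : C) with (RtoC (L / 2) + Ci * RtoC c)%C by (apply C_eq; unfold RtoC, Ci, Cminus, Cplus, Copp, Cmult; simpl; ring).
replace L with (2 * (L / 2)) at 1 by field.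
rewrite RtoC_plus, RtoC_minus, !RtoC_mult; ring.
Qed.

Lemma lim_geom (K q : R) : 0 < q < 1 -> is_lim_seq (fun N => K * q ^ N) 0.
Proof.
intros Hq; replace 0 with (K * 0) by ring; apply (is_lim_seq_mult' _ _ K 0); [apply is_lim_seq_const|].
apply is_lim_seq_geom; rewrite Rabs_right; lra.
Qed.

Lemma P_coef_series (l : C) (n : R) (k : nat) (x : R) : 1 <= x ->
  Clim (fun N => Csum (fun i => binom_coef (l - RtoC n) (k + i) * binom_coef (l + RtoC n) i * RtoC (tanh_tau x ^ (k + 2 * i)))%C (S N))
    (rcpow ((x + 1) / 2) (- l) * P_coef l n k x)%C.
Proof.
intros Hx; set (a := (l - RtoC n)%C); set (b := (l + RtoC n)%C).
assert (Hr := tanh_tau_bounds x Hx); set (r := tanh_tau x) in *.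
(* The binomial series is used on a disc of radius [r0] strictly between [r] and 1; at [x = 1],
   where [r = 0], this radius is still positive. *)
set (r0 := (1 + r) / 2); assert (Hr0 : 0 < r0 < 1) by (unfold r0; lra); assert (Hrr0 : r <= r0) by (unfold r0; lra).
destruct (binomial_series a r0 Hr0) as [Ka [qa [HKa [Hqa Ha]]]].
destruct (binomial_series b r0 Hr0) as [Kb [qb [HKb [Hqb Hb]]]].
set (Ea := exp (Cmod a * (2 * (2 - ln (1 - r0))))).
set (Eb := exp (Cmod b * (2 * (2 - ln (1 - r0))))).
assert (HEa : 0 < Ea) by apply exp_pos. assert (HEb : 0 < Eb) by apply exp_pos.
set (X := fun th => Cexp (a * log1m r th)%C); set (Y := fun th => Cexp (b * log1m r (- th))%C).
assert (HX : forall th, Cmod (X th) <= Ea) by (intros; apply Cexp_log1m_bound; lra).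
assert (HY : forall th, Cmod (Y th) <= Eb) by (intros; apply Cexp_log1m_bound; lra).
assert (HI : is_CRInt (fun t => Cexp (- (Ci * RtoC (INR k * t))) * (X t * Y t))%C (- PI) PI (RtoC (2 * PI) * (rcpow ((x + 1) / 2) (- l) * P_coef l n k x))%C).
{ assert (HG := is_CRInt_scal (rcpow ((x + 1) / 2) (- l)) _ _ _ _ (is_CRInt_CRInt (P_integrand l n k x) (- PI) PI (fun t => Ccont_P_integrand l n k x t Hx))).
  replace (RtoC (2 * PI) * (rcpow ((x + 1) / 2) (- l) * P_coef l n k x))%C with (rcpow ((x + 1) / 2) (- l) * CRInt (P_integrand l n k x) (- PI) PI)%C.
  - apply is_CRInt_ext with (2 := HG); intros t; rewrite (P_integrand_factor l n k x t Hx), rcpow_opp.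
    unfold X, Y, a, b, r; field; apply rcpow_neq_0.
  - unfold P_coef; assert (HPI := PI_RGT_0); rewrite RtoC_inv by lra; field; apply RtoC_neq_0; lra. }
apply (Clim_le _ _ (fun N => 2 * Ka * Eb * qa ^ N + 2 * ((Ea + Ka) * Kb) * qb ^ N) 0).
2: { replace 0 with (0 + 0) by ring; apply is_lim_seq_plus'; apply lim_geom; assumption. }
intros N _.
assert (HP := is_CRInt_partial a b r k (S N)).
assert (HD := is_CRInt_plus _ _ _ _ _ _ HP (is_CRInt_scal (RtoC (-1)) _ _ _ _ HI)).
assert (HPI := PI_RGT_0).
assert (HB := is_CRInt_bound _ (- PI) PI (Ka * qa ^ N * Eb + (Ea + Ka) * (Kb * qb ^ N)) _ ltac:(lra) HD).
set (T := Csum _ (S N)) in *; set (L := (rcpow ((x + 1) / 2) (- l) * P_coef l n k x)%C) in *.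
replace (RtoC (2 * PI) * T + RtoC (-1) * (RtoC (2 * PI) * L))%C with (RtoC (2 * PI) * (T - L))%C in HB by ring.
rewrite Cmod_mult, Cmod_R, Rabs_right in HB by lra.
replace (PI - - PI) with (2 * PI) in HB by ring.
apply Rmult_le_reg_l with (2 * PI); [lra|].
eapply Rle_trans; [apply HB|right; ring].
intros t _.
set (XN := binom_sum a (k + S N) (RtoC r * Cexp (Ci * RtoC t))); set (YN := binom_sum b (S N) (RtoC r * Cexp (Ci * RtoC (- t)))).
replace (Cexp (- (Ci * RtoC (INR k * t))) * (XN * YN) + RtoC (-1) * (Cexp (- (Ci * RtoC (INR k * t))) * (X t * Y t)))%C
  with (Cexp (- (Ci * RtoC (INR k * t))) * ((XN - X t) * Y t + XN * (YN - Y t)))%C by ring.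
replace (- (Ci * RtoC (INR k * t)))%C with (Ci * RtoC (- (INR k * t)))%C by (rewrite RtoC_opp; ring).
rewrite Cmod_mult, Cmod_Cexp_Ci, Rmult_1_l.
assert (Hqn : forall M, 0 <= qa ^ M <= 1) by (intros M; split; [apply pow_le; lra|rewrite <- (pow1 M); apply pow_incr; lra]).
assert (H1 : Cmod (XN - X t)%C <= Ka * qa ^ N).
{ unfold XN, X; replace (k + S N)%nat with (S (k + N)) by lia.
  eapply Rle_trans; [apply Ha; lra|]; rewrite pow_add.
  generalize (Hqn k) (Hqn N); intros; apply Rmult_le_compat_l; [lra|nra]. }
assert (H2 : Cmod (YN - Y t)%C <= Kb * qb ^ N) by (apply Hb; lra).
assert (H3 : Cmod XN <= Ea + Ka).
{ replace XN with (X t + (XN - X t))%C by ring; eapply Rle_trans; [apply Cmod_triangle|].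
  apply Rplus_le_compat; [apply HX|]; eapply Rle_trans; [exact H1|]; generalize (Hqn N); nra. }
eapply Rle_trans; [apply Cmod_triangle|]; rewrite !Cmod_mult.
apply Rplus_le_compat; apply Rmult_le_compat; auto using Cmod_ge_0.
Qed.

(** * Two integrals of Mehler type *)

Lemma is_CInt_pos_Csum (f : nat -> R -> C) (l : nat -> C) (N : nat) :
  (forall j, is_CInt_pos (f j) (l j)) -> is_CInt_pos (fun t => Csum (fun j => f j t) (S N)) (Csum l (S N)).
Proof.
intros H; induction N as [|N IH].
- apply is_CInt_pos_ext with (f 0%nat); [intros; simpl; ring|].
  replace (Csum l 1) with (l 0%nat) by (simpl; ring); apply H.
- exact (is_CInt_pos_plus _ _ _ _ IH (H (S N))).
Qed.

(* The integrands of the representations of the matrix coefficient and of W,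
   for [n < 1/2]; [s] is the area tangent of [1 / x] in the first, [1 / x] in the second. *)
Definition mehler_sinh (l : C) (n m s u : R) : C :=
  Cexp (- RtoC (m * (2 * u + s)) + (l - RtoC n) * RtoC (ln (sinh u)) +
        (l + RtoC n) * RtoC (ln (sinh (u + s))) - l * RtoC (ln (sinh s)))%C.

Definition mehler_lin (l : C) (n m s u : R) : C :=
  Cexp (- RtoC (m * (2 * u + s)) + (l - RtoC n) * RtoC (ln u) +
        (l + RtoC n) * RtoC (ln (u + s)) - l * RtoC (ln s))%C.

Lemma beta_integrand_nat (c a : C) (i : nat) (v : R) : beta_integrand (c + RtoC (INR i))%C a v = (RtoC (exp (- v) ^ i) * beta_integrand c a v)%C.
Proof.
induction i as [|i IH].
- simpl; replace (c + RtoC 0)%C with c by ring; ring.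
- rewrite S_INR, RtoC_plus, Cplus_assoc, beta_integrand_shift, IH; simpl pow; rewrite RtoC_mult; ring.
Qed.

Lemma log1m_angle_0 (rho : R) : 0 <= rho < 1 -> log1m rho 0 = RtoC (ln (1 - rho)).
Proof.
intros H; unfold log1m, RtoC; rewrite cos_0, sin_0; f_equal.
- replace (1 - 2 * rho * 1 + rho ^ 2) with ((1 - rho) * (1 - rho)) by ring; rewrite ln_mult by lra; field.
- replace (rho * 0 / (1 - rho * 1)) with 0 by (field; lra); rewrite atan_0; ring.
Qed.

Lemma exp_neg_lt_1 (v : R) : 0 < v -> 0 < exp (- v) < 1.
Proof. intros Hv; split; [apply exp_pos|]; rewrite <- exp_0; apply exp_increasing; lra. Qed.

Lemma sinh_ln (u : R) : 0 < u -> ln (1 - exp (- (2 * u))) = ln 2 + ln (sinh u) - u.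
Proof.
intros Hu.
assert (Hs : 0 < sinh u) by (rewrite <- sinh_0; apply sinh_lt, Hu).
rewrite <- ln_mult by lra.
rewrite <- (ln_exp u) at 3; rewrite <- ln_div by (try apply exp_pos; lra).
f_equal; unfold sinh.
replace (- (2 * u)) with (- u + - u) by ring; rewrite exp_plus, exp_Ropp; field; apply Rgt_not_eq, exp_pos.
Qed.

(** Once the first binomial coefficient in each term is a Beta integral, the remaining sum under the
    integral sign is the series of [(1 - r^2 e^(-v))^(l + n)]. Its partial sums converge
    geometrically and uniformly in [v], which justifies the interchange with the integral. The
    hypothesis [n < 1/2] gives [-1 < Re (l - n)]. *)
Lemma P_coef_euler (l : C) (n : R) (k : nat) (x : R) : 1 < x -> Re l = - / 2 -> n < / 2 -> 0 < n + INR k ->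
  exists I, is_CInt_pos (fun v => beta_integrand (RtoC (INR k) - (l - RtoC n)) (l - RtoC n) v *
      Cexp ((l + RtoC n) * RtoC (ln (1 - tanh_tau x ^ 2 * exp (- v)))))%C I /\
    (rcpow ((x + 1) / 2) (- l) * P_coef l n k x =
     rGamma (RtoC n - l) * rGamma (l - RtoC n + RtoC 1) * (RtoC (tanh_tau x ^ k) * I))%C.
Proof.
intros Hx Hl Hn Hm; set (a := (l - RtoC n)%C); set (b := (l + RtoC n)%C).
assert (Ha : -1 < Re a) by (unfold a; simpl_Re; lra).
assert (Hk : 0 < Re (RtoC (INR k) - a)%C) by (unfold a; simpl_Re; lra).
assert (Hr := tanh_tau_bounds x (Rlt_le _ _ Hx)); set (r := tanh_tau x) in *.
set (r0 := (1 + r) / 2); assert (Hr0 : 0 < r0 < 1) by (unfold r0; lra); assert (Hrr0 : r <= r0) by (unfold r0; lra).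
assert (Hrho : forall v, 0 < v -> 0 <= r ^ 2 * exp (- v) <= r0).
{ intros v Hv; generalize (exp_neg_lt_1 v Hv); intros; split; [apply Rmult_le_pos; [nra|lra]|].
  apply Rle_trans with r; [|lra]; assert (r ^ 2 <= r) by nra. assert (0 <= r ^ 2) by nra. nra. }
destruct (binomial_series b r0 Hr0) as [Kb [q [HKb [Hq Hb]]]].
set (Eb := exp (Cmod b * (2 * (2 - ln (1 - r0))))).
destruct (is_CInt_pos_dom_beta (Re (RtoC (INR k) - a)%C) (Re a) Hk Ha) as [Kp [HKp HD]].
set (Y := fun v => Cexp (b * RtoC (ln (1 - r ^ 2 * exp (- v))))%C).
assert (HY : forall v, 0 < v -> Y v = Cexp (b * log1m (r ^ 2 * exp (- v)) 0)%C).
{ intros v Hv; unfold Y; rewrite log1m_angle_0 by (specialize (Hrho v Hv); lra); reflexivity. }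
assert (HYc : forall v, 0 < v -> Ccont Y v).
{ intros v Hv; specialize (Hrho v Hv).
  refine (Cder_Ccont _ _ _ (Cder_rcpow (fun v => 1 - r ^ 2 * exp (- v)) b v (r ^ 2 * exp (- v)) _ _)); [lra|].
  auto_derive; [exact Logic.I|ring]. }
destruct (HD Eb (fun v => beta_integrand (RtoC (INR k) - a) a v * Y v)%C) as [I [HI _]].
- left; apply exp_pos.
- intros v Hv; apply Ccont_mult; [apply Ccont_beta_integrand, Hv|apply HYc, Hv].
- intros v Hv; rewrite Cmod_mult, Cmod_beta_integrand, Rmult_comm; apply Rmult_le_compat_r.
  + apply Rmult_le_pos; left; apply exp_pos.
  + rewrite HY by exact Hv; apply Cexp_log1m_bound; [apply Hrho, Hv|lra].
- exists I; split; [exact HI|].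
  set (kap := (rGamma (RtoC n - l) * rGamma (l - RtoC n + RtoC 1))%C).
  apply (Clim_unique _ _ _ (P_coef_series l n k x (Rlt_le _ _ Hx))).
  fold a b; fold r.
  set (T := fun N => Csum (fun i => binom_coef b i * RtoC (r ^ (2 * i)) * Beta_int (RtoC (INR (k + i)) - a) a)%C (S N)).
  assert (HGT : forall N, is_CInt_pos (fun v => beta_integrand (RtoC (INR k) - a) a v * binom_sum b (S N) (RtoC (r ^ 2 * exp (- v)) * Cexp (Ci * RtoC 0)))%C (T N)).
  { intros N; unfold T.
    apply is_CInt_pos_ext with (fun v => Csum (fun i => binom_coef b i * RtoC (r ^ (2 * i)) * beta_integrand (RtoC (INR (k + i)) - a) a v)%C (S N)).
    - intros v Hv; unfold binom_sum; rewrite <- Csum_scal; apply Csum_ext; intros i _.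
      rewrite plus_INR, RtoC_plus.
      replace (RtoC (INR k) + RtoC (INR i) - a)%C with (RtoC (INR k) - a + RtoC (INR i))%C by ring.
      rewrite beta_integrand_nat; replace (Ci * RtoC 0)%C with (RtoC 0) by ring; rewrite Cexp_0, Cmult_1_r.
      rewrite <- RtoC_pow, Rpow_mult_distr, <- pow_mult, RtoC_mult; ring.
    - apply is_CInt_pos_Csum; intros i; apply is_CInt_pos_scal, is_CInt_pos_Beta_int; [|exact Ha].
      rewrite plus_INR; revert Hk; simpl_Re; generalize (pos_INR i); lra. }
  apply Clim_ext_loc with (u := fun N => (kap * RtoC (r ^ k) * T N)%C) (N0 := 0%nat).
  + intros N _; unfold T; rewrite <- Csum_scal; apply Csum_ext; intros i _.
    rewrite (binom_coef_Beta a (k + i) Ha).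
    * replace (- a)%C with (RtoC n - l)%C by (unfold a; ring); fold a in kap; unfold kap.
      rewrite pow_add, RtoC_mult; ring.
    * rewrite plus_INR; revert Hk; simpl_Re; generalize (pos_INR i); lra.
  + rewrite Cmult_assoc; apply Clim_scal.
    apply (Clim_le _ _ (fun N => Kb * Kp * q ^ N) 0); [|apply lim_geom, Hq].
    intros N _.
    assert (HM := is_CInt_pos_minus _ _ _ _ (HGT N) HI).
    destruct (HD (Kb * q ^ N) (fun v => beta_integrand (RtoC (INR k) - a) a v * binom_sum b (S N) (RtoC (r ^ 2 * exp (- v)) * Cexp (Ci * RtoC 0)) - beta_integrand (RtoC (INR k) - a) a v * Y v)%C) as [J [HJ BJ]].
    * apply Rmult_le_pos; [lra|apply pow_le; lra].
    * intros v Hv; apply Ccont_ext_loc with (fun v => beta_integrand (RtoC (INR k) - a) a v * (Csum (fun i => binom_coef b i * RtoC (r ^ (2 * i)) * RtoC (exp (- v) ^ i))%C (S N) + RtoC (-1) * Y v))%C.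
      -- apply filter_forall; intros t; replace (Csum (fun i => binom_coef b i * RtoC (r ^ (2 * i)) * RtoC (exp (- t) ^ i))%C (S N)) with
           (binom_sum b (S N) (RtoC (r ^ 2 * exp (- t)) * Cexp (Ci * RtoC 0))); [ring|].
         unfold binom_sum; apply Csum_ext; intros i _.
         replace (Ci * RtoC 0)%C with (RtoC 0) by ring; rewrite Cexp_0, Cmult_1_r.
         rewrite <- RtoC_pow, Rpow_mult_distr, <- pow_mult, RtoC_mult; ring.
      -- apply Ccont_mult; [apply Ccont_beta_integrand, Hv|]; apply Ccont_plus; [|apply Ccont_mult; [apply Ccont_const|apply HYc, Hv]].
         generalize (S N); intros M; induction M as [|M IH]; [exact (Ccont_const (RtoC 0) v)|].
         apply Ccont_plus; [exact IH|]; apply Ccont_mult; [apply Ccont_const|].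
         refine (Cder_Ccont _ _ _ (Cder_RtoC (fun v => exp (- v) ^ M) v (- INR M * exp (- v) ^ M) _)).
         apply (is_derive_ext (fun v => exp (- (INR M * v)))).
         ++ intros t; rewrite <- Rpower_pow by apply exp_pos; unfold Rpower; rewrite ln_exp; f_equal; ring.
         ++ rewrite <- Rpower_pow by apply exp_pos; unfold Rpower; rewrite ln_exp; auto_derive; [exact Logic.I|]. 
            replace (INR M * - v) with (- (INR M * v)) by ring; ring.
    * intros v Hv; replace (beta_integrand (RtoC (INR k) - a) a v * binom_sum b (S N) (RtoC (r ^ 2 * exp (- v)) * Cexp (Ci * RtoC 0)) - beta_integrand (RtoC (INR k) - a) a v * Y v)%C
        with (beta_integrand (RtoC (INR k) - a) a v * (binom_sum b (S N) (RtoC (r ^ 2 * exp (- v)) * Cexp (Ci * RtoC 0)) - Y v))%C by ring.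
      rewrite Cmod_mult, Cmod_beta_integrand, Rmult_comm; apply Rmult_le_compat_r.
      -- apply Rmult_le_pos; left; apply exp_pos.
      -- rewrite HY by exact Hv; apply Hb, Hrho, Hv.
    * rewrite (is_CInt_pos_det _ _ _ HM HJ); eapply Rle_trans; [exact BJ|right; ring].
Qed.

(** Since [r^2 = (x - 1) / (x + 1)], [(x + 1) / 2] is [1 / (1 - r^2)] with [r = e^(- s)]. *)
Lemma tanh_tau_facts (x : R) : 1 < x -> 0 < tanh_tau x < 1 /\ 0 < - ln (tanh_tau x) /\
  ln ((x + 1) / 2) = - ln (tanh_tau x) - ln 2 - ln (sinh (- ln (tanh_tau x))).
Proof.
intros Hx; assert (Hr := tanh_tau_bounds x (Rlt_le _ _ Hx)).
assert (HS := sinh2tau_sq x (Rlt_le _ _ Hx)); assert (HS0 := sinh2tau_pos x).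
assert (HSp : 0 < sinh2tau x) by nra.
assert (Hrp : 0 < tanh_tau x) by (unfold tanh_tau; apply Rdiv_lt_0_compat; lra).
set (r := tanh_tau x) in *; set (s := - ln r).
assert (Hs : 0 < s) by (unfold s; assert (ln r < 0) by (rewrite <- ln_1; apply ln_increasing; lra); lra).
assert (Er : r = exp (- s)) by (unfold s; rewrite Ropp_involutive, exp_ln; auto).
split; [lra|split; [exact Hs|]].
assert (ln (1 - exp (- (2 * s))) = ln 2 + ln (sinh s) - s) by (apply sinh_ln, Hs).
assert (Ex : (x + 1) / 2 = / (1 - exp (- (2 * s)))).
{ replace (exp (- (2 * s))) with (r * r) by (rewrite Er, <- exp_plus; f_equal; ring).
  unfold r, tanh_tau; replace (sinh2tau x / (x + 1) * (sinh2tau x / (x + 1))) with (sinh2tau x * sinh2tau x / ((x + 1) * (x + 1))) by (field; lra).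
  rewrite HS; field; lra. }
rewrite Ex, ln_Rinv; [lra|]; generalize (exp_neg_lt_1 (2 * s) ltac:(lra)); lra.
Qed.

(** The substitution [v = 2 u] turns [1 - e^(-v)] into [2 e^(-u) sinh u] and [1 - r^2 e^(-v)] into
    [2 e^(-(u + s)) sinh (u + s)]. *)
Lemma P_coef_mehler (l : C) (n : R) (k : nat) (x : R) : 1 < x -> Re l = - / 2 -> n < / 2 -> 0 < n + INR k ->
  exists I, is_CInt_pos (mehler_sinh l n (n + INR k) (- ln (tanh_tau x))) I /\
    P_coef l n k x = (rGamma (RtoC n - l) * rGamma (l - RtoC n + RtoC 1) * (rcpow 2 (l + RtoC 1) * I))%C.
Proof.
intros Hx Hl Hn Hm.
destruct (P_coef_euler l n k x Hx Hl Hn Hm) as [I [HI E]].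
destruct (tanh_tau_facts x Hx) as [Hr [Hs L3]].
set (r := tanh_tau x) in *; set (s := - ln r) in *.
assert (Er : r = exp (- s)) by (unfold s; rewrite Ropp_involutive, exp_ln; [reflexivity|apply Hr]).
set (w := (rcpow 2 (- (l + RtoC 1)) * rcpow ((x + 1) / 2) l * RtoC (r ^ k))%C).
exists (w * I)%C; split.
- apply is_CInt_pos_ext with (2 := is_CInt_pos_scal w _ _ (is_CInt_pos_scale 2 _ _ Rlt_0_2 HI)).
  intros u Hu; unfold w, beta_integrand, mehler_sinh.
  assert (Hsu : 0 < sinh u) by (rewrite <- sinh_0; apply sinh_lt, Hu).
  assert (Hss : 0 < sinh s) by (rewrite <- sinh_0; apply sinh_lt, Hs).
  assert (L1 := sinh_ln u Hu).
  assert (L2 : ln (1 - r ^ 2 * exp (- (2 * u))) = ln 2 + ln (sinh (u + s)) - (u + s)).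
  { rewrite <- sinh_ln by lra; do 2 f_equal; rewrite Er; simpl; rewrite Rmult_1_r, <- !exp_plus; f_equal; ring. }
  assert (L4 : RtoC (r ^ k) = Cexp (RtoC (- (INR k * s)))).
  { rewrite Cexp_real; f_equal; rewrite <- Rpower_pow by apply Hr; unfold Rpower; f_equal; unfold s; ring. }
  assert (L5 : RtoC 2 = Cexp (RtoC (ln 2))) by (rewrite Cexp_real, exp_ln by lra; reflexivity).
  rewrite L4, L5, L2; unfold rcpow; rewrite L1, L3.
  rewrite <- !Cexp_plus; f_equal.
  rewrite !RtoC_minus, !RtoC_plus, !RtoC_opp, !RtoC_mult, !RtoC_plus, !RtoC_mult; ring.
- replace (P_coef l n k x) with (rcpow ((x + 1) / 2) l * (rcpow ((x + 1) / 2) (- l) * P_coef l n k x))%C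
    by (rewrite rcpow_opp; field; apply rcpow_neq_0).
  rewrite E; unfold w; rewrite rcpow_opp; field; apply rcpow_neq_0.
Qed.

(** * Comparison of the two integrands *)

Lemma is_derive_sinh (t : R) : is_derive sinh t (cosh t).
Proof. unfold sinh, cosh; auto_derive; [exact I|field]. Qed.

Lemma is_derive_cosh (t : R) : is_derive cosh t (sinh t).
Proof. unfold sinh, cosh; auto_derive; [exact I|field]. Qed.

Lemma MVT_pos (f df : R -> R) (b : R) : 0 < b ->
  (forall t, 0 <= t <= b -> is_derive f t (df t)) ->
  exists c, 0 <= c <= b /\ f b = f 0 + df c * b.
Proof.
intros Hb Hd; destruct (MVT_gen f 0 b df) as [c [Hc E]].
- intros t Ht; rewrite Rmin_left, Rmax_right in Ht by lra; apply Hd; lra.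
- intros t Ht; rewrite Rmin_left, Rmax_right in Ht by lra.
  apply continuity_pt_filterlim, (ex_derive_continuous (V := R_NormedModule) f t); eexists; apply Hd; lra.
- rewrite Rmin_left, Rmax_right in Hc by lra; exists c; split; [lra|]; rewrite Rminus_0_r in E; lra.
Qed.

Lemma cosh_mono (s t : R) : 0 <= s <= t -> cosh s <= cosh t.
Proof.
intros H; unfold cosh.
replace t with (s + (t - s)) by ring.
set (d := t - s); assert (Hd : 0 <= d) by (unfold d; lra).
assert (Hs : 1 <= exp s) by (generalize (exp_ineq1_le s); lra).
assert (Hdd : 1 <= exp d) by (generalize (exp_ineq1_le d); lra).
rewrite Ropp_plus_distr, !exp_plus, !exp_Ropp.
set (p := exp s) in *; set (q := exp d) in *.
assert (E : p * q + / p * / q - (p + / p) = (q - 1) * (p * p * q - 1) / (p * q)) by (field; lra).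
assert (0 <= (q - 1) * (p * p * q - 1) / (p * q)).
{ assert (1 <= p * p) by nra. assert (1 <= p * p * q) by nra.
  apply Rmult_le_pos; [apply Rmult_le_pos; lra|left; apply Rinv_0_lt_compat; nra]. }
lra.
Qed.

Lemma cosh_ge_1 (t : R) : 0 <= t -> 1 <= cosh t.
Proof. intros Ht; rewrite <- cosh_0; apply cosh_mono; lra. Qed.

Lemma sinh_bounds (u : R) : 0 < u -> u <= sinh u <= u * cosh u.
Proof.
intros Hu; destruct (MVT_pos sinh cosh u Hu) as [c [Hc E]]; [intros; apply is_derive_sinh|].
rewrite sinh_0 in E; generalize (cosh_ge_1 c (proj1 Hc)) (cosh_mono c u Hc); intros; nra.
Qed.

Lemma ln_cosh_le (u : R) : 0 < u -> ln (cosh u) <= u ^ 2.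
Proof.
intros Hu.
destruct (MVT_pos (fun t => ln (cosh t)) (fun t => sinh t / cosh t) u Hu) as [c [Hc E]].
- intros t Ht; assert (H := cosh_ge_1 t (proj1 Ht)).
  assert (H' : 0 < cosh t) by lra.
  eapply is_derive_ext_eq; [exact (is_derive_comp ln cosh t _ _ (is_derive_ln _ H') (is_derive_cosh t))|].
  reflexivity.
- cbv beta in E; rewrite cosh_0, ln_1 in E; rewrite E, Rplus_0_l.
  assert (Hcc := cosh_ge_1 c (proj1 Hc)).
  assert (sinh c / cosh c <= c).
  { apply Rmult_le_reg_r with (cosh c); [lra|]; unfold Rdiv; rewrite Rmult_assoc, Rinv_l by lra.
    destruct (Rle_lt_or_eq_dec 0 c (proj1 Hc)) as [H|<-]; [generalize (sinh_bounds c H); lra|rewrite sinh_0; lra]. }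
  nra.
Qed.

Definition ln_sinhc (u : R) : R := ln (sinh u) - ln u.

Lemma sinh_pos (u : R) : 0 < u -> 0 < sinh u.
Proof. intros Hu; generalize (sinh_bounds u Hu); lra. Qed.

Lemma ln_sinhc_bounds (u : R) : 0 < u -> 0 <= ln_sinhc u <= u ^ 2.
Proof.
intros Hu; destruct (sinh_bounds u Hu) as [H1 H2]; unfold ln_sinhc.
assert (Hc := cosh_ge_1 u (Rlt_le _ _ Hu)).
apply ln_le in H1; [|exact Hu]; apply ln_le in H2; [|apply sinh_pos, Hu].
rewrite ln_mult in H2 by lra; generalize (ln_cosh_le u Hu); lra.
Qed.

(** An integrated form of [0 <= coth u - 1 / u <= 1]. It keeps the part proportional to [n] in the
    difference of the exponents bounded, although [ln_sinhc] itself is unbounded in [u]. *)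
Lemma ln_sinhc_increment (u s : R) : 0 < u -> 0 < s -> 0 <= ln_sinhc (u + s) - ln_sinhc u <= s.
Proof.
intros Hu Hs.
destruct (sinh_bounds u Hu) as [H1 H2]; destruct (sinh_bounds s Hs) as [H3 H4].
assert (Hcs := cosh_ge_1 s (Rlt_le _ _ Hs)); assert (Hcu := cosh_ge_1 u (Rlt_le _ _ Hu)).
assert (Hadd : sinh (u + s) = sinh u * cosh s + cosh u * sinh s).
{ unfold sinh, cosh; rewrite Ropp_plus_distr, !exp_plus; field. }
assert (Hes : cosh s + sinh s = exp s) by (unfold cosh, sinh; field).
assert (Hes1 : cosh s <= exp s) by lra.
assert (Hse : sinh s <= s * exp s) by nra.
assert (Hcu1 : cosh u <= sinh u + 1).
{ assert (cosh u - sinh u = exp (- u)) by (unfold cosh, sinh; field). generalize (exp_neg_lt_1 u Hu); lra. }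
assert (P0 : 0 < sinh u) by lra.
assert (HA : (u + s) * sinh u <= u * sinh (u + s)).
{ rewrite Hadd.
  assert (sinh u * 1 <= sinh u * cosh s) by (apply Rmult_le_compat_l; lra).
  assert (sinh u * s <= u * cosh u * sinh s) by (apply Rmult_le_compat; lra). nra. }
assert (HB : u * sinh (u + s) <= exp s * ((u + s) * sinh u)).
{ rewrite Hadd.
  assert (B1 : u * (cosh u * sinh s) <= u * ((sinh u + 1) * sinh s)).
  { apply Rmult_le_compat_l; [lra|]; apply Rmult_le_compat_r; lra. }
  assert (B2 : u * sinh s <= sinh u * (s * exp s)) by (apply Rmult_le_compat; lra).
  replace (exp s * ((u + s) * sinh u)) with (u * sinh u * exp s + sinh u * (s * exp s)) by ring.
  rewrite <- Hes at 1; nra. }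
assert (Psu : 0 < sinh (u + s)) by (apply sinh_pos; lra).
apply ln_le in HA; [|nra]; apply ln_le in HB; [|nra].
rewrite !ln_mult in HA by lra; rewrite ln_mult, ln_mult, ln_exp, ln_mult in HB by (try apply exp_pos; nra).
unfold ln_sinhc; lra.
Qed.

(* For [x >= 2], [eta = 1 / x] and [tanh sigma = eta]. *)
Lemma sigma_bounds (x : R) : 2 <= x ->
  let s := - ln (tanh_tau x) in
  / x <= s /\ s - / x <= 4 / 3 * / x ^ 3 /\ 0 <= ln (sinh s) - ln (/ x) <= (/ x) ^ 2.
Proof.
intros Hx s; set (e := / x).
assert (He : 0 < e <= / 2) by (split; [apply Rinv_0_lt_compat; lra|apply Rinv_le_contravar; lra]).
assert (HS := sinh2tau_sq x ltac:(lra)); assert (HS0 := sinh2tau_pos x).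
assert (HSp : 0 < sinh2tau x) by nra.
assert (Hxe : x = / e) by (unfold e; rewrite Rinv_inv; reflexivity).
assert (Hrp : 0 < tanh_tau x) by (unfold tanh_tau; apply Rdiv_lt_0_compat; lra).
assert (Es : s = (ln (1 + e) - ln (1 - e)) / 2).
{ unfold s; assert (E2 : ln (tanh_tau x * tanh_tau x) = ln (1 - e) - ln (1 + e)).
  { unfold tanh_tau; replace (sinh2tau x / (x + 1) * (sinh2tau x / (x + 1))) with (sinh2tau x * sinh2tau x / ((x + 1) * (x + 1))) by (field; lra).
    rewrite HS, <- ln_div by lra; f_equal; rewrite Hxe; field; lra. }
  rewrite ln_mult in E2 by assumption; lra. }
(* The derivative of [artanh t - t] is [t^2 / (1 - t^2)], at most [4/3 t^2] for [t <= 1/2]; hence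
   the constant 4/3. *)
destruct (MVT_pos (fun t => (ln (1 + t) - ln (1 - t)) / 2 - t) (fun t => t ^ 2 / (1 - t ^ 2)) e (proj1 He)) as [c [Hc E]].
{ intros t Ht; auto_derive; [lra|field; split; [nra|lra]]. }
cbv beta in E; rewrite Rplus_0_r, !Rminus_0_r, ln_1, <- Es in E.
assert (Hc2 : 0 <= c ^ 2 <= e ^ 2) by (split; nra).
assert (He2 : e ^ 2 <= / 4) by nra.
assert (Hq : 0 <= c ^ 2 / (1 - c ^ 2) <= 4 / 3 * e ^ 2).
{ split; [apply Rmult_le_pos; [lra|left; apply Rinv_0_lt_compat; lra]|].
  apply Rmult_le_reg_r with (1 - c ^ 2); [lra|]; unfold Rdiv at 1; rewrite Rmult_assoc, Rinv_l by lra; nra. }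
set (Q := c ^ 2 / (1 - c ^ 2)) in *.
assert (HQe : 0 <= Q * e) by (apply Rmult_le_pos; lra).
assert (HQe2 : Q * e <= 4 / 3 * e ^ 2 * e) by (apply Rmult_le_compat_r; lra).
split; [lra|split].
- replace (4 / 3 * / x ^ 3) with (4 / 3 * e ^ 2 * e) by (unfold e; field; lra). lra.
- assert (Esh : sinh s = / sinh2tau x).
  { unfold sinh, s; rewrite Ropp_involutive, exp_Ropp, exp_ln by exact Hrp; unfold tanh_tau.
    replace ((/ (sinh2tau x / (x + 1)) - sinh2tau x / (x + 1)) / 2) with (((x + 1) ^ 2 - sinh2tau x * sinh2tau x) / (2 * (x + 1) * sinh2tau x)) by (field; lra).
    rewrite HS; field; lra. }
  rewrite Esh, ln_Rinv by exact HSp.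
  assert (El : 2 * ln (sinh2tau x) = ln (1 - e ^ 2) - 2 * ln e).
  { replace (2 * ln (sinh2tau x)) with (ln (sinh2tau x) + ln (sinh2tau x)) by ring; rewrite <- ln_mult by exact HSp; rewrite HS.
    replace (2 * ln e) with (ln e + ln e) by ring; rewrite <- ln_mult by lra; rewrite <- ln_div by nra.
    f_equal; rewrite Hxe; field; lra. }
  assert (Hl1 : ln (1 - e ^ 2) <= 0) by (rewrite <- ln_1; apply ln_le; nra).
  assert (Hl2 : - ln (1 - e ^ 2) <= 2 * e ^ 2).
  { rewrite <- ln_Rinv by nra; eapply Rle_trans; [apply ln_le_sub_1, Rinv_0_lt_compat; nra|].
    apply Rmult_le_reg_r with (1 - e ^ 2); [nra|]; rewrite Rmult_minus_distr_r, Rinv_l by nra; nra. }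
  lra.
Qed.

(** Against the decay [e^(-y)] this leaves [e^(- y / 4)], the rate that [weight_integral]
    expects. *)
Lemma quad_le_exp (y : R) : 0 < y -> y + y ^ 2 <= 10 * exp (3 / 4 * y).
Proof.
intros Hy; replace (3 / 4 * y) with (3 / 8 * y + 3 / 8 * y) by field; rewrite exp_plus.
assert (H := exp_ineq1_le (3 / 8 * y)); nra.
Qed.

(* Both integrands are dominated by [((u + eta) / u) ^ (n + 1/2)] times an exponential;
   [n < 1/2] makes this integrable at [0], with a bound that does not depend on [m] and [eta]. *)
Lemma weight_integral (n : R) : n < / 2 ->
  exists C0, 0 < C0 /\ forall (m eta M : R) (f : R -> C), 0 < m -> 0 < eta -> 0 <= M ->
    (forall u, 0 < u -> Ccont f u) ->
    (forall u, 0 < u -> Cmod (f u) <= M * (m * (exp ((n + / 2) * (ln (u + eta) - ln u)) * exp (- (m * (u + eta) / 4))))) ->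
    exists l, is_CInt_pos f l /\ Cmod l <= M * C0 * exp (- (m * eta / 8)).
Proof.
intros Hn; destruct (Rle_lt_dec (n + / 2) 0) as [Ht|Ht].
(* A ratio [(u + eta) / u >= 1] to a nonpositive power is at most 1. *)
- destruct (is_CInt_pos_dom_power 0) as [Kp [HKp HD]]; [lra|].
  exists (4 * Kp); split; [lra|]; intros m eta M f Hm He HM Hf HB.
  destruct (HD (M * m * exp (- (m * eta / 8))) (m / 4) f) as [l [Hl Bl]]; auto; try lra.
  + repeat apply Rmult_le_pos; try lra; left; apply exp_pos.
  + intros u Hu; eapply Rle_trans; [apply HB, Hu|].
    rewrite !Rmult_assoc; apply Rmult_le_compat_l; [exact HM|]; apply Rmult_le_compat_l; [lra|].
    rewrite (Rpower_O u Hu), Rmult_1_l, <- !exp_plus; apply exp_le.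
    assert (ln u <= ln (u + eta)) by (apply ln_le; lra). nra.
  + exists l; split; [exact Hl|]; eapply Rle_trans; [exact Bl|].
    replace (- (0 + 1)) with (- (1)) by ring; rewrite Rpower_Ropp, Rpower_1 by lra; right; field; lra.
(* Here [t < 1], so [u^(-t)] is integrable at 0. Absorbing [(m (u + eta))^t], scaled by [m], into
   the exponential keeps the constant independent of [m] and [eta]. *)
- set (t := n + / 2) in *.
  destruct (is_CInt_pos_dom_power (- t)) as [Kp [HKp HD]]; [unfold t; lra|].
  destruct (Rpower_exp_bound t (/ 8) (Rlt_le _ _ Ht)) as [C1 [HC1 HE]]; [lra|].
  exists (C1 * Kp * Rpower 8 (1 - t)); split; [repeat apply Rmult_lt_0_compat; auto; apply exp_pos|].
  intros m eta M f Hm He HM Hf HB.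
  destruct (HD (M * (C1 * Rpower m (1 - t) * exp (- (m * eta / 8)))) (m / 8) f) as [l [Hl Bl]]; auto; try lra.
  + repeat apply Rmult_le_pos; try lra; left; apply exp_pos.
  + intros u Hu; eapply Rle_trans; [apply HB, Hu|].
    rewrite (Rmult_assoc M); apply Rmult_le_compat_l; [exact HM|].
    assert (A := HE (m * (u + eta)) ltac:(nra)).
    assert (E1 : m * (exp (t * (ln (u + eta) - ln u)) * exp (- (m * (u + eta) / 4))) =
      Rpower (m * (u + eta)) t * (Rpower m (1 - t) * Rpower u (- t) * exp (- (m * (u + eta) / 4)))).
    { rewrite <- (exp_ln m Hm) at 1; unfold Rpower; rewrite <- !exp_plus, ln_mult by lra; f_equal; ring. }
    rewrite E1.
    apply Rle_trans with (C1 * exp (/ 8 * (m * (u + eta))) * (Rpower m (1 - t) * Rpower u (- t) * exp (- (m * (u + eta) / 4)))).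
    * apply Rmult_le_compat_r; [|exact A]; repeat apply Rmult_le_pos; left; apply exp_pos.
    * right.
      replace (C1 * exp (/ 8 * (m * (u + eta))) * (Rpower m (1 - t) * Rpower u (- t) * exp (- (m * (u + eta) / 4))))
        with (C1 * Rpower m (1 - t) * Rpower u (- t) * (exp (/ 8 * (m * (u + eta))) * exp (- (m * (u + eta) / 4)))) by ring.
      replace (C1 * Rpower m (1 - t) * exp (- (m * eta / 8)) * (Rpower u (- t) * exp (- (m / 8 * u))))
        with (C1 * Rpower m (1 - t) * Rpower u (- t) * (exp (- (m * eta / 8)) * exp (- (m / 8 * u)))) by ring.
      rewrite <- !exp_plus; do 2 f_equal; field.
  + exists l; split; [exact Hl|]; eapply Rle_trans; [exact Bl|]; right.
    assert (E2 : Rpower m (1 - t) * Rpower (m / 8) (- (- t + 1)) = Rpower 8 (1 - t)).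
    { unfold Rpower; rewrite <- exp_plus, ln_div by lra; f_equal; ring. }
    rewrite <- E2; ring.
Qed.

Lemma Cmod_mehler_lin (l : C) (n m eta u : R) : Re l = - / 2 -> 0 < u -> 0 < eta ->
  Cmod (mehler_lin l n m eta u) = sqrt eta * (/ (u + eta) * (exp ((n + / 2) * (ln (u + eta) - ln u)) * exp (- (m * (2 * u + eta))))).
Proof.
intros Hl Hu He; unfold mehler_lin; rewrite Cmod_Cexp; simpl_Re; rewrite Hl.
replace (sqrt eta) with (exp (/ 2 * ln eta)) by (rewrite <- Rpower_sqrt by exact He; reflexivity).
rewrite <- (exp_ln (u + eta)) at 2 by lra; rewrite <- exp_Ropp, <- !exp_plus; f_equal; field.
Qed.

Lemma Ccont_mehler_lin (l : C) (n m eta u : R) : 0 < u -> 0 < eta -> Ccont (mehler_lin l n m eta) u.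
Proof.
intros Hu He; unfold mehler_lin.
eapply Cder_Ccont, Cder_Cexp.
assert (E : forall t, (- RtoC (m * (2 * t + eta)) + (l - RtoC n) * RtoC (ln t) + (l + RtoC n) * RtoC (ln (t + eta)) + (- l * RtoC (ln eta)) =
  - RtoC (m * (2 * t + eta)) + (l - RtoC n) * RtoC (ln t) + (l + RtoC n) * RtoC (ln (t + eta)) - l * RtoC (ln eta))%C) by (intros; ring).
apply (Cder_ext _ _ _ _ E).
apply Cder_plus; [apply Cder_plus; [apply Cder_plus|]|apply Cder_const].
- apply (Cder_ext (fun t => RtoC (-1) * RtoC (m * (2 * t + eta)))%C); [intros; ring|].
  apply Cder_scal, (Cder_RtoC (fun t => m * (2 * t + eta)) u (m * 2)); auto_derive; [exact I|ring].
- apply Cder_scal, (Cder_RtoC ln u (/ u)), is_derive_ln, Hu.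
- apply Cder_scal, (Cder_RtoC (fun t => ln (t + eta)) u (/ (u + eta))); auto_derive; [lra|field; lra].
Qed.

Lemma Ccont_mehler_sinh (l : C) (n m s u : R) : 0 < u -> 0 < s -> Ccont (mehler_sinh l n m s) u.
Proof.
intros Hu Hs; unfold mehler_sinh.
eapply Cder_Ccont, Cder_Cexp.
assert (E : forall t, (- RtoC (m * (2 * t + s)) + (l - RtoC n) * RtoC (ln (sinh t)) + (l + RtoC n) * RtoC (ln (sinh (t + s))) + (- l * RtoC (ln (sinh s))) =
  - RtoC (m * (2 * t + s)) + (l - RtoC n) * RtoC (ln (sinh t)) + (l + RtoC n) * RtoC (ln (sinh (t + s))) - l * RtoC (ln (sinh s)))%C) by (intros; ring).
apply (Cder_ext _ _ _ _ E).
assert (H1 := sinh_pos u Hu); assert (H2 := sinh_pos (u + s) ltac:(lra)).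
apply Cder_plus; [apply Cder_plus; [apply Cder_plus|]|apply Cder_const].
- apply (Cder_ext (fun t => RtoC (-1) * RtoC (m * (2 * t + s)))%C); [intros; ring|].
  apply Cder_scal, (Cder_RtoC (fun t => m * (2 * t + s)) u (m * 2)); auto_derive; [exact I|ring].
- apply Cder_scal, (Cder_RtoC (fun t => ln (sinh t))).
  exact (is_derive_comp ln sinh u _ _ (is_derive_ln _ H1) (is_derive_sinh u)).
- apply Cder_scal, (Cder_RtoC (fun t => ln (sinh (t + s)))).
  apply (is_derive_comp ln (fun t => sinh (t + s)) u (/ sinh (u + s)) (1 * cosh (u + s)) (is_derive_ln _ H2)).
  apply (is_derive_comp sinh (fun t => t + s) u (cosh (u + s)) 1 (is_derive_sinh _)).
  auto_derive; [exact I|ring].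
Qed.

(** Four replacements contribute to the difference of the exponents: [s] by [1 / x] in the
    exponential, [sinh u] by [u], [sinh (u + s)] by [u + 1 / x], and [sinh s] by [1 / x]. With
    [t = u + 1 / x], each is [O (t^2)] or [O (m t^3)]. *)
Lemma integrand_diff (l : C) (n : R) : Re l = - / 2 ->
  exists C0, 0 < C0 /\ forall m x u, 0 < m -> 2 <= x -> 0 < u ->
    Cmod (mehler_sinh l n m (- ln (tanh_tau x)) u - mehler_lin l n m (/ x) u)%C <=
    C0 / m ^ 2 * sqrt (/ x) * (m * (exp ((n + / 2) * (ln (u + / x) - ln u)) * exp (- (m * (u + / x) / 4)))).
Proof.
intros Hl.
set (ca := Cmod (l - RtoC n)); set (cb := Cmod (l + RtoC n)); set (cl := Cmod l).
assert (Hca : 0 <= ca) by apply Cmod_ge_0; assert (Hcb : 0 <= cb) by apply Cmod_ge_0; assert (Hcl : 0 <= cl) by apply Cmod_ge_0.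
(* The terms of [K] come from the bounds [B1] to [B4] below, and [c0] bounds the excess of the real
   part of the first exponent. *)
set (K := 2 + ca + 6 * cb + cl); set (c0 := 3 * Rabs n + 1).
exists (2 * K * exp c0 * 10); split; [unfold K; repeat apply Rmult_lt_0_compat; try lra; apply exp_pos|].
intros m x u Hm Hx Hu.
destruct (sigma_bounds x Hx) as [Hs1 [Hs2 Hs3]]; cbv zeta in *.
set (s := - ln (tanh_tau x)) in *; set (e := / x) in *.
assert (He : 0 < e <= / 2) by (split; [apply Rinv_0_lt_compat; lra|apply Rinv_le_contravar; lra]).
replace (4 / 3 * / x ^ 3) with (4 / 3 * e ^ 3) in Hs2 by (unfold e; field; lra).
assert (He2 : 0 < e ^ 2 <= / 4) by (split; nra).
assert (Hs2' : s - e <= / 3 * e) by (replace (e ^ 3) with (e * e ^ 2) in Hs2 by ring; nra).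
assert (D1 := ln_sinhc_bounds u Hu); assert (D2 := ln_sinhc_bounds (u + s) ltac:(lra)); assert (D3 := ln_sinhc_increment u s Hu ltac:(lra)).
set (d := ln (u + s) - ln (u + e)).
assert (Hd : 0 <= d <= 4 / 3 * e ^ 2).
{ unfold d; split; [assert (ln (u + e) <= ln (u + s)) by (apply ln_le; lra); lra|].
  rewrite <- ln_div by lra; eapply Rle_trans; [apply ln_le_sub_1, Rdiv_lt_0_compat; lra|].
  replace ((u + s) / (u + e) - 1) with ((s - e) / (u + e)) by (field; lra).
  apply Rmult_le_reg_r with (u + e); [lra|]; unfold Rdiv at 1; rewrite Rmult_assoc, Rinv_l by lra.
  replace (e ^ 3) with (e ^ 2 * e) in Hs2 by ring; nra. }
set (q := ln (sinh s) - ln e) in *.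
unfold mehler_sinh, mehler_lin.
set (LA := (- RtoC (m * (2 * u + s)) + (l - RtoC n) * RtoC (ln (sinh u)) + (l + RtoC n) * RtoC (ln (sinh (u + s))) - l * RtoC (ln (sinh s)))%C).
set (LB := (- RtoC (m * (2 * u + e)) + (l - RtoC n) * RtoC (ln u) + (l + RtoC n) * RtoC (ln (u + e)) - l * RtoC (ln e))%C).
assert (Ediff : (LA - LB = RtoC (- (m * (s - e))) + ((l - RtoC n) * RtoC (ln_sinhc u) + ((l + RtoC n) * RtoC (ln_sinhc (u + s) + d) + - (l * RtoC q))))%C).
{ unfold LA, LB, q, d, ln_sinhc; rewrite !RtoC_opp, !RtoC_mult, !RtoC_plus, !RtoC_minus, !RtoC_mult; ring. }
(* With [Re l = -1/2] the two unbounded terms [ln_sinhc] enter with negative sign, apart from their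
   difference, which is multiplied by [n] and bounded by [ln_sinhc_increment]. *)
assert (HRe : Re LA <= Re LB + c0).
{ assert (Re LA - Re LB <= c0); [|lra].
  rewrite <- Re_minus, Ediff; simpl_Re; rewrite Hl.
  assert (A := Rabs_mult_le n (ln_sinhc (u + s) + d - ln_sinhc u) 3 ltac:(apply Rabs_le; lra)).
  assert (0 <= m * (s - e)) by (apply Rmult_le_pos; lra).
  unfold c0; nra. }
set (t := u + e) in *; assert (Ht : 0 < t) by (unfold t; lra).
assert (HK : Cmod (LA - LB)%C <= K * (t ^ 2 + m * t ^ 3)).
{ assert (B1 : m * (s - e) <= 2 * (m * t ^ 3)).
  { assert (e ^ 3 <= t ^ 3) by (apply pow_incr; unfold t; lra).
    assert (s - e <= 2 * t ^ 3) by lra. nra. }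
  assert (B2 : ln_sinhc u <= t ^ 2) by (assert (u ^ 2 <= t ^ 2) by (apply pow_incr; unfold t; lra); lra).
  assert (B3 : ln_sinhc (u + s) + d <= 6 * t ^ 2).
  { assert ((u + s) ^ 2 <= (2 * t) ^ 2) by (apply pow_incr; unfold t; lra).
    assert (e ^ 2 <= t ^ 2) by (apply pow_incr; unfold t; lra).
    replace ((2 * t) ^ 2) with (4 * t ^ 2) in H by ring; lra. }
  assert (B4 : q <= t ^ 2) by (assert (e ^ 2 <= t ^ 2) by (apply pow_incr; unfold t; lra); lra).
  assert (P2 : 0 <= t ^ 2) by (apply pow_le; lra). assert (P3 : 0 <= m * t ^ 3) by (apply Rmult_le_pos; [lra|apply pow_le; lra]).
  rewrite Ediff.
  eapply Rle_trans; [apply Cmod_triangle|].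
  eapply Rle_trans; [apply Rplus_le_compat_l, Cmod_triangle|].
  eapply Rle_trans; [apply Rplus_le_compat_l, Rplus_le_compat_l, Cmod_triangle|].
  rewrite Cmod_opp, !Cmod_mult, !Cmod_R, Rabs_Ropp, !Rabs_right by (try apply Rle_ge; try apply Rmult_le_pos; lra).
  fold ca cb cl.
  assert (C1 := Rmult_le_compat_l _ _ _ Hca B2); assert (C2 := Rmult_le_compat_l _ _ _ Hcb B3); assert (C3 := Rmult_le_compat_l _ _ _ Hcl B4).
  unfold K; nra. }
eapply Rle_trans; [apply (Cexp_diff _ _ (Re LB + c0)); [exact HRe|unfold c0; generalize (Rabs_pos n); lra]|].
assert (EB : exp (Re LB) = sqrt e * (/ t * (exp ((n + / 2) * (ln t - ln u)) * exp (- (m * (2 * u + e)))))).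
{ rewrite <- Cmod_Cexp; apply (Cmod_mehler_lin l n m e u Hl Hu (proj1 He)). }
rewrite exp_plus, EB.
set (X := exp ((n + / 2) * (ln t - ln u))); assert (HX : 0 < X) by apply exp_pos.
assert (Hsq : 0 < sqrt e) by (apply sqrt_lt_R0; lra).
assert (HE1 : exp (- (m * (2 * u + e))) <= exp (- (m * t))) by (apply exp_le; unfold t; nra).
assert (HQ := quad_le_exp (m * t) ltac:(nra)).
assert (HKp : 0 < K) by (unfold K; lra).
assert (Hc0 : 0 < exp c0) by apply exp_pos.
apply Rle_trans with (2 * (K * (t ^ 2 + m * t ^ 3) * (sqrt e * (/ t * (X * exp (- (m * t)))) * exp c0))).
{ apply Rmult_le_compat_l; [lra|]; apply Rmult_le_compat; [apply Cmod_ge_0| |exact HK|].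
  - repeat apply Rmult_le_pos; try lra; try (left; apply Rinv_0_lt_compat; lra); left; apply exp_pos.
  - apply Rmult_le_compat_r; [lra|]; apply Rmult_le_compat_l; [lra|]; apply Rmult_le_compat_l; [left; apply Rinv_0_lt_compat; lra|].
    apply Rmult_le_compat_l; lra. }
(* Dividing [t^2 + m t^3] by [t] gives [(m t + (m t)^2) / m]; with the normalizing factor [m] of the
   weight this is the gain [m^-2]. *)
replace (2 * (K * (t ^ 2 + m * t ^ 3) * (sqrt e * (/ t * (X * exp (- (m * t)))) * exp c0)))
  with (2 * K * exp c0 * sqrt e * X * / m * ((m * t + (m * t) ^ 2) * exp (- (m * t)))) by (field; lra).
replace (2 * K * exp c0 * 10 / m ^ 2 * sqrt e * (m * (X * exp (- (m * t / 4)))))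
  with (2 * K * exp c0 * sqrt e * X * / m * (10 * exp (- (m * t / 4)))) by (field; lra).
apply Rmult_le_compat_l.
- repeat apply Rmult_le_pos; try lra; left; apply Rinv_0_lt_compat; lra.
- apply Rle_trans with (10 * exp (3 / 4 * (m * t)) * exp (- (m * t))).
  + apply Rmult_le_compat_r; [left; apply exp_pos|exact HQ].
  + right; rewrite Rmult_assoc, <- exp_plus; do 2 f_equal; field.
Qed.

(** * The case [n < 1/2] *)

Definition ell (lambda : R) : C := (RtoC (- / 2) + Ci * RtoC lambda)%C.

Lemma Re_ell (lambda : R) : Re (ell lambda) = - / 2.
Proof. unfold ell, Re, Ci, RtoC, Cplus, Cmult; simpl; ring. Qed.

(** The factor [1 / (u + eta)] is simply bounded by [1 / eta]. This is wasteful for small [m eta],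
    but the resulting weight [m eta] is what [t_bound] allows. *)
Lemma is_CInt_pos_mehler_lin (l : C) (n : R) : Re l = - / 2 -> n < / 2 ->
  exists C0, 0 < C0 /\ forall m eta, 0 < m -> 0 < eta ->
    exists J, is_CInt_pos (mehler_lin l n m eta) J /\ m * eta * Cmod J <= C0 * sqrt eta * exp (- (m * eta / 8)).
Proof.
intros Hl Hn; destruct (weight_integral n Hn) as [C0 [HC0 H]].
exists C0; split; [exact HC0|]; intros m eta Hm He.
assert (Hs : 0 < sqrt eta) by (apply sqrt_lt_R0, He).
assert (Hme : 0 < m * eta) by (apply Rmult_lt_0_compat; assumption).
destruct (H m eta (sqrt eta / (m * eta)) (mehler_lin l n m eta)) as [J [HJ BJ]]; auto.
- apply Rmult_le_pos; [lra|left; apply Rinv_0_lt_compat, Hme].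
- intros u Hu; apply Ccont_mehler_lin; assumption.
- intros u Hu; rewrite (Cmod_mehler_lin l n m eta u Hl Hu He).
  unfold Rdiv at 1; rewrite Rmult_assoc; apply Rmult_le_compat_l; [lra|].
  set (X := exp ((n + / 2) * (ln (u + eta) - ln u))); assert (0 < X) by apply exp_pos.
  assert (E1 : exp (- (m * (2 * u + eta))) <= exp (- (m * (u + eta) / 4))) by (apply exp_le; nra).
  assert (E2 : / (u + eta) <= / eta) by (apply Rinv_le_contravar; lra).
  replace (/ (m * eta) * (m * (X * exp (- (m * (u + eta) / 4))))) with (/ eta * (X * exp (- (m * (u + eta) / 4)))) by (field; lra).
  apply Rmult_le_compat; [left; apply Rinv_0_lt_compat; lra|apply Rmult_le_pos; [lra|left; apply exp_pos]|exact E2|].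
  apply Rmult_le_compat_l; [lra|exact E1].
- exists J; split; [exact HJ|].
  apply Rle_trans with (m * eta * (sqrt eta / (m * eta) * C0 * exp (- (m * eta / 8)))).
  + apply Rmult_le_compat_l; lra.
  + right; field; lra.
Qed.

(** The integral of [J] is rescaled by [u -> u / x], so that [u + 1 / x] becomes [(1 + u) / x]. For
    [rho = i lambda] the convergence condition [0 < Re (rho - nu + 1/2)] is [n < 1/2]. *)
Lemma W_mehler_lin (W : C -> C -> C -> C) (lambda n m x : R) (J : C) : is_whittaker_W W ->
  n < / 2 -> 0 < m -> 0 < x -> is_CInt_pos (mehler_lin (ell lambda) n m (/ x)) J ->
  W (RtoC n) (Ci * RtoC lambda)%C (RtoC (2 * m / x)) =
    (rGamma (ell lambda - RtoC n + RtoC 1) * (rcpow (2 * m) (ell lambda + RtoC 1) * J))%C.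
Proof.
intros [HW _] Hn Hm Hx HJ.
assert (Hz : 0 < 2 * m / x) by (apply Rdiv_lt_0_compat; lra).
assert (Hix : 0 < / x) by (apply Rinv_0_lt_compat, Hx).
rewrite HW; [|rewrite Re_RtoC; exact Hz|].
2: { unfold Ci, RtoC, Re, Cplus, Cminus, Copp, Cmult; simpl; lra. }
unfold whittaker_int; set (l := ell lambda) in *.
assert (E1 : (Ci * RtoC lambda + RtoC (/ 2) = l + RtoC 1)%C) by (apply C_eq; unfold l, ell, Ci, RtoC, Re, Im, Cplus, Cmult; simpl; field).
assert (E2 : (Ci * RtoC lambda - RtoC n + RtoC (/ 2) = l - RtoC n + RtoC 1)%C) by (apply C_eq; unfold l, ell, Ci, RtoC, Re, Im, Cplus, Cminus, Copp, Cmult; simpl; field).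
assert (E3 : (Ci * RtoC lambda - RtoC n - RtoC (/ 2) = l - RtoC n)%C) by (apply C_eq; unfold l, ell, Ci, RtoC, Re, Im, Cplus, Cminus, Copp, Cmult; simpl; field).
assert (E4 : (Ci * RtoC lambda + RtoC n - RtoC (/ 2) = l + RtoC n)%C) by (apply C_eq; unfold l, ell, Ci, RtoC, Re, Im, Cplus, Cminus, Copp, Cmult; simpl; field).
rewrite E1, E2, E3, E4.
set (w := Cexp (RtoC (m * / x) - (l + RtoC 1) * RtoC (ln (/ x)))%C).
erewrite (is_CInt_pos_CInt _ (w * J)%C).
- rewrite (Cpower_pos (2 * m / x)) by exact Hz.
  fold (rcpow (2 * m / x) (l + RtoC 1)); unfold Rdiv; rewrite rcpow_mult by lra.
  replace (- (RtoC (2 * m * / x) / RtoC 2))%C with (- RtoC (m * / x))%C.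
  2: { rewrite !RtoC_mult; field; apply RtoC_neq_0; lra. }
  unfold w, Cminus; rewrite Cexp_plus, !Cexp_opp; unfold rcpow.
  field; split; apply Cexp_neq_0.
- apply is_CInt_pos_ext with (2 := is_CInt_pos_scal w _ _ (is_CInt_pos_scale (/ x) _ _ Hix HJ)).
  intros u Hu; rewrite !Cpower_pos by lra; unfold w, mehler_lin.
  replace (RtoC (/ x)) with (Cexp (RtoC (ln (/ x)))) by (rewrite Cexp_real, exp_ln by exact Hix; reflexivity).
  assert (L1 : ln (/ x * u) = ln (/ x) + ln u) by (apply ln_mult; assumption).
  assert (L2 : ln (/ x * u + / x) = ln (/ x) + ln (1 + u)).
  { rewrite <- ln_mult by lra; f_equal; ring. }
  rewrite L1, L2, <- !Cexp_plus; f_equal.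
  unfold Rdiv; rewrite !RtoC_mult, !RtoC_plus, !RtoC_mult; ring.
Qed.

Definition W_term (W : C -> C -> C -> C) (lambda n m x : R) : C :=
  (rcpow m (- (ell lambda + RtoC 1)) * (rGamma (RtoC n - ell lambda) * W (RtoC n) (Ci * RtoC lambda) (RtoC (2 * m / x))))%C.

(* The factor [m / x] absorbs the logarithm of [W] at [0], present when [lambda = 0]. *)
Definition t_bound (W : C -> C -> C -> C) (lambda n : R) : Prop :=
  exists K c, 0 < K /\ 0 < c /\ forall m x, 0 < m -> 1 <= x ->
    m / x * Cmod (W_term W lambda n m x) <= K * (sqrt (/ x) * exp (- (c * (m / x)))).

(** The exponential factor makes the bound stable under the recurrence, whose coefficient grows with
    [m / x]. The restriction [2 <= x] keeps [sinh (2 tau)], by which that recurrence divides, away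
    from 0. *)
Definition diff_bound (W : C -> C -> C -> C) (lambda n : R) : Prop :=
  exists K c, 0 < K /\ 0 < c /\ forall k x, 0 < n + INR k -> 2 <= x ->
    (n + INR k) ^ 2 * Cmod (P_coef (ell lambda) n k x - W_term W lambda n (n + INR k) x)%C
      <= K * (sqrt (/ x) * exp (- (c * ((n + INR k) / x)))).

Lemma W_term_mehler_lin (W : C -> C -> C -> C) (lambda n m x : R) (J : C) : is_whittaker_W W ->
  n < / 2 -> 0 < m -> 0 < x -> is_CInt_pos (mehler_lin (ell lambda) n m (/ x)) J ->
  W_term W lambda n m x = (rGamma (RtoC n - ell lambda) * rGamma (ell lambda - RtoC n + RtoC 1) * (rcpow 2 (ell lambda + RtoC 1) * J))%C.
Proof.
intros HW Hn Hm Hx HJ; unfold W_term; rewrite (W_mehler_lin W lambda n m x J HW Hn Hm Hx HJ).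
rewrite rcpow_mult, rcpow_opp by lra; field; apply rcpow_neq_0.
Qed.

Lemma t_bound_base (W : C -> C -> C -> C) (lambda n : R) : is_whittaker_W W -> n < / 2 -> t_bound W lambda n.
Proof.
intros HW Hn; set (l := ell lambda).
destruct (is_CInt_pos_mehler_lin l n (Re_ell lambda) Hn) as [C0 [HC0 H]].
set (kap := Cmod (rGamma (RtoC n - l) * rGamma (l - RtoC n + RtoC 1) * rcpow 2 (l + RtoC 1))%C).
assert (Hk : 0 <= kap) by apply Cmod_ge_0.
exists ((kap + 1) * C0), (/ 8); split; [apply Rmult_lt_0_compat; lra|]; split; [lra|].
intros m x Hm Hx; destruct (H m (/ x) Hm ltac:(apply Rinv_0_lt_compat; lra)) as [J [HJ BJ]].
rewrite (W_term_mehler_lin W lambda n m x J HW Hn Hm ltac:(lra) HJ); fold l.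
rewrite Cmult_assoc, Cmod_mult; fold kap.
replace (m / x * (kap * Cmod J)) with (kap * (m * / x * Cmod J)) by (field; lra).
apply Rle_trans with (kap * (C0 * sqrt (/ x) * exp (- (m * / x / 8)))); [apply Rmult_le_compat_l; assumption|].
replace (/ 8 * (m / x)) with (m * / x / 8) by (field; lra).
assert (0 <= C0 * sqrt (/ x) * exp (- (m * / x / 8))).
{ apply Rmult_le_pos; [apply Rmult_le_pos; [lra|apply sqrt_pos]|left; apply exp_pos]. }
nra.
Qed.

Lemma diff_bound_base (W : C -> C -> C -> C) (lambda n : R) : is_whittaker_W W -> n < / 2 -> diff_bound W lambda n.
Proof.
intros HW Hn; set (l := ell lambda).
destruct (is_CInt_pos_mehler_lin l n (Re_ell lambda) Hn) as [C0 [HC0 H]].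
destruct (weight_integral n Hn) as [C1 [HC1 H1]].
destruct (integrand_diff l n (Re_ell lambda)) as [C2 [HC2 H2]].
set (kap := Cmod (rGamma (RtoC n - l) * rGamma (l - RtoC n + RtoC 1) * rcpow 2 (l + RtoC 1))%C).
assert (Hk : 0 <= kap) by apply Cmod_ge_0.
exists ((kap + 1) * (C2 * C1)), (/ 8); split; [repeat apply Rmult_lt_0_compat; lra|]; split; [lra|].
intros k x Hm Hx; set (m := n + INR k) in *.
assert (Hix : 0 < / x) by (apply Rinv_0_lt_compat; lra).
destruct (H m (/ x) Hm Hix) as [J [HJ _]].
destruct (P_coef_mehler l n k x ltac:(lra) (Re_ell lambda) Hn Hm) as [I [HI EQ]].
rewrite (W_term_mehler_lin W lambda n m x J HW Hn Hm ltac:(lra) HJ); fold l; rewrite EQ; fold m in HI.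
assert (HD := is_CInt_pos_minus _ _ _ _ HI HJ).
assert (Hsg := sigma_bounds x Hx); cbv zeta in Hsg; destruct Hsg as [Hs1 _].
destruct (H1 m (/ x) (C2 / m ^ 2 * sqrt (/ x)) (fun u => mehler_sinh l n m (- ln (tanh_tau x)) u - mehler_lin l n m (/ x) u)%C) as [D [HDD BD]]; auto.
- apply Rmult_le_pos; [|apply sqrt_pos]; apply Rmult_le_pos; [lra|left; apply Rinv_0_lt_compat, pow_lt, Hm].
- intros u Hu; apply Ccont_ext_loc with (fun u => mehler_sinh l n m (- ln (tanh_tau x)) u + RtoC (-1) * mehler_lin l n m (/ x) u)%C.
  + apply filter_forall; intros; ring.
  + apply Ccont_plus; [apply Ccont_mehler_sinh; lra|]; apply Ccont_mult; [apply Ccont_const|apply Ccont_mehler_lin; lra].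
- assert (E := is_CInt_pos_det _ _ _ HD HDD).
  replace (rGamma (RtoC n - l) * rGamma (l - RtoC n + RtoC 1) * (rcpow 2 (l + RtoC 1) * I) - rGamma (RtoC n - l) * rGamma (l - RtoC n + RtoC 1) * (rcpow 2 (l + RtoC 1) * J))%C
    with (rGamma (RtoC n - l) * rGamma (l - RtoC n + RtoC 1) * rcpow 2 (l + RtoC 1) * (I - J))%C by ring.
  rewrite E, Cmod_mult; fold kap.
  apply Rle_trans with (m ^ 2 * (kap * (C2 / m ^ 2 * sqrt (/ x) * C1 * exp (- (m * / x / 8))))).
  + apply Rmult_le_compat_l; [apply pow_le; lra|]; apply Rmult_le_compat_l; assumption.
  + replace (/ 8 * (m / x)) with (m * / x / 8) by (field; lra).
    set (X := sqrt (/ x) * exp (- (m * / x / 8))).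
    assert (HX : 0 <= X) by (apply Rmult_le_pos; [apply sqrt_pos|left; apply exp_pos]).
    replace (m ^ 2 * (kap * (C2 / m ^ 2 * sqrt (/ x) * C1 * exp (- (m * / x / 8))))) with (kap * (C2 * C1 * X)) by (unfold X; field; lra).
    clearbody X; assert (0 <= C2 * C1 * X) by (repeat apply Rmult_le_pos; lra). nra.
Qed.

(** * The three-term recurrence of W in its first parameter *)

Lemma rGamma_S (s : C) : rGamma s = (s * rGamma (s + RtoC 1))%C.
Proof.
destruct (archimed (Rabs (Re s))) as [Hup _].
set (k := Z.to_nat (up (Rabs (Re s)))).
assert (Hk : - Re s < INR k).
{ unfold k; rewrite INR_IZR_INZ, Z2Nat.id.
  - generalize (Rle_abs (- Re s)); rewrite Rabs_Ropp; lra.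
  - apply le_IZR; generalize (Rabs_pos (Re s)); lra. }
rewrite (rGamma_eq s (S k)) by (simpl_Re; rewrite S_INR; lra).
rewrite (rGamma_eq (s + RtoC 1)%C k) by (simpl_Re; lra).
rewrite rising_shift, S_INR, RtoC_plus.
replace (s + (RtoC (INR k) + RtoC 1))%C with (s + RtoC 1 + RtoC (INR k))%C by ring.
unfold Cdiv; ring.
Qed.

Lemma mehler_lin_up (l : C) (n m u : R) : 0 < u -> mehler_lin l (n + 1) m 1 u = (mehler_lin l n m 1 u * RtoC ((u + 1) / u))%C.
Proof.
intros Hu; replace (RtoC ((u + 1) / u)) with (Cexp (RtoC (ln ((u + 1) / u))))
  by (rewrite Cexp_real, exp_ln by (apply Rdiv_lt_0_compat; lra); reflexivity).
rewrite ln_div by lra; unfold mehler_lin; rewrite <- Cexp_plus; f_equal; rewrite !RtoC_plus, RtoC_minus; ring.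
Qed.

Lemma mehler_lin_down (l : C) (n m u : R) : 0 < u -> mehler_lin l (n - 1) m 1 u = (mehler_lin l n m 1 u * RtoC (u / (u + 1)))%C.
Proof.
intros Hu; replace (RtoC (u / (u + 1))) with (Cexp (RtoC (ln (u / (u + 1)))))
  by (rewrite Cexp_real, exp_ln by (apply Rdiv_lt_0_compat; lra); reflexivity).
rewrite ln_div by lra; unfold mehler_lin; rewrite <- Cexp_plus; f_equal; rewrite !RtoC_minus; ring.
Qed.

(** Integration of the derivative of [mehler_lin l n m 1], using [1 / u = (u + 1) / u - 1] and
    [1 / (u + 1) = 1 - u / (u + 1)]. For [n < -1/2] the primitive vanishes at 0 and the integral
    with [n + 1] converges. *)
Lemma mehler_lin_rec (l : C) (n m : R) (Jp J0 Jm : C) : Re l = - / 2 -> n < - / 2 -> 0 < m ->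
  is_CInt_pos (mehler_lin l (n + 1) m 1) Jp -> is_CInt_pos (mehler_lin l n m 1) J0 -> is_CInt_pos (mehler_lin l (n - 1) m 1) Jm ->
  ((l - RtoC n) * Jp = (RtoC (2 * m) - RtoC 2 * RtoC n) * J0 + (l + RtoC n) * Jm)%C.
Proof.
intros Hl Hn Hm Hp H0 Hd.
assert (HC := is_CInt_pos_plus _ _ _ _ (is_CInt_pos_scal (l - RtoC n)%C _ _ Hp) (is_CInt_pos_plus _ _ _ _ (is_CInt_pos_scal (- (RtoC (2 * m) - RtoC 2 * RtoC n))%C _ _ H0) (is_CInt_pos_scal (- (l + RtoC n))%C _ _ Hd))).
assert (HZ : is_CInt_pos (fun u => (l - RtoC n) * mehler_lin l (n + 1) m 1 u + (- (RtoC (2 * m) - RtoC 2 * RtoC n) * mehler_lin l n m 1 u + - (l + RtoC n) * mehler_lin l (n - 1) m 1 u))%C (RtoC 0)).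
{ apply (is_CInt_pos_FTC_0 (mehler_lin l n m 1) _ 1 (- / 2 - n) (2 * m)); try lra.
  - intros u Hu; rewrite (mehler_lin_up l n m u Hu), (mehler_lin_down l n m u Hu); unfold mehler_lin at 1.
    eapply Cder_eq.
    + apply Cder_Cexp.
      apply (Cder_ext (fun t => RtoC (-1) * RtoC (m * (2 * t + 1)) + (l - RtoC n) * RtoC (ln t) + (l + RtoC n) * RtoC (ln (t + 1)) + (- l * RtoC (ln 1)))%C); [intros; ring|].
      apply Cder_plus; [apply Cder_plus; [apply Cder_plus|]|apply Cder_const]; apply Cder_scal.
      * apply (Cder_RtoC (fun t => m * (2 * t + 1)) u (m * 2)); auto_derive; [exact I|ring].
      * apply (Cder_RtoC ln u (/ u)), is_derive_ln, Hu.
      * apply (Cder_RtoC (fun t => ln (t + 1)) u (/ (u + 1))); auto_derive; [lra|field; lra].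
    + match goal with |- context [Cexp ?e] => change (Cexp e) with (mehler_lin l n m 1 u) end; set (G := mehler_lin l n m 1 u).
      assert (N0 : RtoC u <> RtoC 0) by (apply RtoC_neq_0; lra).
      assert (N1 : (RtoC u + RtoC 1 <> RtoC 0)%C) by (rewrite <- RtoC_plus; apply RtoC_neq_0; lra).
      rewrite !RtoC_div, !RtoC_mult, !RtoC_inv, !RtoC_plus by lra; field; auto.
  - intros u Hu; apply Ccont_plus; [|apply Ccont_plus]; (apply Ccont_mult; [apply Ccont_const|apply Ccont_mehler_lin; lra]).
  - intros u Hu; rewrite (Cmod_mehler_lin l n m 1 u Hl Hu Rlt_0_1), sqrt_1, !Rmult_1_l.
    rewrite <- (exp_ln (u + 1)) at 1 by lra; unfold Rpower; rewrite <- exp_Ropp, <- !exp_plus; apply exp_le.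
    assert (0 <= ln (u + 1)) by (rewrite <- ln_1; apply ln_le; lra). nra. }
assert (E := is_CInt_pos_det _ _ _ HC HZ).
replace ((RtoC (2 * m) - RtoC 2 * RtoC n) * J0 + (l + RtoC n) * Jm)%C with
  ((l - RtoC n) * Jp - ((l - RtoC n) * Jp + (- (RtoC (2 * m) - RtoC 2 * RtoC n) * J0 + - (l + RtoC n) * Jm)))%C by ring.
rewrite E; ring.
Qed.

Definition W_defect (W : C -> C -> C -> C) (lambda z : R) (t : R) : C :=
  let l := ell lambda in
  (W (RtoC (t + 1)) (Ci * RtoC lambda) (RtoC z)
   - (RtoC z - RtoC 2 * RtoC t) * W (RtoC t) (Ci * RtoC lambda) (RtoC z)
   + (RtoC t - RtoC 1 - l) * (RtoC t + l) * W (RtoC (t - 1)) (Ci * RtoC lambda) (RtoC z))%C.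

(** For [t < -1/2] the three parameters [t + 1], [t], [t - 1] are all below 1/2, where the integral
    representation is available; [rGamma_S] aligns their Gamma factors. *)
Lemma W_defect_left (W : C -> C -> C -> C) (lambda z t : R) : is_whittaker_W W -> 0 < z -> t < - / 2 ->
  W_defect W lambda z t = RtoC 0.
Proof.
intros HW Hz Ht; set (l := ell lambda).
assert (HJ : forall n, n < / 2 -> exists J, is_CInt_pos (mehler_lin l n (z / 2) (/ 1)) J).
{ intros n Hn; destruct (is_CInt_pos_mehler_lin l n (Re_ell lambda) Hn) as [C0 [_ H]].
  destruct (H (z / 2) (/ 1)) as [J [HJ _]]; [lra|lra|exists J; exact HJ]. }
destruct (HJ (t + 1) ltac:(lra)) as [Jp HJp]; destruct (HJ t ltac:(lra)) as [J0 HJ0]; destruct (HJ (t - 1) ltac:(lra)) as [Jm HJm].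
unfold W_defect; fold l.
replace (RtoC z) with (RtoC (2 * (z / 2) / 1)) by (f_equal; field).
rewrite (W_mehler_lin W lambda (t + 1) (z / 2) 1 Jp HW), (W_mehler_lin W lambda t (z / 2) 1 J0 HW), (W_mehler_lin W lambda (t - 1) (z / 2) 1 Jm HW); try assumption; try lra.
fold l.
rewrite Rinv_1 in *.
assert (R := mehler_lin_rec l t (z / 2) Jp J0 Jm (Re_ell lambda) Ht ltac:(lra) HJp HJ0 HJm).
replace (2 * (z / 2) / 1) with (2 * (z / 2)) by field.
rewrite RtoC_minus, RtoC_plus.
assert (G1 := rGamma_S (l - (RtoC t + RtoC 1) + RtoC 1)%C).
assert (G2 := rGamma_S (l - RtoC t + RtoC 1)%C).
replace (l - (RtoC t + RtoC 1) + RtoC 1)%C with (l - RtoC t)%C in * by ring.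
replace (l - (RtoC t - RtoC 1) + RtoC 1)%C with (l - RtoC t + RtoC 1 + RtoC 1)%C by ring.
rewrite G1, G2.
set (g := rGamma (l - RtoC t + RtoC 1 + RtoC 1)); set (p := rcpow (2 * (z / 2)) (l + RtoC 1)).
replace ((l - RtoC t) * ((l - RtoC t + RtoC 1) * g) * (p * Jp) - (RtoC (2 * (z / 2)) - RtoC 2 * RtoC t) * ((l - RtoC t + RtoC 1) * g * (p * J0)) + (RtoC t - RtoC 1 - l) * (RtoC t + l) * (g * (p * Jm)))%C
  with ((l - RtoC t + RtoC 1) * g * p * ((l - RtoC t) * Jp - ((RtoC (2 * (z / 2)) - RtoC 2 * RtoC t) * J0 + (l + RtoC t) * Jm)))%C by ring.
rewrite R; ring.
Qed.

(** * Real-analytic functions and the identity theorem *)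

(** Only real increments occur: the recurrence is continued along the real axis of the first
    parameter, from [t < -1/2] to all [t]. *)
Definition real_analytic (f : R -> C) (t0 : R) : Prop :=
  exists (a : nat -> C) (r : R), 0 < r /\
    forall h, Rabs h < r -> Clim (fun N => Csum (fun j => a j * RtoC (h ^ j))%C N) (f (t0 + h)).

Lemma sum_n_Csum (f : nat -> C) (N : nat) : sum_n (G := C_AbelianMonoid) f N = Csum f (S N).
Proof.
induction N as [|N IH]; [rewrite sum_O; simpl; ring|].
rewrite sum_Sn, IH; reflexivity.
Qed.

Lemma analytic_real_analytic (f : C -> C) (t0 : R) : analytic_at f (RtoC t0) -> real_analytic (fun t => f (RtoC t)) t0.
Proof.
intros [a [r [Hr H]]]; exists a, r; split; [exact Hr|]; intros h Hh.
assert (E : (RtoC (t0 + h) - RtoC t0 = RtoC h)%C) by (rewrite RtoC_plus; ring).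
assert (P := H (RtoC (t0 + h))); rewrite E, Cmod_R in P; specialize (P Hh).
unfold is_pseries, is_series in P.
assert (Q : is_lim_seq (fun N => Cmod (Csum (fun j => a j * RtoC (h ^ j))%C (S N) - f (RtoC (t0 + h)))%C) 0).
{ apply is_lim_seq_spec; intros e.
  assert (L := proj1 (filterlim_locally_ball_norm _ _) P e).
  revert L; apply filter_imp; intros N HN; rewrite sum_n_Csum in HN.
  assert (HN' : Cmod (Csum (fun k => scal (pow_n (RtoC h : C_AbsRing) k) (a k)) (S N) - f (RtoC (t0 + h)))%C < e) by exact HN.
  rewrite Rminus_0_r, Rabs_right by (apply Rle_ge, Cmod_ge_0).
  replace (Csum (fun j => a j * RtoC (h ^ j))%C (S N)) with (Csum (fun k => scal (pow_n (RtoC h : C_AbsRing) k) (a k)) (S N)); [exact HN'|].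
  apply Csum_ext; intros j _.
  assert (Ep : pow_n (RtoC h : C_AbsRing) j = RtoC (h ^ j)).
  { induction j as [|j IH]; [reflexivity|]; simpl; rewrite IH, RtoC_mult; reflexivity. }
  rewrite Ep; unfold scal; simpl; unfold mult; simpl; ring. }
unfold Clim; apply (is_lim_seq_incr_1 (fun N => Cmod (Csum (fun j => a j * RtoC (h ^ j))%C N - f (RtoC (t0 + h)))%C)); exact Q.
Qed.

Lemma real_analytic_ext (f g : R -> C) (t0 : R) : (forall t, f t = g t) -> real_analytic f t0 -> real_analytic g t0.
Proof.
intros E [a [r [Hr H]]]; exists a, r; split; [exact Hr|]; intros h Hh; rewrite <- E; apply H, Hh.
Qed.

Lemma Csum_plus (f g : nat -> C) (N : nat) : Csum (fun j => f j + g j)%C N = (Csum f N + Csum g N)%C.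
Proof. induction N as [|N IH]; simpl; [ring|rewrite IH; ring]. Qed.

Lemma Clim_plus (u v : nat -> C) (l l' : C) : Clim u l -> Clim v l' -> Clim (fun N => u N + v N)%C (l + l')%C.
Proof.
intros H H'; apply (Clim_le _ _ (fun N => Cmod (u N - l)%C + Cmod (v N - l')%C) 0).
- intros N _; replace (u N + v N - (l + l'))%C with ((u N - l) + (v N - l'))%C by ring; apply Cmod_triangle.
- replace 0 with (0 + 0) by ring; apply is_lim_seq_plus'; assumption.
Qed.

Lemma real_analytic_plus (f g : R -> C) (t0 : R) : real_analytic f t0 -> real_analytic g t0 -> real_analytic (fun t => f t + g t)%C t0.
Proof.
intros [a [r [Hr H]]] [b [s [Hs H']]].
exists (fun j => a j + b j)%C, (Rmin r s); split; [apply Rmin_glb_lt; assumption|].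
intros h Hh; assert (Hh1 := Rlt_le_trans _ _ _ Hh (Rmin_l _ _)); assert (Hh2 := Rlt_le_trans _ _ _ Hh (Rmin_r _ _)).
apply Clim_ext_loc with (2 := Clim_plus _ _ _ _ (H h Hh1) (H' h Hh2)) (N0 := 0%nat).
intros N _; rewrite <- Csum_plus; apply Csum_ext; intros; ring.
Qed.

(** At [t0 + h] the factor is [(c + d t0) + d h], and multiplication by [h] shifts the coefficients
    by one. *)
Lemma real_analytic_affine (f : R -> C) (c d : C) (t0 : R) : real_analytic f t0 -> real_analytic (fun t => (c + d * RtoC t) * f t)%C t0.
Proof.
intros [a [r [Hr H]]].
exists (fun j => (c + d * RtoC t0) * a j + d * match j with O => RtoC 0 | S i => a i end)%C, r; split; [exact Hr|].
intros h Hh.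
assert (L1 := Clim_scal (c + d * RtoC t0)%C _ _ (H h Hh)).
assert (L2 : Clim (fun N => Csum (fun j => match j with O => RtoC 0 | S i => a i end * RtoC (h ^ j))%C N) (RtoC h * f (t0 + h)%R)%C).
{ assert (L3 := Clim_scal (RtoC h) _ _ (H h Hh)).
  unfold Clim; apply (is_lim_seq_incr_1 (fun N => Cmod (Csum (fun j => match j with O => RtoC 0 | S i => a i end * RtoC (h ^ j))%C N - RtoC h * f (t0 + h)%R)%C)).
  revert L3; unfold Clim; apply is_lim_seq_ext; intros N; do 2 f_equal.
  induction N as [|N IH]; [simpl; ring|].
  replace (Csum (fun j => match j with O => RtoC 0 | S i => a i end * RtoC (h ^ j))%C (S (S N)))
    with (Csum (fun j => match j with O => RtoC 0 | S i => a i end * RtoC (h ^ j))%C (S N) + a N * RtoC (h ^ S N))%C by reflexivity.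
  rewrite <- IH; simpl; rewrite RtoC_mult; ring. }
assert (L := Clim_plus _ _ _ _ L1 (Clim_scal d _ _ L2)).
replace ((c + d * RtoC t0) * f (t0 + h)%R + d * (RtoC h * f (t0 + h)%R))%C with ((c + d * RtoC (t0 + h)) * f (t0 + h)%R)%C in L
  by (rewrite RtoC_plus; ring).
apply Clim_ext_loc with (2 := L) (N0 := 0%nat); intros N _.
rewrite <- !Csum_scal, <- Csum_plus; apply Csum_ext; intros; ring.
Qed.

Lemma real_analytic_shift (f : R -> C) (c t0 : R) : real_analytic f (t0 + c) -> real_analytic (fun t => f (t + c)) t0.
Proof.
intros [a [r [Hr H]]]; exists a, r; split; [exact Hr|]; intros h Hh.
replace (t0 + h + c) with (t0 + c + h) by ring; apply H, Hh.
Qed.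

(** The terms beyond the leading one form a geometric tail of ratio [|h| / rho <= 1/2], bounded
    uniformly in the number [P] of further terms. The induction carries [2 q - 2 q^(P + 1)] so that
    each step can pay for its new term. *)
Lemma Csum_lead (a : nat -> C) (h rho M : R) (N P : nat) : 0 < rho -> Rabs h <= rho / 2 -> 0 <= M ->
  (forall j, (j < N)%nat -> a j = RtoC 0) -> (forall j, Cmod (a j) * rho ^ j <= M) ->
  Cmod (Csum (fun j => a j * RtoC (h ^ j))%C (S (N + P)) - a N * RtoC (h ^ N))%C <= Rabs h ^ N * (2 * M / rho ^ S N * Rabs h).
Proof.
intros Hrho Hh HM Ha HB.
assert (H0 : forall Q, (Q <= N)%nat -> Csum (fun j => a j * RtoC (h ^ j))%C Q = RtoC 0).
{ induction Q as [|Q IH]; intros HQ; [reflexivity|]; simpl; rewrite IH, Ha by lia; ring. }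
assert (Hp := Rabs_pos h).
set (q := Rabs h / rho).
assert (Hq : 0 <= q <= / 2).
{ unfold q; split; [apply Rmult_le_pos; [lra|left; apply Rinv_0_lt_compat, Hrho]|].
  apply Rmult_le_reg_r with rho; [exact Hrho|]; unfold Rdiv; rewrite Rmult_assoc, Rinv_l by lra; lra. }
assert (HrN : 0 < rho ^ N) by (apply pow_lt, Hrho).
assert (Hc : 0 <= Rabs h ^ N * (M / rho ^ N)) by (apply Rmult_le_pos; [apply pow_le; lra|apply Rmult_le_pos; [lra|left; apply Rinv_0_lt_compat, HrN]]).
assert (HP : Cmod (Csum (fun j => a j * RtoC (h ^ j))%C (S (N + P)) - a N * RtoC (h ^ N))%C <= Rabs h ^ N * (M / rho ^ N) * (2 * q - 2 * q ^ S P)).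
{ induction P as [|P IH].
  - rewrite Nat.add_0_r; simpl Csum; rewrite H0 by lia.
    replace (RtoC 0 + a N * RtoC (h ^ N) - a N * RtoC (h ^ N))%C with (RtoC 0) by ring; rewrite Cmod_0; simpl pow.
    apply Rmult_le_pos; [exact Hc|nra].
  - replace (N + S P)%nat with (S (N + P)) by lia.
    replace (Csum (fun j => a j * RtoC (h ^ j))%C (S (S (N + P)))) with (Csum (fun j => a j * RtoC (h ^ j))%C (S (N + P)) + a (S (N + P)) * RtoC (h ^ S (N + P)))%C by reflexivity.
    set (X := Csum _ (S (N + P))) in *.
    replace (X + a (S (N + P)) * RtoC (h ^ S (N + P)) - a N * RtoC (h ^ N))%C with ((X - a N * RtoC (h ^ N)) + a (S (N + P)) * RtoC (h ^ S (N + P)))%C by ring.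
    eapply Rle_trans; [apply Cmod_triangle|].
    assert (T : Cmod (a (S (N + P)) * RtoC (h ^ S (N + P)))%C <= Rabs h ^ N * (M / rho ^ N) * q ^ S P).
    { rewrite Cmod_mult, Cmod_R, <- RPow_abs.
      replace (Rabs h ^ S (N + P)) with (Rabs h ^ N * (q ^ S P * rho ^ S P)).
      2: { rewrite <- Rpow_mult_distr; unfold q; replace (Rabs h / rho * rho) with (Rabs h) by (field; lra); rewrite <- pow_add; f_equal; lia. }
      specialize (HB (S (N + P))); replace (rho ^ S (N + P)) with (rho ^ N * rho ^ S P) in HB by (rewrite <- pow_add; f_equal; lia).
      replace (Cmod (a (S (N + P))) * (Rabs h ^ N * (q ^ S P * rho ^ S P))) with (Rabs h ^ N * (/ rho ^ N) * q ^ S P * (Cmod (a (S (N + P))) * (rho ^ N * rho ^ S P))) by (field; lra).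
      replace (Rabs h ^ N * (M / rho ^ N) * q ^ S P) with (Rabs h ^ N * (/ rho ^ N) * q ^ S P * M) by (field; lra).
      apply Rmult_le_compat_l; [|exact HB].
      apply Rmult_le_pos; [apply Rmult_le_pos; [apply pow_le; lra|left; apply Rinv_0_lt_compat, HrN]|apply pow_le; lra]. }
    apply Rle_trans with (Rabs h ^ N * (M / rho ^ N) * (2 * q - 2 * q ^ S P) + Rabs h ^ N * (M / rho ^ N) * q ^ S P); [lra|].
    rewrite <- Rmult_plus_distr_l; apply Rmult_le_compat_l; [exact Hc|].
    assert (Hq1 : 0 <= q ^ S P) by (apply pow_le; lra).
    change (q ^ S (S P)) with (q * q ^ S P); nra. }
eapply Rle_trans; [exact HP|].
rewrite Rmult_assoc; apply Rmult_le_compat_l; [apply pow_le; lra|].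
replace (2 * M / rho ^ S N * Rabs h) with (M / rho ^ N * (2 * q)) by (unfold q; simpl; field; lra).
apply Rmult_le_compat_l; [apply Rmult_le_pos; [lra|left; apply Rinv_0_lt_compat, HrN]|].
assert (0 <= q ^ S P) by (apply pow_le; lra); lra.
Qed.

(** If [a N] were the first nonzero coefficient, it would dominate the series for small negative
    [h], where the sum is 0. So all coefficients vanish, and the function is 0 on the right of [t0]
    too. *)
Lemma real_analytic_zero (f : R -> C) (t0 d : R) : 0 < d -> real_analytic f t0 -> (forall t, t0 - d < t < t0 -> f t = RtoC 0) ->
  exists r, 0 < r /\ forall t, Rabs (t - t0) < r -> f t = RtoC 0.
Proof.
intros Hd [a [r [Hr H]]] Hz.
set (rho := Rmin r d / 2).
assert (Hm : 0 < Rmin r d) by (apply Rmin_glb_lt; assumption).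
assert (Hm1 : Rmin r d <= r) by apply Rmin_l; assert (Hm2 : Rmin r d <= d) by apply Rmin_r.
assert (Hrho : 0 < rho) by (unfold rho; lra).
assert (HL : forall h, - (2 * rho) < h < 0 -> Clim (fun N => Csum (fun j => a j * RtoC (h ^ j))%C N) (RtoC 0)).
{ intros h Hh; unfold rho in Hh; rewrite <- (Hz (t0 + h)) by lra; apply H; rewrite Rabs_left; lra. }
(* The series converges at [h = - rho], so its terms tend to 0 and are bounded. *)
assert (HB : exists M, 0 <= M /\ forall j, Cmod (a j) * rho ^ j <= M).
{ assert (L := HL (- rho) ltac:(lra)).
  assert (L2 : is_lim_seq (fun N => Cmod (a N) * rho ^ N) 0).
  { apply (is_lim_seq_le_le (fun _ => 0) _ (fun N => Cmod (Csum (fun j => a j * RtoC ((- rho) ^ j))%C (S N) - RtoC 0)%C + Cmod (Csum (fun j => a j * RtoC ((- rho) ^ j))%C N - RtoC 0)%C)).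
    - intros N; split; [apply Rmult_le_pos; [apply Cmod_ge_0|apply pow_le; lra]|].
      replace (Cmod (a N) * rho ^ N) with (Cmod (a N * RtoC ((- rho) ^ N))%C).
      + replace (a N * RtoC ((- rho) ^ N))%C with ((Csum (fun j => a j * RtoC ((- rho) ^ j))%C (S N) - RtoC 0) + - (Csum (fun j => a j * RtoC ((- rho) ^ j))%C N - RtoC 0))%C by (simpl; ring).
        eapply Rle_trans; [apply Cmod_triangle|]; rewrite Cmod_opp; lra.
      + rewrite Cmod_mult, Cmod_R, <- RPow_abs, Rabs_Ropp, Rabs_right by lra; reflexivity.
    - apply is_lim_seq_const.
    - assert (L1 := proj1 (is_lim_seq_incr_1 _ _) L).
      assert (S := is_lim_seq_plus' _ _ 0 0 L1 L); rewrite Rplus_0_r in S; exact S. }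
  destruct (proj2 (is_lim_seq_spec _ _) L2 (mkposreal 1 Rlt_0_1)) as [N0 HN0]; cbn [pos] in HN0.
  assert (G : forall Q, exists M, 0 <= M /\ forall j, (j < Q)%nat -> Cmod (a j) * rho ^ j <= M).
  { induction Q as [|Q [M [HM IH]]]; [exists 0; split; [lra|lia]|].
    exists (M + Cmod (a Q) * rho ^ Q).
    assert (0 <= Cmod (a Q) * rho ^ Q) by (apply Rmult_le_pos; [apply Cmod_ge_0|apply pow_le; lra]).
    split; [lra|]; intros j Hj; destruct (Nat.eq_dec j Q) as [->|Hne]; [lra|].
    specialize (IH j ltac:(lia)); lra. }
  destruct (G N0) as [M [HM IH]]; exists (M + 1); split; [lra|]; intros j.
  destruct (Nat.lt_ge_cases j N0) as [Hj|Hj]; [specialize (IH j Hj); lra|].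
  specialize (HN0 j Hj); rewrite Rminus_0_r in HN0; apply Rabs_def2 in HN0; lra. }
destruct HB as [M [HM HB]].
assert (Ha : forall N j, (j < N)%nat -> a j = RtoC 0).
{ induction N as [|N IH]; [lia|]; intros j Hj.
  destruct (Nat.eq_dec j N) as [->|Hne]; [|apply IH; lia].
  apply Cmod_eq_0; apply Rle_antisym; [|apply Cmod_ge_0].
  assert (HN : 0 < rho ^ S N) by (apply pow_lt, Hrho).
  assert (HK : 0 <= 2 * M / rho ^ S N) by (apply Rmult_le_pos; [lra|left; apply Rinv_0_lt_compat, HN]).
  assert (Hsmall : forall e, 0 < e -> e <= rho / 2 -> Cmod (a N) <= 2 * M / rho ^ S N * e).
  { intros e He He2.
    assert (He' : Rabs (- e) = e) by (rewrite Rabs_Ropp, Rabs_right; lra).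
    assert (L := HL (- e) ltac:(lra)).
    assert (HeN : 0 < e ^ N) by (apply pow_lt, He).
    assert (B : Rbar_le (e ^ N * Cmod (a N)) (e ^ N * (2 * M / rho ^ S N * e) + 0)).
    { apply (is_lim_seq_le (fun _ => e ^ N * Cmod (a N)) (fun P => e ^ N * (2 * M / rho ^ S N * e) + Cmod (Csum (fun j => a j * RtoC ((- e) ^ j))%C (P + S N)%nat - RtoC 0)%C)).
      - intros P.
        assert (A := Csum_lead a (- e) rho M N P Hrho ltac:(rewrite He'; exact He2) HM IH HB).
        rewrite He' in A; replace (P + S N)%nat with (S (N + P)) by lia.
        set (X := Csum _ (S (N + P))) in *.
        replace (e ^ N * Cmod (a N)) with (Cmod (a N * RtoC ((- e) ^ N))%C)
          by (rewrite Cmod_mult, Cmod_R, <- RPow_abs, He'; ring).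
        replace (a N * RtoC ((- e) ^ N))%C with (- (X - a N * RtoC ((- e) ^ N)) + (X - RtoC 0))%C by ring.
        eapply Rle_trans; [apply Cmod_triangle|]; rewrite Cmod_opp; lra.
      - apply is_lim_seq_const.
      - apply is_lim_seq_plus'; [apply is_lim_seq_const|].
        exact (Clim_shift _ _ (S N) L). }
    simpl in B; rewrite Rplus_0_r in B; apply Rmult_le_reg_l with (1 := HeN) in B; exact B. }
  apply Rnot_lt_le; intros Hpos.
  set (K := 2 * M / rho ^ S N) in *.
  (* This [e] makes the bound of [Hsmall] at most half of [Cmod (a N)], a contradiction. *)
  set (e := Rmin (rho / 2) (Cmod (a N) / (2 * (K + 1)))).
  assert (He : 0 < e) by (apply Rmin_glb_lt; [lra|apply Rdiv_lt_0_compat; lra]).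
  assert (He2 : e <= Cmod (a N) / (2 * (K + 1))) by apply Rmin_r.
  assert (A := Hsmall e He (Rmin_l _ _)).
  assert (K * e <= K * (Cmod (a N) / (2 * (K + 1)))) by (apply Rmult_le_compat_l; lra).
  assert (K * (Cmod (a N) / (2 * (K + 1))) <= Cmod (a N) / 2).
  { apply Rmult_le_reg_r with (2 * (K + 1)); [lra|].
    replace (K * (Cmod (a N) / (2 * (K + 1))) * (2 * (K + 1))) with (K * Cmod (a N)) by (field; lra). nra. }
  lra. }
exists r; split; [exact Hr|]; intros t Ht.
assert (L := H (t - t0) Ht); replace (t0 + (t - t0)) with t in L by ring.
apply (Clim_unique _ _ _ L).
apply Clim_ext_loc with (2 := Clim_const (RtoC 0)) (N0 := 0%nat); intros N _.
symmetry; induction N as [|N IH]; [reflexivity|]; simpl; rewrite IH, (Ha (S N) N) by lia; ring.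
Qed.

(** If [f] were nonzero somewhere, the points to the left of which [f] vanishes would have a
    supremum, and [real_analytic_zero] would push it further to the right. *)
Lemma identity_theorem (f : R -> C) (T0 : R) : (forall t, real_analytic f t) -> (forall t, t < T0 -> f t = RtoC 0) ->
  forall t, f t = RtoC 0.
Proof.
intros HA Hz t1.
destruct (Ceq_dec (f t1) (RtoC 0)) as [E|Hne]; [exact E|exfalso].
set (E := fun t => forall s, s < t -> f s = RtoC 0).
assert (HE1 : forall t, E t -> t <= t1) by (intros t Ht; apply Rnot_lt_le; intros A; apply Hne, Ht, A).
destruct (completeness E) as [T [HT1 HT2]].
- exists t1; intros t Ht; apply HE1, Ht.
- exists T0; exact Hz.
- assert (HT : forall s, s < T -> f s = RtoC 0).
  { intros s Hs; destruct (Ceq_dec (f s) (RtoC 0)) as [A|A]; [exact A|exfalso].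
    assert (T <= s); [|lra]; apply HT2; intros t Ht; apply Rnot_lt_le; intros B; apply A, Ht, B. }
  destruct (real_analytic_zero f T 1 Rlt_0_1 (HA T)) as [r [Hr H]]; [intros t Ht; apply HT; lra|].
  assert (HTr : E (T + r)).
  { intros s Hs; destruct (Rlt_le_dec s T) as [A|A]; [apply HT, A|].
    apply H; rewrite Rabs_right; lra. }
  specialize (HT1 _ HTr); lra.
Qed.

Lemma W_rec (W : C -> C -> C -> C) (lambda z t : R) : is_whittaker_W W -> 0 < z -> W_defect W lambda z t = RtoC 0.
Proof.
intros HW Hz; revert t; apply identity_theorem with (- / 2); [|intros t Ht; apply W_defect_left; assumption].
intros t; set (l := ell lambda).
assert (HR : forall s, real_analytic (fun u => W (RtoC u) (Ci * RtoC lambda)%C (RtoC z)) s).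
{ intros s; apply (analytic_real_analytic (fun nu => W nu (Ci * RtoC lambda)%C (RtoC z))).
  exact (proj1 (proj2 HW (RtoC s) (Ci * RtoC lambda)%C (RtoC z) (or_introl Hz))). }
apply real_analytic_ext with (fun t => W (RtoC (t + 1)) (Ci * RtoC lambda) (RtoC z)
   + ((- RtoC z + RtoC 2 * RtoC t) * W (RtoC t) (Ci * RtoC lambda) (RtoC z)
   + (- RtoC 1 - l + RtoC 1 * RtoC t) * ((l + RtoC 1 * RtoC t) * W (RtoC (t + - (1))) (Ci * RtoC lambda) (RtoC z))))%C.
- intros s; unfold W_defect; fold l; unfold Rminus; ring.
- apply real_analytic_plus; [apply (real_analytic_shift (fun u => W (RtoC u) (Ci * RtoC lambda)%C (RtoC z))), HR|].
  apply real_analytic_plus; [apply real_analytic_affine, HR|].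
  apply real_analytic_affine, real_analytic_affine, (real_analytic_shift (fun u => W (RtoC u) (Ci * RtoC lambda)%C (RtoC z))), HR.
Qed.

(** The normalization by [rGamma (n - l)] turns the recurrence of [W] into that of [P_coef_rec],
    with [2 / x] in place of [2 / sinh2tau x]. *)
Lemma W_term_rec (W : C -> C -> C -> C) (lambda n m x : R) : is_whittaker_W W -> 0 < m -> 0 < x ->
  let l := ell lambda in
  ((RtoC n - l) * W_term W lambda (n + 1) m x =
   RtoC (2 / x * (m - n * x)) * W_term W lambda n m x - (RtoC n + l) * W_term W lambda (n - 1) m x)%C.
Proof.
intros HW Hm Hx l.
assert (Hz : 0 < 2 * m / x) by (apply Rdiv_lt_0_compat; lra).
assert (R := W_rec W lambda (2 * m / x) n HW Hz); unfold W_defect in R; fold l in R.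
unfold W_term; fold l.
rewrite RtoC_plus, RtoC_minus in *.
assert (G1 := rGamma_S (RtoC n - l)%C); assert (G2 := rGamma_S (RtoC n - RtoC 1 - l)%C).
replace (RtoC n - RtoC 1 - l + RtoC 1)%C with (RtoC n - l)%C in G2 by ring.
replace (RtoC n + RtoC 1 - l)%C with (RtoC n - l + RtoC 1)%C by ring.
rewrite G2, G1.
replace (RtoC (2 / x * (m - n * x))) with (RtoC (2 * m / x) - RtoC 2 * RtoC n)%C
  by (rewrite <- RtoC_mult, <- RtoC_minus; f_equal; field; lra).
set (w1 := W (RtoC n + RtoC 1)%C _ _) in *; set (w0 := W (RtoC n) _ _) in *; set (wm := W (RtoC n - RtoC 1)%C _ _) in *.
set (g := rGamma (RtoC n - l + RtoC 1)); set (p := rcpow m (- (l + RtoC 1))).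
replace ((RtoC n - l) * (p * (g * w1)))%C with
  (p * g * (RtoC n - l) * ((w1 - (RtoC (2 * m / x) - RtoC 2 * RtoC n) * w0 + (RtoC n - RtoC 1 - l) * (RtoC n + l) * wm) + (RtoC (2 * m / x) - RtoC 2 * RtoC n) * w0 - (RtoC n - RtoC 1 - l) * (RtoC n + l) * wm))%C by ring.
rewrite R; ring.
Qed.

(** * Induction on [n] *)

(** Each of the two linear factors takes a quarter of the rate [c]; [y e^(- c y / 4) <= 4 / c]
    explains the constant [E]. *)
Lemma quad_absorb (B c : R) : 0 <= B -> 0 < c ->
  exists K, 0 < K /\ forall y, 0 < y -> (y + B + 1) ^ 2 * exp (- (c * y)) <= K * exp (- (c / 2 * y)).
Proof.
intros HB Hc; set (E := B + 1 + 4 / c).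
assert (H4 : 0 < 4 / c) by (apply Rdiv_lt_0_compat; lra).
exists (E ^ 2); split; [apply pow_lt; unfold E; lra|]; intros y Hy.
replace (exp (- (c * y))) with (exp (- (c / 2 * y)) * exp (- (c / 4 * y)) * exp (- (c / 4 * y)))
  by (rewrite <- !exp_plus; f_equal; field).
assert (H1 : (y + B + 1) * exp (- (c / 4 * y)) <= E).
{ rewrite exp_Ropp; apply Rmult_le_reg_r with (exp (c / 4 * y)); [apply exp_pos|].
  rewrite Rmult_assoc, Rinv_l, Rmult_1_r by (apply Rgt_not_eq, exp_pos).
  apply Rle_trans with (E * (1 + c / 4 * y)).
  - unfold E; replace ((B + 1 + 4 / c) * (1 + c / 4 * y)) with (B + 1 + 4 / c + (B + 1) * (c / 4 * y) + y) by (field; lra).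
    assert (0 <= (B + 1) * (c / 4 * y)) by (repeat apply Rmult_le_pos; lra); lra.
  - apply Rmult_le_compat_l; [unfold E; lra|apply exp_ineq1_le]. }
set (p := exp (- (c / 2 * y))); set (q := exp (- (c / 4 * y))) in *.
assert (Hp : 0 < p) by apply exp_pos; assert (Hq : 0 < q) by apply exp_pos.
replace ((y + B + 1) ^ 2 * (p * q * q)) with (((y + B + 1) * q) ^ 2 * p) by ring.
apply Rmult_le_compat_r; [lra|]; apply pow_incr; split; [apply Rmult_le_pos; lra|exact H1].
Qed.

Lemma exp_rate (c c' y : R) : c' <= c -> 0 < y -> exp (- (c * y)) <= exp (- (c' * y)).
Proof. intros H Hy; apply exp_le; nra. Qed.

(** The coefficient [2 (m / x - n)] of the recurrence is absorbed by half of the decay, and the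
    division by [n - l] is the reason for the nonvanishing hypothesis. *)
Lemma t_bound_step (W : C -> C -> C -> C) (lambda n : R) : is_whittaker_W W ->
  (RtoC n - ell lambda <> RtoC 0)%C -> t_bound W lambda n -> t_bound W lambda (n - 1) -> t_bound W lambda (n + 1).
Proof.
intros HW Hne [K1 [c1 [HK1 [Hc1 H1]]]] [K2 [c2 [HK2 [Hc2 H2]]]].
set (c := Rmin c1 c2); assert (Hc : 0 < c) by (apply Rmin_pos; assumption).
destruct (quad_absorb (Rabs n) c (Rabs_pos n) Hc) as [K3 [HK3 H3]].
set (l := ell lambda) in *.
set (d := Cmod (RtoC n - l)%C); assert (Hd : 0 < d) by (apply Cmod_gt_0, Hne).
set (b := Cmod (RtoC n + l)%C); assert (Hb : 0 <= b) by apply Cmod_ge_0.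
exists ((2 * K1 + b * K2) * K3 / d), (c / 2).
assert (HbK : 0 <= b * K2) by (apply Rmult_le_pos; lra).
split; [apply Rdiv_lt_0_compat; [apply Rmult_lt_0_compat; lra|exact Hd]|]; split; [lra|].
intros m x Hm Hx; set (y := m / x); assert (Hy : 0 < y) by (apply Rdiv_lt_0_compat; lra).
specialize (H1 m x Hm Hx); specialize (H2 m x Hm Hx); fold y in H1, H2.
assert (R := W_term_rec W lambda n m x HW Hm ltac:(lra)); cbv zeta in R; fold l in R.
replace (2 / x * (m - n * x)) with (2 * (y - n)) in R by (unfold y; field; lra).
set (s := sqrt (/ x)) in *; assert (Hs : 0 <= s) by apply sqrt_pos.
set (T := W_term W lambda n m x) in *; set (Tm := W_term W lambda (n - 1) m x) in *; set (Tp := W_term W lambda (n + 1) m x) in *.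
assert (N : d * Cmod Tp <= 2 * (y + Rabs n) * Cmod T + b * Cmod Tm).
{ unfold d; rewrite <- Cmod_mult, R; eapply Rle_trans; [apply Cmod_triangle|].
  rewrite Cmod_opp, !Cmod_mult, Cmod_R; fold b; apply Rplus_le_compat_r, Rmult_le_compat_r; [apply Cmod_ge_0|].
  rewrite Rabs_mult, (Rabs_right 2) by lra; apply Rmult_le_compat_l; [lra|].
  eapply Rle_trans; [apply Rabs_triang|]; rewrite Rabs_Ropp, (Rabs_right y) by lra; lra. }
assert (E1 := exp_rate c1 c y (Rmin_l _ _) Hy); assert (E2 := exp_rate c2 c y (Rmin_r _ _) Hy).
specialize (H3 y Hy).
set (X := exp (- (c * y))) in *; assert (HX : 0 < X) by apply exp_pos.
assert (HA := Rabs_pos n).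
assert (F1 : y * Cmod T <= K1 * (s * X)) by (eapply Rle_trans; [exact H1|]; apply Rmult_le_compat_l; [lra|]; apply Rmult_le_compat_l; lra).
assert (F2 : y * Cmod Tm <= K2 * (s * X)) by (eapply Rle_trans; [exact H2|]; apply Rmult_le_compat_l; [lra|]; apply Rmult_le_compat_l; lra).
assert (HsX : 0 <= s * X) by (apply Rmult_le_pos; lra).
apply Rmult_le_reg_l with d; [exact Hd|].
apply Rle_trans with (2 * (y + Rabs n) * (y * Cmod T) + b * (y * Cmod Tm)); [nra|].
apply Rle_trans with (2 * (y + Rabs n) * (K1 * (s * X)) + b * (K2 * (s * X))).
{ apply Rplus_le_compat; apply Rmult_le_compat_l; lra. }
apply Rle_trans with ((2 * K1 + b * K2) * s * ((y + Rabs n + 1) ^ 2 * X)).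
- assert (G1 : y + Rabs n <= (y + Rabs n + 1) ^ 2) by nra. assert (G2 : 1 <= (y + Rabs n + 1) ^ 2) by nra.
  replace (2 * (y + Rabs n) * (K1 * (s * X)) + b * (K2 * (s * X))) with (2 * K1 * (s * X) * (y + Rabs n) + b * K2 * (s * X) * 1) by ring.
  replace ((2 * K1 + b * K2) * s * ((y + Rabs n + 1) ^ 2 * X)) with (2 * K1 * (s * X) * (y + Rabs n + 1) ^ 2 + b * K2 * (s * X) * (y + Rabs n + 1) ^ 2) by ring.
  apply Rplus_le_compat; apply Rmult_le_compat_l; auto; apply Rmult_le_pos; lra.
- apply Rle_trans with ((2 * K1 + b * K2) * s * (K3 * exp (- (c / 2 * y)))).
  + apply Rmult_le_compat_l; [apply Rmult_le_pos; lra|exact H3].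
  + right; field; lra.
Qed.

(** The relative discrepancy of the two recurrences. With [S = sinh2tau x] it equals
    [1 / (S (x + S))], because [x^2 - S^2 = 1]. *)
Lemma x_over_sinh2tau (x : R) : 2 <= x -> 0 <= x / sinh2tau x - 1 <= 2 * (/ x) ^ 2 /\ 0 < sinh2tau x.
Proof.
intros Hx; assert (HS := sinh2tau_sq x ltac:(lra)); assert (HS0 := sinh2tau_pos x); assert (Hlt := sinh2tau_lt x ltac:(lra)).
assert (HSp : 0 < sinh2tau x) by nra.
split; [|exact HSp]; split.
- apply Rmult_le_reg_r with (sinh2tau x); [exact HSp|]; rewrite Rmult_minus_distr_r; unfold Rdiv; rewrite Rmult_assoc, Rinv_l by lra; lra.
- replace (x / sinh2tau x - 1) with (/ (sinh2tau x * (x + sinh2tau x))).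
  + replace (2 * (/ x) ^ 2) with (/ (x * x / 2)) by (field; lra).
    apply Rinv_le_contravar; [nra|]; nra.
  + rewrite <- (Rmult_1_l (/ (sinh2tau x * (x + sinh2tau x)))).
    replace 1 with ((x - sinh2tau x) * (x + sinh2tau x)) at 1 by (replace ((x - sinh2tau x) * (x + sinh2tau x)) with (x ^ 2 - sinh2tau x * sinh2tau x) by ring; rewrite HS; ring).
    field; lra.
Qed.

(** Subtraction of the two recurrences. The discrepancy multiplies [W_term] by [O (x^-2)]; under the
    weight [m^2] this becomes [(m / x)^2], of which one factor goes to [t_bound] and the other to
    the exponential. *)
Lemma diff_bound_step (W : C -> C -> C -> C) (lambda n : R) : is_whittaker_W W ->
  (RtoC n - ell lambda <> RtoC 0)%C -> t_bound W lambda n ->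
  diff_bound W lambda n -> diff_bound W lambda (n - 1) -> diff_bound W lambda (n + 1).
Proof.
intros HW Hne [K0 [c0 [HK0 [Hc0 H0]]]] [K1 [c1 [HK1 [Hc1 H1]]]] [K2 [c2 [HK2 [Hc2 H2]]]].
set (c := Rmin c0 (Rmin c1 c2)); assert (Hc : 0 < c) by (repeat apply Rmin_pos; assumption).
destruct (quad_absorb (Rabs n) c (Rabs_pos n) Hc) as [K3 [HK3 H3]].
set (l := ell lambda) in *.
set (d := Cmod (RtoC n - l)%C); assert (Hd : 0 < d) by (apply Cmod_gt_0, Hne).
set (b := Cmod (RtoC n + l)%C); assert (Hb : 0 <= b) by apply Cmod_ge_0.
exists ((4 * K1 + 4 * K0 + b * K2) * K3 / d), (c / 2).
assert (HbK : 0 <= b * K2) by (apply Rmult_le_pos; lra).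
split; [apply Rdiv_lt_0_compat; [apply Rmult_lt_0_compat; lra|exact Hd]|]; split; [lra|].
intros k x Hm Hx.
(* Lowering [n] by one while raising the index by one leaves [m], and hence the argument of [W],
   unchanged. *)
assert (Em : n + 1 + INR k = n + INR (S k)) by (rewrite S_INR; ring).
assert (Em' : n - 1 + INR (S (S k)) = n + INR (S k)) by (rewrite !S_INR; ring).
specialize (H1 (S k) x); specialize (H2 (S (S k)) x); rewrite Em' in H2; rewrite Em in *.
set (m := n + INR (S k)) in *; specialize (H1 Hm Hx); specialize (H2 Hm Hx); specialize (H0 m x Hm ltac:(lra)).
set (y := m / x) in *; assert (Hy : 0 < y) by (apply Rdiv_lt_0_compat; lra).
assert (R := W_term_rec W lambda n m x HW Hm ltac:(lra)); cbv zeta in R; fold l in R.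
assert (Q := P_coef_rec l n k x ltac:(lra)); fold m in Q.
destruct (x_over_sinh2tau x Hx) as [Hxs HSp].
set (s := sqrt (/ x)) in *; assert (Hs : 0 <= s) by apply sqrt_pos.
set (T := W_term W lambda n m x) in *; set (Tm := W_term W lambda (n - 1) m x) in *; set (Tp := W_term W lambda (n + 1) m x) in *.
set (Q0 := P_coef l n (S k) x) in *; set (Qp := P_coef l (n + 1) k x) in *; set (Qm := P_coef l (n - 1) (S (S k)) x) in *.
set (g := x / sinh2tau x) in *.
assert (HSC : RtoC (sinh2tau x / 2) <> RtoC 0) by (apply RtoC_neq_0; lra).
assert (Q' : ((RtoC n - l) * Qp = RtoC (2 * g * (y - n)) * Q0 - (RtoC n + l) * Qm)%C).
{ replace ((RtoC n - l) * Qp)%C with (/ RtoC (sinh2tau x / 2) * (RtoC (sinh2tau x / 2) * ((RtoC n - l) * Qp + (RtoC n + l) * Qm)) - (RtoC n + l) * Qm)%C by (field; exact HSC).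
  rewrite Q, <- RtoC_inv by lra.
  replace (RtoC (2 * g * (y - n))) with (RtoC (/ (sinh2tau x / 2)) * RtoC (m - n * x))%C
    by (rewrite <- RtoC_mult; f_equal; unfold g, y; field; lra). ring. }
replace (2 / x * (m - n * x)) with (2 * (y - n)) in R by (unfold y; field; lra).
assert (HA := Rabs_pos n).
assert (Hyn : Rabs (y - n) <= y + Rabs n).
{ eapply Rle_trans; [apply Rabs_triang|]; rewrite Rabs_Ropp, (Rabs_right y) by lra; lra. }
assert (Hix : (/ x) ^ 2 <= / 4) by (replace (/ 4) with ((/ 2) ^ 2) by field; apply pow_incr; split; [left; apply Rinv_0_lt_compat; lra|apply Rinv_le_contravar; lra]).
(* [g Q0 - T] is split into [g (Q0 - T)] and [(g - 1) T]; for [x >= 2], [g <= 3/2] and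
   [g - 1 <= 2 x^-2] give the two constants 4. *)
assert (N : d * Cmod (Qp - Tp)%C <= 4 * (y + Rabs n) * Cmod (Q0 - T)%C + (4 * (/ x) ^ 2 * (y + Rabs n) * Cmod T + b * Cmod (Qm - Tm)%C)).
{ unfold d; rewrite <- Cmod_mult.
  replace ((RtoC n - l) * (Qp - Tp))%C with ((RtoC n - l) * Qp - (RtoC n - l) * Tp)%C by ring.
  rewrite Q', R.
  replace (RtoC (2 * g * (y - n)) * Q0 - (RtoC n + l) * Qm - (RtoC (2 * (y - n)) * T - (RtoC n + l) * Tm))%C
    with (RtoC (2 * g * (y - n)) * (Q0 - T) + (RtoC (2 * (g - 1) * (y - n)) * T + - ((RtoC n + l) * (Qm - Tm))))%C
    by (rewrite !RtoC_mult, !RtoC_minus; ring).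
  eapply Rle_trans; [apply Cmod_triangle|]; eapply Rle_trans; [apply Rplus_le_compat_l, Cmod_triangle|].
  rewrite Cmod_opp, !Cmod_mult, !Cmod_R, !Rabs_mult, (Rabs_right 2), (Rabs_right g), (Rabs_right (g - 1)) by lra; fold b.
  apply Rplus_le_compat; [|apply Rplus_le_compat_r]; (apply Rmult_le_compat_r; [apply Cmod_ge_0|]).
  - assert (0 <= Rabs (y - n)) by apply Rabs_pos. nra.
  - apply Rmult_le_compat; [lra|apply Rabs_pos|lra|exact Hyn]. }
assert (E0 := exp_rate c0 c y (Rmin_l _ _) Hy).
assert (E1 := exp_rate c1 c y (Rle_trans _ _ _ (Rmin_r _ _) (Rmin_l _ _)) Hy).
assert (E2 := exp_rate c2 c y (Rle_trans _ _ _ (Rmin_r _ _) (Rmin_r _ _)) Hy).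
specialize (H3 y Hy).
set (X := exp (- (c * y))) in *; assert (HX : 0 < X) by apply exp_pos.
assert (F0 : y * Cmod T <= K0 * (s * X)) by (eapply Rle_trans; [exact H0|]; apply Rmult_le_compat_l; [lra|]; apply Rmult_le_compat_l; lra).
assert (F1 : m ^ 2 * Cmod (Q0 - T)%C <= K1 * (s * X)) by (eapply Rle_trans; [exact H1|]; apply Rmult_le_compat_l; [lra|]; apply Rmult_le_compat_l; lra).
assert (F2 : m ^ 2 * Cmod (Qm - Tm)%C <= K2 * (s * X)) by (eapply Rle_trans; [exact H2|]; apply Rmult_le_compat_l; [lra|]; apply Rmult_le_compat_l; lra).
assert (HsX : 0 <= s * X) by (apply Rmult_le_pos; lra).
assert (Hm2 : 0 <= m ^ 2) by apply pow2_ge_0.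
apply Rmult_le_reg_l with d; [exact Hd|]; fold l; fold Qp.
apply Rle_trans with (4 * (y + Rabs n) * (m ^ 2 * Cmod (Q0 - T)%C) + (4 * (y * (y + Rabs n)) * (y * Cmod T) + b * (m ^ 2 * Cmod (Qm - Tm)%C))).
{ assert (Ey : m ^ 2 * (/ x) ^ 2 = y * y) by (unfold y; field; lra).
  apply Rmult_le_compat_l with (r := m ^ 2) in N; [|exact Hm2].
  replace (d * (m ^ 2 * Cmod (Qp - Tp)%C)) with (m ^ 2 * (d * Cmod (Qp - Tp)%C)) by ring.
  eapply Rle_trans; [exact N|]; right.
  transitivity (4 * (y + Rabs n) * (m ^ 2 * Cmod (Q0 - T)%C) + (4 * (m ^ 2 * (/ x) ^ 2) * (y + Rabs n) * Cmod T + b * (m ^ 2 * Cmod (Qm - Tm)%C))); [ring|].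
  rewrite Ey; ring. }
apply Rle_trans with (4 * (y + Rabs n) * (K1 * (s * X)) + (4 * (y * (y + Rabs n)) * (K0 * (s * X)) + b * (K2 * (s * X)))).
{ apply Rplus_le_compat; [|apply Rplus_le_compat]; apply Rmult_le_compat_l; try lra; try assumption.
  apply Rmult_le_pos; [lra|]; apply Rmult_le_pos; lra. }
apply Rle_trans with ((4 * K1 + 4 * K0 + b * K2) * s * ((y + Rabs n + 1) ^ 2 * X)).
- set (Y := (y + Rabs n + 1) ^ 2).
  assert (G1 : y + Rabs n <= Y) by (unfold Y; nra). assert (G2 : 1 <= Y) by (unfold Y; nra).
  assert (G3 : y * (y + Rabs n) <= Y) by (unfold Y; nra).
  replace (4 * (y + Rabs n) * (K1 * (s * X)) + (4 * (y * (y + Rabs n)) * (K0 * (s * X)) + b * (K2 * (s * X))))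
    with (4 * K1 * (s * X) * (y + Rabs n) + (4 * K0 * (s * X) * (y * (y + Rabs n)) + b * K2 * (s * X) * 1)) by ring.
  replace ((4 * K1 + 4 * K0 + b * K2) * s * (Y * X)) with (4 * K1 * (s * X) * Y + (4 * K0 * (s * X) * Y + b * K2 * (s * X) * Y)) by ring.
  apply Rplus_le_compat; [|apply Rplus_le_compat]; apply Rmult_le_compat_l; auto; apply Rmult_le_pos; lra.
- apply Rle_trans with ((4 * K1 + 4 * K0 + b * K2) * s * (K3 * exp (- (c / 2 * y)))).
  + apply Rmult_le_compat_l; [apply Rmult_le_pos; lra|exact H3].
  + right; field; lra.
Qed.

(** * The exceptional case [lambda = 0], [n = 1/2] *)

(** [Gamma(1)^2 = B(1, 1) = 1]. The square suffices: in [W_half] one factor comes from the left-hand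
    side and one from the integral formula for [W]. *)
Lemma rGamma_1_sq : (rGamma (RtoC 1) * rGamma (RtoC 1) = RtoC 1)%C.
Proof.
assert (B := Beta_Gamma (RtoC 0) 1 ltac:(rewrite Re_RtoC; lra) ltac:(simpl INR; rewrite Re_minus, !Re_RtoC; lra)).
assert (B1 := Beta_int_1 (RtoC 0) ltac:(rewrite Re_RtoC; lra)).
change (INR (fact 1)) with 1 in B; change (INR 1) with 1 in B.
replace (RtoC 1 - RtoC 0)%C with (RtoC 1) in B by ring; replace (RtoC 0 + RtoC 1)%C with (RtoC 1) in * by ring.
rewrite B1 in B.
assert (G := rGamma_eq (RtoC 1) 0 ltac:(simpl INR; rewrite Re_plus, !Re_RtoC; lra)).
simpl in G; replace (RtoC 1 + RtoC 0)%C with (RtoC 1) in G by ring.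
assert (N := Gamma_neq_0 (RtoC 1) ltac:(rewrite Re_RtoC; lra)).
rewrite G; transitivity (RtoC 1 / (Gamma_Euler (RtoC 1) * Gamma_Euler (RtoC 1)))%C; [field; exact N|].
rewrite <- B; field; apply RtoC_neq_0; lra.
Qed.

(* The exceptional case [l = -1/2], [n = 1/2], where the recurrence from [n = -1/2] degenerates. *)
Lemma W_half (W : C -> C -> C -> C) (z : R) : is_whittaker_W W -> 0 < z ->
  (rGamma (RtoC 1) * W (RtoC (/ 2)) (Ci * RtoC 0) (RtoC z) = rcpow z (RtoC (/ 2)) * RtoC (exp (- (z / 2))))%C.
Proof.
intros HW Hz; set (l := ell 0).
assert (El : l = RtoC (- / 2)) by (unfold l, ell; ring).
assert (HJ : forall n, n < / 2 -> exists J, is_CInt_pos (mehler_lin l n (z / 2) (/ 1)) J).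
{ intros n Hn; destruct (is_CInt_pos_mehler_lin l n (Re_ell 0) Hn) as [C0 [_ H]].
  destruct (H (z / 2) (/ 1)) as [J [HJ _]]; [lra|lra|exists J; exact HJ]. }
destruct (HJ (- / 2) ltac:(lra)) as [J0 HJ0]; destruct (HJ (- / 2 - 1) ltac:(lra)) as [Jm HJm].
assert (R := W_rec W 0 z (- / 2) HW Hz); unfold W_defect in R; fold l in R.
replace (- / 2 + 1) with (/ 2) in R by field.
assert (Ez : RtoC z = RtoC (2 * (z / 2) / 1)) by (f_equal; field).
assert (W0 := W_mehler_lin W 0 (- / 2) (z / 2) 1 J0 HW ltac:(lra) ltac:(lra) ltac:(lra) HJ0).
assert (Wm := W_mehler_lin W 0 (- / 2 - 1) (z / 2) 1 Jm HW ltac:(lra) ltac:(lra) ltac:(lra) HJm).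
rewrite <- Ez in W0, Wm; fold l in W0, Wm.
replace (2 * (z / 2)) with z in W0, Wm by field.
rewrite W0, Wm in R.
(* [W] at [1/2] is obtained from the parameters [-1/2] and [-3/2]. For [n = -1/2] the integrand is
   [e^(- z (2 u + 1) / 2) / (u + 1)], and the combination required by the recurrence is the
   derivative of minus this function. *)
assert (HZ : (RtoC (z + 1) * J0 - Jm = RtoC (exp (- (z / 2))))%C).
{ apply (is_CInt_pos_det _ _ _ (is_CInt_pos_minus _ _ _ _ (is_CInt_pos_scal (RtoC (z + 1)) _ _ HJ0) HJm)).
  rewrite Rinv_1 in *.
  set (F := fun u => RtoC (- exp (- (z / 2 * (2 * u + 1))) / (u + 1))).
  assert (HF : forall u, 0 < u -> mehler_lin l (- / 2) (z / 2) 1 u = RtoC (exp (- (z / 2 * (2 * u + 1))) / (u + 1))).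
  { intros u Hu; unfold mehler_lin; rewrite El, ln_1.
    replace (- RtoC (z / 2 * (2 * u + 1)) + (RtoC (- / 2) - RtoC (- / 2)) * RtoC (ln u) + (RtoC (- / 2) + RtoC (- / 2)) * RtoC (ln (u + 1)) - RtoC (- / 2) * RtoC 0)%C
      with (RtoC (- (z / 2 * (2 * u + 1)) + - ln (u + 1))).
    - rewrite Cexp_real, exp_plus, (exp_Ropp (ln (u + 1))), exp_ln by lra; reflexivity.
    - rewrite RtoC_plus, !RtoC_opp.
      assert (E2 : (RtoC (/ 2) + RtoC (/ 2) = RtoC 1)%C) by (rewrite <- RtoC_plus; f_equal; field).
      transitivity (- RtoC (z / 2 * (2 * u + 1)) - (RtoC (/ 2) + RtoC (/ 2)) * RtoC (ln (u + 1)))%C; [rewrite E2; ring|ring]. }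
  replace (RtoC (exp (- (z / 2)))) with (RtoC 0 - RtoC (- exp (- (z / 2))))%C by (rewrite <- RtoC_minus; f_equal; ring).
  apply (is_CInt_pos_FTC F).
  - intros u Hu; rewrite (mehler_lin_down l (- / 2) (z / 2) u Hu), HF by exact Hu.
    eapply Cder_eq.
    + apply (Cder_RtoC (fun u => - exp (- (z / 2 * (2 * u + 1))) / (u + 1)) u
        ((z + / (u + 1)) * (exp (- (z / 2 * (2 * u + 1))) / (u + 1)))).
      auto_derive; [lra|]; field; lra.
    + rewrite <- !RtoC_mult, <- RtoC_minus; f_equal; field; lra.
  - intros u Hu; apply Ccont_ext_loc with (fun u => RtoC (z + 1) * mehler_lin l (- / 2) (z / 2) 1 u + RtoC (-1) * mehler_lin l (- / 2 - 1) (z / 2) 1 u)%C.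
    + apply filter_forall; intros; ring.
    + apply Ccont_plus; (apply Ccont_mult; [apply Ccont_const|apply Ccont_mehler_lin; lra]).
  - apply (lim_Rpower_0 _ (z + 1) 1); try lra.
    intros u Hu; rewrite Rpower_1 by lra; unfold F; rewrite <- RtoC_minus, Cmod_R.
    replace (- exp (- (z / 2 * (2 * u + 1))) / (u + 1) - - exp (- (z / 2))) with (exp (- (z / 2)) * (1 - exp (- (z * u)) / (u + 1))).
    2: { replace (- (z / 2 * (2 * u + 1))) with (- (z / 2) + - (z * u)) by field; rewrite exp_plus; field; lra. }
    assert (A1 : 0 < exp (- (z / 2)) < 1) by (apply exp_neg_lt_1; lra).
    assert (A2 : 0 < exp (- (z * u)) < 1) by (apply exp_neg_lt_1; nra).
    assert (A3 : exp (- (z * u)) / (u + 1) <= 1).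
    { apply Rmult_le_reg_r with (u + 1); [lra|]; unfold Rdiv; rewrite Rmult_assoc, Rinv_l by lra; lra. }
    assert (A4 : 1 - (z + 1) * u <= exp (- (z * u)) / (u + 1)).
    { apply Rle_trans with (exp (- ((z + 1) * u))); [generalize (exp_ineq1_le (- ((z + 1) * u))); lra|].
      replace (- ((z + 1) * u)) with (- (z * u) + - u) by ring; rewrite exp_plus; apply Rmult_le_compat_l; [lra|].
      rewrite exp_Ropp; apply Rinv_le_contravar; [lra|]; generalize (exp_ineq1_le u); lra. }
    rewrite Rabs_right by (apply Rle_ge, Rmult_le_pos; lra). nra.
  - apply (lim_exp_infty _ 1 z Hz); [lra|].
    intros u Hu; unfold F; replace (RtoC (- exp (- (z / 2 * (2 * u + 1))) / (u + 1)) - RtoC 0)%C with (RtoC (- exp (- (z / 2 * (2 * u + 1))) / (u + 1))) by ring.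
    rewrite Cmod_R; replace (- exp (- (z / 2 * (2 * u + 1))) / (u + 1)) with (- (exp (- (z / 2 * (2 * u + 1))) * / (u + 1))) by (field; lra).
    assert (A1 : 0 < exp (- (z / 2 * (2 * u + 1)))) by apply exp_pos.
    assert (A2 : / (u + 1) <= 1) by (rewrite <- Rinv_1; apply Rinv_le_contravar; lra).
    assert (A3 : 0 < / (u + 1)) by (apply Rinv_0_lt_compat; lra).
    assert (A4 : exp (- (z / 2 * (2 * u + 1))) <= exp (- (z * u))) by (apply exp_le; nra).
    rewrite Rabs_Ropp, Rabs_right by (apply Rle_ge, Rmult_le_pos; lra). nra. }
assert (G := rGamma_S (RtoC 1)); rewrite Cmult_1_l in G.
assert (S := rGamma_1_sq).
assert (A0 : (l - RtoC (- / 2) + RtoC 1 = RtoC 1)%C) by (rewrite El; ring).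
assert (Am : (l - RtoC (- / 2 - 1) + RtoC 1 = RtoC 1 + RtoC 1)%C) by (rewrite El, RtoC_minus; ring).
assert (A2 : (l + RtoC 1 = RtoC (/ 2))%C) by (rewrite El, <- RtoC_plus; f_equal; field).
rewrite A0, Am, A2, <- G in R.
set (g := rGamma (RtoC 1)) in *; set (w := W (RtoC (/ 2)) _ _) in *; set (p := rcpow z (RtoC (/ 2))) in *.
assert (A3 : (RtoC 2 * RtoC (- / 2) = - RtoC 1)%C) by (rewrite <- RtoC_mult, <- RtoC_opp; f_equal; field).
assert (A4 : ((RtoC (- / 2) - RtoC 1 - l) * (RtoC (- / 2) + l) = RtoC 1)%C).
{ rewrite El; rewrite <- RtoC_minus, <- RtoC_minus, <- RtoC_plus, <- RtoC_mult; f_equal; field. }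
rewrite A3, A4 in R.
assert (Ew : w = (g * p * (RtoC (z + 1) * J0 - Jm))%C).
{ replace w with ((w - (RtoC z - - RtoC 1) * (g * (p * J0)) + RtoC 1 * (g * (p * Jm))) + g * p * ((RtoC z + RtoC 1) * J0 - Jm))%C by ring.
  rewrite R, RtoC_plus; ring. }
rewrite Ew, HZ.
replace (g * (g * p * RtoC (exp (- (z / 2)))))%C with (g * g * (p * RtoC (exp (- (z / 2)))))%C by ring.
rewrite S; ring.
Qed.

Lemma W_term_half (W : C -> C -> C -> C) (m x : R) : is_whittaker_W W -> 0 < m -> 0 < x ->
  W_term W 0 (/ 2) m x = Cexp (RtoC (/ 2 * ln 2 + / 2 * ln (/ x) - m * / x)).
Proof.
intros HW Hm Hx; unfold W_term.
assert (Hix : 0 < / x) by (apply Rinv_0_lt_compat, Hx).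
assert (E1 : (RtoC (/ 2) - ell 0 = RtoC 1)%C).
{ unfold ell; replace (RtoC (/ 2) - (RtoC (- / 2) + Ci * RtoC 0))%C with (RtoC (/ 2) - RtoC (- / 2))%C by ring.
  rewrite <- RtoC_minus; f_equal; field. }
assert (E2 : (ell 0 + RtoC 1 = RtoC (/ 2))%C).
{ unfold ell; replace (RtoC (- / 2) + Ci * RtoC 0 + RtoC 1)%C with (RtoC (- / 2) + RtoC 1)%C by ring.
  rewrite <- RtoC_plus; f_equal; field. }
rewrite E1, E2, (W_half W (2 * m / x) HW) by (apply Rdiv_lt_0_compat; lra).
unfold rcpow; rewrite <- Cexp_real, <- !Cexp_plus; f_equal.
assert (L : ln (2 * m / x) = ln 2 + ln m + ln (/ x)) by (unfold Rdiv; rewrite !ln_mult by lra; ring).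
rewrite L, <- RtoC_opp, <- !RtoC_mult, <- !RtoC_plus; f_equal; field; lra.
Qed.

Lemma binom_coef_zero (j : nat) : binom_coef (RtoC 0) (S j) = RtoC 0.
Proof.
unfold binom_coef; replace (rising (- RtoC 0) (S j)) with (RtoC 0); [unfold Cdiv; ring|].
rewrite rising_shift; ring.
Qed.

Lemma binom_coef_minus_1 (j : nat) : binom_coef (- RtoC 1) j = RtoC 1.
Proof.
unfold binom_coef; replace (- - RtoC 1)%C with (RtoC 1) by ring; rewrite rising_1.
field; apply RtoC_neq_0, INR_fact_neq_0.
Qed.

(** The two exponents [l - n] and [l + n] are -1 and 0, so the series reduces to its first term
    [r^k]; the value is [sqrt (2 sinh s) e^(- m s)], to be compared with
    [sqrt (2 / x) e^(- m / x)]. *)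
Lemma P_coef_half (k : nat) (x : R) : 1 < x ->
  P_coef (ell 0) (/ 2) k x = Cexp (RtoC (/ 2 * ln 2 + / 2 * ln (sinh (- ln (tanh_tau x))) - (/ 2 + INR k) * - ln (tanh_tau x))).
Proof.
intros Hx; destruct (tanh_tau_facts x Hx) as [Hr [Hs L3]].
assert (El : ell 0 = RtoC (- / 2)) by (unfold ell; ring).
assert (H := P_coef_series (ell 0) (/ 2) k x (Rlt_le _ _ Hx)).
assert (E1 : (ell 0 - RtoC (/ 2) = - RtoC 1)%C) by (rewrite El, <- RtoC_minus, <- RtoC_opp; f_equal; field).
assert (E2 : (ell 0 + RtoC (/ 2) = RtoC 0)%C) by (rewrite El, <- RtoC_plus; f_equal; field).
rewrite E1, E2 in H.
assert (E : (rcpow ((x + 1) / 2) (- ell 0) * P_coef (ell 0) (/ 2) k x = RtoC (tanh_tau x ^ k))%C).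
{ apply (Clim_unique _ _ _ H), Clim_ext_loc with (2 := Clim_const _) (N0 := 0%nat); intros N _.
  symmetry; induction N as [|N IH].
  - simpl Csum; rewrite binom_coef_minus_1, binom_coef_0; replace (k + 2 * 0)%nat with k by lia.
    replace (k + 0)%nat with k by lia; ring.
  - match goal with |- Csum ?f (S (S N)) = _ => replace (Csum f (S (S N))) with (Csum f (S N) + f (S N))%C by reflexivity end.
    rewrite IH, binom_coef_zero; ring. }
replace (P_coef (ell 0) (/ 2) k x) with (rcpow ((x + 1) / 2) (ell 0) * (rcpow ((x + 1) / 2) (- ell 0) * P_coef (ell 0) (/ 2) k x))%C
  by (rewrite rcpow_opp; field; apply rcpow_neq_0).
rewrite E, <- Rpower_pow by lra; unfold Rpower, rcpow; rewrite <- Cexp_real, <- Cexp_plus; f_equal.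
rewrite L3, El, <- RtoC_mult, <- RtoC_plus; f_equal; field.
Qed.

Lemma t_bound_half (W : C -> C -> C -> C) : is_whittaker_W W -> t_bound W 0 (/ 2).
Proof.
intros HW; exists (2 * exp (/ 2 * ln 2)), (/ 2); split; [generalize (exp_pos (/ 2 * ln 2)); lra|]; split; [lra|].
intros m x Hm Hx; rewrite (W_term_half W m x HW Hm) by lra.
set (y := m / x); assert (Hy : 0 < y) by (apply Rdiv_lt_0_compat; lra).
assert (Hix : 0 < / x) by (apply Rinv_0_lt_compat; lra).
rewrite Cmod_Cexp, Re_RtoC; change (m * / x) with y.
rewrite <- (Rpower_sqrt (/ x)) by exact Hix; unfold Rpower.
replace (/ 2 * ln 2 + / 2 * ln (/ x) - y) with (/ 2 * ln 2 + (/ 2 * ln (/ x) + (- (/ 2 * y) + - (/ 2 * y)))) by field.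
rewrite !exp_plus.
set (p := exp (/ 2 * ln 2)); set (s := exp (/ 2 * ln (/ x))); set (q := exp (- (/ 2 * y))).
assert (Hp : 0 < p) by apply exp_pos; assert (Hs : 0 < s) by apply exp_pos; assert (Hq : 0 < q) by apply exp_pos.
assert (Hyq : y * q <= 2).
{ unfold q; rewrite exp_Ropp; apply Rmult_le_reg_r with (exp (/ 2 * y)); [apply exp_pos|].
  rewrite Rmult_assoc, Rinv_l by (apply Rgt_not_eq, exp_pos); generalize (exp_ineq1_le (/ 2 * y)); lra. }
replace (y * (p * (s * (q * q)))) with (p * s * q * (y * q)) by ring.
replace (2 * p * (s * q)) with (p * s * q * 2) by ring.
apply Rmult_le_compat_l; [repeat apply Rmult_le_pos; lra|exact Hyq].
Qed.

Lemma diff_bound_half (W : C -> C -> C -> C) : is_whittaker_W W -> diff_bound W 0 (/ 2).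
Proof.
(* The estimates below give [2 * 8 * 20 = 320], rounded up. *)
intros HW; exists (1000 * exp (/ 2 * ln 2 + 1)), (/ 8); split; [generalize (exp_pos (/ 2 * ln 2 + 1)); lra|]; split; [lra|].
intros k x Hm Hx; rewrite (P_coef_half k x) by lra; rewrite (W_term_half W _ x HW Hm) by lra.
set (m := / 2 + INR k) in *.
destruct (sigma_bounds x Hx) as [H1 [H2 H3]]; cbv zeta in *.
set (s := - ln (tanh_tau x)) in *; set (e := / x) in *.
assert (He : 0 < e <= / 2) by (split; [apply Rinv_0_lt_compat; lra|apply Rinv_le_contravar; lra]).
replace (4 / 3 * / x ^ 3) with (4 / 3 * e ^ 3) in H2 by (unfold e; field; lra).
change (m / x) with (m * e); set (y := m * e); assert (Hy : 0 < y) by (apply Rmult_lt_0_compat; lra).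
assert (Hms : 0 <= m * (s - e)) by (apply Rmult_le_pos; lra).
assert (He2 : 0 <= e ^ 2 <= / 4) by (split; nra).
set (M := / 2 * ln 2 + / 2 * ln e - y + 1).
assert (HD : Cmod (Cexp (RtoC (/ 2 * ln 2 + / 2 * ln (sinh s) - m * s)) - Cexp (RtoC (/ 2 * ln 2 + / 2 * ln e - m * e)))%C
  <= 2 * ((e ^ 2 + 2 * m * e ^ 3) * exp M)).
{ eapply Rle_trans; [apply (Cexp_diff _ _ M); rewrite Re_RtoC; unfold M, y; lra|].
  apply Rmult_le_compat_l; [lra|]; apply Rmult_le_compat_r; [left; apply exp_pos|].
  rewrite <- RtoC_minus, Cmod_R.
  replace (/ 2 * ln 2 + / 2 * ln (sinh s) - m * s - (/ 2 * ln 2 + / 2 * ln e - m * e)) with (/ 2 * (ln (sinh s) - ln e) - m * (s - e)) by ring.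
  assert (m * (s - e) <= m * (4 / 3 * e ^ 3)) by (apply Rmult_le_compat_l; lra).
  assert (0 <= m * e ^ 3) by (apply Rmult_le_pos; [lra|apply pow_le; lra]).
  apply Rabs_le; lra. }
apply Rle_trans with (m ^ 2 * (2 * ((e ^ 2 + 2 * m * e ^ 3) * exp M))).
{ apply Rmult_le_compat_l; [apply pow2_ge_0|exact HD]. }
replace (m ^ 2 * (2 * ((e ^ 2 + 2 * m * e ^ 3) * exp M))) with (2 * (y * (y + 2 * y ^ 2)) * exp M) by (unfold y; ring).
rewrite <- (Rpower_sqrt e) by lra; unfold Rpower.
replace M with ((/ 2 * ln 2 + 1) + (/ 2 * ln e + - y)) by (unfold M; ring); rewrite (exp_plus (/ 2 * ln 2 + 1)), (exp_plus (/ 2 * ln e)).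
set (p := exp (/ 2 * ln 2 + 1)); set (r := exp (/ 2 * ln e)).
assert (Hp : 0 < p) by apply exp_pos; assert (Hr : 0 < r) by apply exp_pos.
assert (HQ := quad_le_exp y Hy).
assert (HY : y * exp (- (/ 8 * y)) <= 8).
{ rewrite exp_Ropp; apply Rmult_le_reg_r with (exp (/ 8 * y)); [apply exp_pos|].
  rewrite Rmult_assoc, Rinv_l by (apply Rgt_not_eq, exp_pos); generalize (exp_ineq1_le (/ 8 * y)); lra. }
assert (E : exp (- y) = exp (- (/ 8 * y)) * exp (- (/ 8 * y)) * exp (- (3 / 4 * y))) by (rewrite <- !exp_plus; f_equal; field).
rewrite E; set (q := exp (- (/ 8 * y))) in *; assert (Hq : 0 < q) by apply exp_pos.
set (v := exp (- (3 / 4 * y))); assert (Hv : 0 < v) by apply exp_pos.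
assert (HQv : (y + 2 * y ^ 2) * v <= 20).
{ apply Rle_trans with (2 * (10 * exp (3 / 4 * y)) * v); [apply Rmult_le_compat_r; [lra|nra]|].
  unfold v; rewrite exp_Ropp; right; field; apply Rgt_not_eq, exp_pos. }
replace (2 * (y * (y + 2 * y ^ 2)) * (p * (r * (q * q * v)))) with (2 * p * r * q * ((y * q) * ((y + 2 * y ^ 2) * v))) by ring.
apply Rle_trans with (2 * p * r * q * (8 * 20)).
- apply Rmult_le_compat_l; [repeat apply Rmult_le_pos; lra|].
  apply Rmult_le_compat; [apply Rmult_le_pos; lra|apply Rmult_le_pos; [nra|lra]|exact HY|exact HQv].
- assert (0 < p * (r * q)) by (repeat apply Rmult_lt_0_compat; assumption). nra.
Qed.

(** The induction treats all [n < 1/2 + N] at once, because the step to [n] uses both [n - 1] and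
    [n - 2]. The coefficient [n - 1 - l] vanishes only for [lambda = 0], [n = 1/2]. *)
Lemma bounds_all (W : C -> C -> C -> C) (lambda : R) : is_whittaker_W W ->
  forall (N : nat) (n : R), n < / 2 + INR N -> t_bound W lambda n /\ diff_bound W lambda n.
Proof.
intros HW N; induction N as [|N IH]; intros n Hn.
- simpl in Hn; split; [apply t_bound_base|apply diff_bound_base]; try assumption; lra.
- rewrite S_INR in Hn.
  destruct (Rlt_le_dec n (/ 2)) as [Hb|Hb]; [split; [apply t_bound_base|apply diff_bound_base]; assumption|].
  destruct (IH (n - 1) ltac:(lra)) as [T1 D1]; destruct (IH (n - 1 - 1) ltac:(lra)) as [T2 D2].
  destruct (Ceq_dec (RtoC (n - 1) - ell lambda)%C (RtoC 0)) as [E|E].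
  + assert (E1 := f_equal fst E); assert (E2 := f_equal snd E).
    unfold ell, Ci, RtoC, Cminus, Cplus, Copp, Cmult in E1, E2; cbn [fst snd] in E1, E2.
    assert (lambda = 0) by lra; assert (n = / 2) by lra; subst lambda n.
    split; [apply t_bound_half|apply diff_bound_half]; assumption.
  + replace n with (n - 1 + 1) by ring; split; [apply t_bound_step|apply diff_bound_step]; assumption.
Qed.

(** * The range [1 <= x <= 2] and the conclusion *)

Lemma Clim_bound (u : nat -> C) (l : C) (B : R) : (forall N, Cmod (u N) <= B) -> Clim u l -> Cmod l <= B.
Proof.
intros HB H.
assert (E : Rbar_le (Cmod l) (B + 0)).
{ apply (is_lim_seq_le (fun _ => Cmod l) (fun N => B + Cmod (u N - l)%C)).
  - intros N; replace l with (u N + - (u N - l))%C at 1 by ring.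
    eapply Rle_trans; [apply Cmod_triangle|]; rewrite Cmod_opp; apply Rplus_le_compat_r, HB.
  - apply is_lim_seq_const.
  - apply is_lim_seq_plus'; [apply is_lim_seq_const|exact H]. }
simpl in E; lra.
Qed.

Lemma Csum_geom (f : nat -> C) (K q : R) (N : nat) : 0 <= q <= / 2 -> 0 <= K ->
  (forall j, Cmod (f j) <= K * q ^ j) -> Cmod (Csum f N) <= 2 * K.
Proof.
intros Hq HK Hf.
assert (H : Cmod (Csum f N) <= K * (2 - 2 * q ^ N)).
{ induction N as [|N IH]; [simpl Csum; simpl pow; rewrite Cmod_0; lra|].
  simpl Csum; eapply Rle_trans; [apply Cmod_triangle|].
  assert (Hp : 0 <= q ^ N) by (apply pow_le; lra).
  assert (0 <= K * q ^ N * (1 - 2 * q)) by (repeat apply Rmult_le_pos; lra).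
  specialize (Hf N); simpl pow; lra. }
assert (0 <= q ^ N) by (apply pow_le; lra). nra.
Qed.

(** On [[1, 2]], [r] stays away from 1, so the factor [r^k] in the series beats both the growth of
    the coefficients and the weight [m^2]. *)
Lemma P_coef_small_x (l : C) (n : R) : Re l = - / 2 ->
  exists K, 0 < K /\ forall k x, 1 <= x <= 2 -> (n + INR k) ^ 2 * Cmod (P_coef l n k x) <= K.
Proof.
intros Hl.
(* For [x <= 2], [r^2 <= 1/3] and [r <= 0.6]. The rate 1.2 gives [1.2 * 0.6 = 0.72] in [k], a ratio
   [1.2^2 / 3 = 0.48 <= 1/2] in the summation index, and [1.2 * 0.72 < 1] once the weight is
   included. *)
destruct (binom_coef_bound (l - RtoC n)%C (12 / 10)) as [Ka [HKa Ha]]; [lra|].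
destruct (binom_coef_bound (l + RtoC n)%C (12 / 10)) as [Kb [HKb Hb]]; [lra|].
(* From [j = 10] on, the ratio of consecutive squares is at most [(12 / 11)^2 < 1.2]. *)
destruct (geometric_bound (fun j => (INR j + 1) ^ 2) (12 / 10) 10) as [Kc [HKc Hc]]; [lra|intros; apply pow2_ge_0| |].
{ intros j Hj; apply le_INR in Hj; rewrite S_INR; replace (INR 10) with 10 in Hj by (simpl; ring); nra. }
set (A := Rabs n + 1); assert (HA : 1 <= A) by (unfold A; generalize (Rabs_pos n); lra).
exists (A ^ 2 * Kc * (2 * (Ka * Kb))); split; [repeat apply Rmult_lt_0_compat; lra|].
intros k x Hx.
assert (Hr := tanh_tau_bounds x (proj1 Hx)).
assert (Hr2 : tanh_tau x ^ 2 <= / 3).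
{ unfold tanh_tau; replace ((sinh2tau x / (x + 1)) ^ 2) with (sinh2tau x * sinh2tau x / (x + 1) ^ 2) by (field; lra).
  rewrite (sinh2tau_sq x (proj1 Hx)); apply Rmult_le_reg_r with ((x + 1) ^ 2); [nra|].
  unfold Rdiv; rewrite Rmult_assoc, Rinv_l by nra; nra. }
set (r := tanh_tau x) in *.
assert (Hr1 : r <= 6 / 10) by nra.
assert (Hbc : forall c Kd j, (forall j, INR (S j) * Cmod (binom_coef c j) <= Kd * (12 / 10) ^ j) -> Cmod (binom_coef c j) <= Kd * (12 / 10) ^ j).
{ intros c Kd j H; eapply Rle_trans; [|apply H]; rewrite S_INR; generalize (Cmod_ge_0 (binom_coef c j)) (pos_INR j); intros; nra. }
assert (HS : Cmod (rcpow ((x + 1) / 2) (- l) * P_coef l n k x)%C <= 2 * (Ka * Kb * (72 / 100) ^ k)).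
{ apply (Clim_bound _ _ _) with (2 := P_coef_series l n k x (proj1 Hx)); intros N.
  apply (Csum_geom _ _ (/ 2)); [lra|repeat apply Rmult_le_pos; try lra; apply pow_le; lra|].
  intros j; fold r; rewrite !Cmod_mult, Cmod_R, Rabs_right by (apply Rle_ge, pow_le; lra).
  apply Rle_trans with ((Ka * (12 / 10) ^ (k + j)) * (Kb * (12 / 10) ^ j) * r ^ (k + 2 * j)).
  - apply Rmult_le_compat_r; [apply pow_le; lra|]; apply Rmult_le_compat; try apply Cmod_ge_0; apply Hbc; assumption.
  - rewrite !pow_add, pow_mult.
    replace (Ka * ((12 / 10) ^ k * (12 / 10) ^ j) * (Kb * (12 / 10) ^ j) * (r ^ k * (r ^ 2) ^ j))
      with (Ka * Kb * (((12 / 10) ^ k * r ^ k) * ((12 / 10) ^ j * (12 / 10) ^ j * (r ^ 2) ^ j))) by ring.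
    rewrite <- !Rpow_mult_distr.
    replace (Ka * Kb * (72 / 100) ^ k * (/ 2) ^ j) with (Ka * Kb * ((72 / 100) ^ k * (/ 2) ^ j)) by ring.
    apply Rmult_le_compat_l; [apply Rmult_le_pos; lra|].
    apply Rmult_le_compat; try (apply pow_le; nra); apply pow_incr; split; nra. }
rewrite Cmod_mult, Cmod_rcpow, Re_opp, Hl, Ropp_involutive in HS.
assert (H1 : 1 <= Rpower ((x + 1) / 2) (/ 2)).
{ unfold Rpower; apply Rle_trans with (exp 0); [rewrite exp_0; lra|].
  apply exp_le, Rmult_le_pos; [lra|]; apply Rle_trans with (ln 1); [rewrite ln_1; lra|apply ln_le; lra]. }
assert (HQ : Cmod (P_coef l n k x) <= 2 * (Ka * Kb * (72 / 100) ^ k)) by (generalize (Cmod_ge_0 (P_coef l n k x)); nra).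
specialize (Hc k); cbv beta in Hc.
assert (Hm : (n + INR k) ^ 2 <= A ^ 2 * (INR k + 1) ^ 2).
{ rewrite <- Rpow_mult_distr; apply pow_maj_Rabs; unfold A; eapply Rle_trans; [apply Rabs_triang|].
  rewrite (Rabs_right (INR k)) by (apply Rle_ge, pos_INR); generalize (pos_INR k) (Rabs_pos n); intros; nra. }
assert (Hp : 0 <= (72 / 100) ^ k) by (apply pow_le; lra).
assert (Hpp : (12 / 10) ^ k * (72 / 100) ^ k <= 1).
{ rewrite <- Rpow_mult_distr, <- (pow1 k); apply pow_incr; lra. }
assert (Hp2 : 0 <= (12 / 10) ^ k) by (apply pow_le; lra).
apply Rle_trans with (A ^ 2 * (Kc * (12 / 10) ^ k) * (2 * (Ka * Kb * (72 / 100) ^ k))).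
- apply Rmult_le_compat; [apply pow2_ge_0|apply Cmod_ge_0| |exact HQ].
  eapply Rle_trans; [exact Hm|]; apply Rmult_le_compat_l; [apply pow2_ge_0|exact Hc].
- replace (A ^ 2 * (Kc * (12 / 10) ^ k) * (2 * (Ka * Kb * (72 / 100) ^ k)))
    with (A ^ 2 * Kc * (2 * (Ka * Kb)) * ((12 / 10) ^ k * (72 / 100) ^ k)) by ring.
  rewrite <- (Rmult_1_r (A ^ 2 * Kc * (2 * (Ka * Kb)))) at 2; apply Rmult_le_compat_l; [|exact Hpp].
  repeat apply Rmult_le_pos; lra.
Qed.

(** For [x <= 2] the decay in [m / x] is a decay in [m], which compensates the power of [m] left
    over by [t_bound]. *)
Lemma W_term_small_x (W : C -> C -> C -> C) (lambda n : R) : t_bound W lambda n ->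
  exists K, 0 < K /\ forall m x, 0 < m -> 1 <= x <= 2 -> m ^ 2 * Cmod (W_term W lambda n m x) <= K.
Proof.
intros [K [c [HK [Hc H]]]].
exists (2 * K * (2 / c)); split; [apply Rmult_lt_0_compat; [lra|apply Rdiv_lt_0_compat; lra]|].
intros m x Hm Hx; specialize (H m x Hm (proj1 Hx)).
set (T := Cmod (W_term W lambda n m x)) in *.
assert (HT : 0 <= T) by apply Cmod_ge_0.
assert (Hix : 0 < / x <= 1) by (split; [apply Rinv_0_lt_compat; lra|rewrite <- Rinv_1; apply Rinv_le_contravar; lra]).
assert (Hs : sqrt (/ x) <= 1) by (rewrite <- sqrt_1; apply sqrt_le_1_alt; lra).
assert (Hs0 := sqrt_pos (/ x)).
assert (E : exp (- (c * (m / x))) <= exp (- (c / 2 * m))).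
{ apply exp_le; assert (m / 2 <= m / x) by (apply Rmult_le_compat_l; [lra|apply Rinv_le_contravar; lra]). nra. }
assert (Hq : 0 < exp (- (c * (m / x)))) by apply exp_pos.
assert (Hq2 : 0 < exp (- (c / 2 * m))) by apply exp_pos.
assert (HB : m / x * T <= K * exp (- (c / 2 * m))).
{ eapply Rle_trans; [exact H|]; apply Rmult_le_compat_l; [lra|]; nra. }
assert (HM : m * exp (- (c / 2 * m)) <= 2 / c).
{ rewrite exp_Ropp; apply Rmult_le_reg_r with (exp (c / 2 * m)); [apply exp_pos|].
  rewrite Rmult_assoc, Rinv_l by (apply Rgt_not_eq, exp_pos).
  apply Rle_trans with (2 / c * (c / 2 * m)); [right; field; lra|].
  apply Rmult_le_compat_l; [left; apply Rdiv_lt_0_compat; lra|]; generalize (exp_ineq1_le (c / 2 * m)); lra. }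
replace (m ^ 2 * T) with (m * x * (m / x * T)) by (field; lra).
apply Rle_trans with (m * 2 * (K * exp (- (c / 2 * m)))).
- apply Rmult_le_compat; [apply Rmult_le_pos; lra| |apply Rmult_le_compat_l; lra|exact HB].
  apply Rmult_le_pos; [apply Rmult_le_pos; lra|exact HT].
- replace (m * 2 * (K * exp (- (c / 2 * m)))) with (2 * K * (m * exp (- (c / 2 * m)))) by ring.
  apply Rmult_le_compat_l; lra.
Qed.

Lemma coefP_minus_W (W : C -> C -> C -> C) (lambda n x : R) (k : nat) : 1 <= x -> 0 < n + INR k ->
  let l := ell lambda in
  Cmod (coefP l (n + INR k) n x - RtoC (-1) ^ k / Cpower (RtoC (n + INR k)) (l + RtoC 1)
     * rGamma (RtoC n - l) * W (RtoC n) (Ci * RtoC lambda) (RtoC (2 * (n + INR k) / x)))%C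
  = Cmod (P_coef l n k x - W_term W lambda n (n + INR k) x)%C.
Proof.
intros Hx Hm l; unfold l at 1; unfold ell; rewrite coefP_P_coef by exact Hx; fold (ell lambda); fold l.
rewrite Cpower_pos by exact Hm; fold (rcpow (n + INR k) (l + RtoC 1)).
unfold W_term; fold l; rewrite rcpow_opp.
match goal with |- Cmod ?z = Cmod ?w => replace z with (RtoC (-1) ^ k * w)%C by (unfold Cdiv; ring) end.
rewrite Cmod_mult, Cmod_pow, Cmod_R, Rabs_left by lra; replace (- -1) with 1 by ring; rewrite pow1; ring.
Qed.

Theorem theorem1p3 :
  forall W : C -> C -> C -> C, is_whittaker_W W ->
  forall n lambda : R,
  let l : C := (RtoC (- / 2) + Ci * RtoC lambda)%C in
  is_finite (Lub_Rbar (fun v : R =>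
    exists (x m : R) (k : nat),
      1 <= x /\ m = n + INR k /\ 0 < m /\
      v = Cmod (coefP l m n x
                - RtoC (-1) ^ k / Cpower (RtoC m) (l + RtoC 1)
                  * rGamma (RtoC n - l)
                  * W (RtoC n) (Ci * RtoC lambda) (RtoC (2 * m / x)))%C
          * sqrt x * m ^ 2)).
Proof.
intros W HW n lambda l.
destruct (archimed (Rabs n)) as [Hup _].
(* Larger than [|n|], so that it serves twice: as the induction depth, by [n < 1/2 + N], and as an
   index with [n + N > 0]. *)
set (N := Z.to_nat (up (Rabs n))).
assert (HN : Rabs n < INR N).
{ unfold N; rewrite INR_IZR_INZ, Z2Nat.id; [exact Hup|]; apply le_IZR; generalize (Rabs_pos n); lra. }
assert (Hn1 := Rle_abs n); assert (Hn2 := Rle_abs (- n)); rewrite Rabs_Ropp in Hn2.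
destruct (bounds_all W lambda HW N n ltac:(lra)) as [HT HD].
destruct (P_coef_small_x l n (Re_ell lambda)) as [K1 [HK1 B1]].
destruct (W_term_small_x W lambda n HT) as [K2 [HK2 B2]].
destruct HD as [K3 [c [HK3 [Hc B3]]]].
set (E := fun v : R => _).
assert (HB : forall v, E v -> v <= 2 * (K1 + K2) + K3).
{ intros v [x [m [k [Hx [-> [Hm ->]]]]]].
  assert (Ed := coefP_minus_W W lambda n x k Hx Hm); cbv zeta in Ed; change (ell lambda) with l in Ed; rewrite Ed.
  set (m := n + INR k) in *; set (D := Cmod _).
  assert (Hsx := sqrt_lt_R0 x ltac:(lra)).
  replace (D * sqrt x * m ^ 2) with (sqrt x * (m ^ 2 * D)) by ring.
  destruct (Rle_lt_dec x 2) as [H2|H2].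
  - assert (Hs2 : sqrt x <= 2).
    { rewrite <- (sqrt_square 2) by lra; apply sqrt_le_1_alt; lra. }
    assert (HmD : m ^ 2 * D <= K1 + K2).
    { apply Rle_trans with (m ^ 2 * (Cmod (P_coef l n k x) + Cmod (W_term W lambda n m x))).
      - apply Rmult_le_compat_l; [apply pow2_ge_0|]; unfold D, Cminus.
        eapply Rle_trans; [apply Cmod_triangle|]; rewrite Cmod_opp; lra.
      - rewrite Rmult_plus_distr_l; apply Rplus_le_compat; [apply B1|apply B2]; auto. }
    assert (0 <= m ^ 2 * D) by (apply Rmult_le_pos; [apply pow2_ge_0|apply Cmod_ge_0]).
    assert (sqrt x * (m ^ 2 * D) <= 2 * (K1 + K2)) by (apply Rmult_le_compat; lra).
    lra.
  - specialize (B3 k x Hm ltac:(lra)); change (ell lambda) with l in B3; fold m in B3; fold D in B3.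
    apply Rle_trans with (sqrt x * (K3 * (sqrt (/ x) * exp (- (c * (m / x)))))).
    + apply Rmult_le_compat_l; lra.
    + rewrite sqrt_inv.
      replace (sqrt x * (K3 * (/ sqrt x * exp (- (c * (m / x)))))) with (K3 * exp (- (c * (m / x)))) by (field; lra).
      assert (exp (- (c * (m / x))) <= 1).
      { rewrite <- exp_0; apply exp_le; assert (0 < m / x) by (apply Rdiv_lt_0_compat; lra). nra. }
      nra. }
(* The supremum of an empty set would be minus infinity, so finiteness also needs an element:
   [x = 1] and [k = N] provide one. *)
assert (HE : exists v, E v).
{ eexists; exists 1, (n + INR N), N; split; [lra|]; split; [reflexivity|]; split; [lra|reflexivity]. }
destruct HE as [v0 Hv0].
destruct (Lub_Rbar_correct E) as [L1 L2].
assert (U : Rbar_le (Lub_Rbar E) (2 * (K1 + K2) + K3)) by (apply L2; intros v Hv; apply HB, Hv).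
specialize (L1 v0 Hv0).
destruct (Lub_Rbar E) as [r| |]; [reflexivity|contradiction|contradiction].
Qed.
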